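(* Up to isomorphism of graded Lie algebras, $(E_6,\Sigma_{1,6})$ and $(F_4,\Sigma_4)$ are the only complex exceptional simple graded Lie algebras $\mathfrak g=\bigoplus_p\mathfrak g_p$ with a $|2|$-grading whose negative part $\mathfrak g_-=\mathfrak g_{-2}\oplus\mathfrak g_{-1}$ is (isomorphic as a graded Lie algebra to) the complexification $\mathfrak n\otimes\mathbb C$ of a pseudo $H$-type Lie algebra $\mathfrak n=\mathfrak n_{-2}\oplus\mathfrak n_{-1}$ with $\dim\mathfrak n_{-2}>1$. (Both of these graded Lie algebras have this property, and no other one does.)
   Context: $|2|$-gradings: let $\mathfrak g$ be a complex simple Lie algebra with Cartan subalgebra $\mathfrak h$, simple roots $\alpha_1,\dots,\alpha_r$ in Bourbaki numbering, and root spaces $\mathfrak g_\alpha$. For a set $\Sigma$ of simple roots and a root $\alpha=\sum_i a_i\alpha_i$, put $\mathrm{ht}_\Sigma(\alpha)=\sum_{i:\alpha_i\in\Sigma}a_i$. Set $\mathfrak g_k=\bigoplus_{\mathrm{ht}_\Sigma(\alpha)=k}\mathfrak g_\alpha$ for $k\ne0$ and $\mathfrak g_0=\mathfrak h\oplus\bigoplus_{\mathrm{ht}_\Sigma(\alpha)=0}\mathfrak g_\alpha$. If the highest root has $\Sigma$-height $2$ this is a $|2|$-grading, and all $|2|$-gradings are understood to arise in this way; $(\mathfrak g,\Sigma)$ denotes the resulting graded Lie algebra. Here $\Sigma_{1,6}=\{\alpha_1,\alpha_6\}$ in $E_6$ (the two ends of the long arms of the Dynkin diagram), and $\Sigma_4=\{\alpha_4\}$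 in $F_4$ (the short simple root at the end of the diagram). The exceptional Lie algebras are $E_6,E_7,E_8,F_4,G_2$. A pseudo $H$-type Lie algebra is a real graded 2-step nilpotent Lie algebra $\mathfrak n=\mathfrak n_{-2}\oplus\mathfrak n_{-1}$ (with $[\mathfrak n_{-1},\mathfrak n_{-1}]\subset\mathfrak n_{-2}$ and $\mathfrak n_{-2}$ central) endowed with a non-degenerate symmetric bilinear form $\langle\cdot,\cdot\rangle=\langle\cdot,\cdot\rangle_{\mathfrak n_{-2}}+\langle\cdot,\cdot\rangle_{\mathfrak n_{-1}}$ with $\langle\cdot,\cdot\rangle_{\mathfrak n_{-2}}$ non-degenerate, such that the maps $J_z\in\mathrm{End}(\mathfrak n_{-1})$, $z\in\mathfrak n_{-2}$, defined by $\langle J_zx,y\rangle_{\mathfrak n_{-1}}=\langle[x,y],z\rangle_{\mathfrak n_{-2}}$ for all $x,y\in\mathfrak n_{-1}$ satisfy $J_z^2=-\langle z,z\rangle_{\mathfrak n_{-2}}\mathrm{Id}_{\mathfrak n_{-1}}$. *)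

(* Defs.v *)
(* Mathematical Components, with realType and classical sets from
   MathComp-Analysis. *)
From HB Require Import structures.
From mathcomp Require Import all_boot all_order all_algebra sesquilinear.
From mathcomp Require Import complex.
From mathcomp Require Import mathcomp_extra boolp classical_sets reals.

Set Implicit Arguments.
Unset Strict Implicit.
Unset Printing Implicit Defensive.

Import VectorInternalTheory Order.TTheory GRing.Theory Num.Theory.
Local Open Scope classical_set_scope.
Local Open Scope ring_scope.

HB.mixin Record Vector_isLieAlgebra (K : fieldType) L of Vector K L := {
  lie : L -> L -> L;
  lie_linearl : forall y, linear (lie ^~ y);
  lie_linearr : forall x, linear (lie x);
  liexx : forall x, lie x x = 0;
  lie_jacobi : forall x y z,
    lie x (lie y z) + lie y (lie z x) + lie z (lie x y) = 0
}.

(* Finite-dimensional Lie algebras over K. *)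
#[short(type="lieAlgType")]
HB.structure Definition LieAlgebra (K : fieldType) :=
  { L of Vector_isLieAlgebra K L & Vector K L }.

Notation "[lie x , y ]" := (lie x y)
  (at level 0, x, y at level 99, format "[lie  x ,  y ]") : ring_scope.

Section LinSpan.
Variables (K : fieldType) (V : vectType K).

Definition lin_span (S : set V) : set V :=
  [set x | exists (m : nat) (c : 'I_m -> K) (v : 'I_m -> V),
     (forall i, S (v i)) /\ x = \sum_i c i *: v i].

End LinSpan.

Section LieTheory.
Variables (K : fieldType) (L : lieAlgType K).
Implicit Types (x y z : L) (c : K).

Lemma lieDl x y z : [lie x + y, z] = [lie x, z] + [lie y, z].
Proof. by have /(_ 1 x y) := lie_linearl z; rewrite !scale1r. Qed.

Lemma lieDr x y z : [lie x, y + z] = [lie x, y] + [lie x, z].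
Proof. by have /(_ 1 y z) := lie_linearr x; rewrite !scale1r. Qed.

Lemma lie0l x : [lie 0, x] = 0.
Proof. by apply: (addIr [lie 0, x]); rewrite -lieDl !add0r. Qed.

Lemma lie0r x : [lie x, 0] = 0.
Proof. by apply: (addIr [lie x, 0]); rewrite -lieDr !add0r. Qed.

Lemma lieZl c x y : [lie c *: x, y] = c *: [lie x, y].
Proof. by have /(_ c x 0) := lie_linearl y; rewrite !addr0 lie0l addr0. Qed.

Lemma lieZr c x y : [lie x, c *: y] = c *: [lie x, y].
Proof. by have /(_ c y 0) := lie_linearr x; rewrite !addr0 lie0r addr0. Qed.

Lemma lieNl x y : [lie - x, y] = - [lie x, y].
Proof. by rewrite -scaleN1r lieZl scaleN1r. Qed.

Lemma lieNr x y : [lie x, - y] = - [lie x, y].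
Proof. by rewrite -scaleN1r lieZr scaleN1r. Qed.

Lemma lieC x y : [lie x, y] = - [lie y, x].
Proof.
apply/eqP; rewrite -addr_eq0; apply/eqP.
by have := liexx (x + y); rewrite !(lieDl, lieDr) !liexx add0r addr0.
Qed.

End LieTheory.

(* phi identifies L with the subspace of L' spanned by the pieces G' k. When G'
   is a grading of L', this is an isomorphism of L onto L'; when G' is the
   negative part of a grading of L', it is an isomorphism of L onto the
   subalgebra of negative degree. In all uses below the G k span L. *)
Definition graded_lie_iso (K : fieldType) (L L' : lieAlgType K)
    (G : int -> set L) (G' : int -> set L') : Prop :=
  exists phi : 'Hom(L, L'),
    [/\ injective phi,
        forall x y, phi [lie x, y] = [lie phi x, phi y] &
        forall k, phi @` G k = G' k].

Definition negative_part (K : fieldType) (L : lieAlgType K)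
    (G : int -> set L) (k : int) : set L :=
  if k < 0 then G k else [set 0].

Section RootData.
Variables (K : fieldType) (L : lieAlgType K).

Definition simple_lie : Prop :=
  (exists x y : L, [lie x, y] != 0) /\
  (forall I : {vspace L}, (forall x y, y \in I -> [lie x, y] \in I) ->
     I = 0%VS \/ I = fullv).

Definition abelian_subspace (U : {vspace L}) : Prop :=
  forall x y, x \in U -> y \in U -> [lie x, y] = 0.

Definition ad_diagonalizable (x : L) : Prop :=
  exists e : seq L, basis_of fullv e /\
    forall v, v \in e -> exists c : K, [lie x, v] = c *: v.

(* The usual definition for semisimple Lie algebras over an algebraically closed
   field of characteristic 0. *)
Definition cartan_subalgebra (h : {vspace L}) : Prop :=
  [/\ abelian_subspace h,
      forall x, x \in h -> ad_diagonalizable x &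
      forall U, abelian_subspace U -> (h <= U)%VS -> U = h].

Variable h : {vspace L}.

Definition functional := 'Hom(subvs_of h, K^o).

Definition root_space (b : functional) : set L :=
  [set x | forall H : subvs_of h, [lie vsval H, x] = (b H : K) *: x].

Definition is_root (b : functional) : Prop :=
  b <> 0 /\ exists2 x, root_space b x & x <> 0.

(* H is the coroot of b: the element of [g_b, g_(-b)] on which b equals 2. *)
Definition is_coroot (b : functional) (H : subvs_of h) : Prop :=
  (exists x y, [/\ root_space b x, root_space (- b) y &
                   vsval H = [lie x, y]]) /\
  b H = 2.

Variables (r : nat) (alpha : 'I_r -> functional).

Definition root_of (a : 'I_r -> int) : functional := \sum_i alpha i *~ a i.

Definition simple_roots : Prop :=
  [/\ forall i, is_root (alpha i),
      free (codom alpha) &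
      forall b, is_root b -> exists a : 'I_r -> int, b = root_of a /\
        ((forall i, 0 <= a i) \/ (forall i, a i <= 0))].

(* A i j = <alpha_i, alpha_j^vee>, the convention of Bourbaki. *)
Definition has_cartan_matrix (A : 'M[int]_r) : Prop :=
  exists H : 'I_r -> subvs_of h,
    (forall i, is_coroot (alpha i) (H i)) /\
    (forall i j, alpha i (H j) = (A i j)%:~R).

Variable Sigma : {set 'I_r}.

Definition height (a : 'I_r -> int) : int := \sum_(i in Sigma) a i.

Definition sigma_grading (k : int) : set L :=
  lin_span ([set x | k = 0 /\ x \in h] `|`
            [set x | exists a, [/\ is_root (root_of a), height a = k &
                                   root_space (root_of a) x]]).

Definition highest_root (a : 'I_r -> int) : Prop :=
  is_root (root_of a) /\
  forall b : 'I_r -> int, is_root (root_of b) -> forall i, b i <= a i.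

Definition two_grading : Prop := exists2 a, highest_root a & height a = 2.

End RootData.

Arguments simple_lie {K} L.

Inductive exceptional := E6 | E7 | E8 | F4 | G2.

Definition rank (t : exceptional) : nat :=
  match t with E6 => 6 | E7 => 7 | E8 => 8 | F4 => 4 | G2 => 2 end.

Definition cartan_rows (t : exceptional) : seq (seq int) :=
  match t with
  | E6 => [:: [::  2;  0; -1;  0;  0;  0];
              [::  0;  2;  0; -1;  0;  0];
              [:: -1;  0;  2; -1;  0;  0];
              [::  0; -1; -1;  2; -1;  0];
              [::  0;  0;  0; -1;  2; -1];
              [::  0;  0;  0;  0; -1;  2]]
  | E7 => [:: [::  2;  0; -1;  0;  0;  0;  0];
              [::  0;  2;  0; -1;  0;  0;  0];
              [:: -1;  0;  2; -1;  0;  0;  0];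
              [::  0; -1; -1;  2; -1;  0;  0];
              [::  0;  0;  0; -1;  2; -1;  0];
              [::  0;  0;  0;  0; -1;  2; -1];
              [::  0;  0;  0;  0;  0; -1;  2]]
  | E8 => [:: [::  2;  0; -1;  0;  0;  0;  0;  0];
              [::  0;  2;  0; -1;  0;  0;  0;  0];
              [:: -1;  0;  2; -1;  0;  0;  0;  0];
              [::  0; -1; -1;  2; -1;  0;  0;  0];
              [::  0;  0;  0; -1;  2; -1;  0;  0];
              [::  0;  0;  0;  0; -1;  2; -1;  0];
              [::  0;  0;  0;  0;  0; -1;  2; -1];
              [::  0;  0;  0;  0;  0;  0; -1;  2]]
  | F4 => [:: [::  2; -1;  0;  0];
              [:: -1;  2; -2;  0];
              [::  0; -1;  2; -1];
              [::  0;  0; -1;  2]]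
  | G2 => [:: [::  2; -1];
              [:: -3;  2]]
  end.

Definition cartan_matrix (t : exceptional) : 'M[int]_(rank t) :=
  \matrix_(i, j) nth 0 (nth [::] (cartan_rows t) i) j.

(* L is the simple Lie algebra of type t, with Cartan subalgebra h and simple
   roots alpha numbered as in Bourbaki. *)
Definition exceptional_lie (K : fieldType) (t : exceptional)
    (L : lieAlgType K) (h : {vspace L}) (alpha : 'I_(rank t) -> functional h) :=
  [/\ simple_lie L, cartan_subalgebra h, simple_roots alpha &
      has_cartan_matrix alpha (cartan_matrix t)].

Arguments exceptional_lie {K} t {L h} alpha.

(* Bourbaki's alpha_k is the value of alpha at the ordinal k - 1. *)
Definition nodes (r : nat) (s : seq nat) : {set 'I_r} :=
  [set i : 'I_r | i.+1 \in s]%SET.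

Definition Sigma16 : {set 'I_(rank E6)} := nodes (rank E6) [:: 1%N; 6%N].
Definition Sigma4 : {set 'I_(rank F4)} := nodes (rank F4) [:: 4%N].

(* The graded Lie algebra (L, G) is isomorphic to (g, Sigma), with g of type
   t. *)
Definition graded_iso_to (K : fieldType) (L : lieAlgType K) (G : int -> set L)
    (t : exceptional) (Sigma : {set 'I_(rank t)}) : Prop :=
  exists (L' : lieAlgType K) (h' : {vspace L'})
         (alpha' : 'I_(rank t) -> functional h'),
    exceptional_lie t alpha' /\ graded_lie_iso G (sigma_grading alpha' Sigma).

Arguments graded_iso_to {K L} G t Sigma.

(* The complexification of a real vector space V is V (+) iV, the pair (x, y)
   standing for x + i y. *)
Definition complexified (R : realType) (V : Type) : Type := (V * V)%type.

Section ComplexifiedVector.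
Variables (R : realType) (V : vectType R).
Local Notation VC := (complexified R V).

HB.instance Definition _ := GRing.Zmodule.copy VC (V * V)%type.

Definition complexified_scale (c : R[i]) (u : VC) : VC :=
  (complex.Re c *: u.1 - complex.Im c *: u.2,
   complex.Re c *: u.2 + complex.Im c *: u.1).

Fact complexified_scaleA a b u :
  complexified_scale a (complexified_scale b u) = complexified_scale (a * b) u.
Proof.
case: a b u => [a a'] [b b'] [x y]; rewrite /complexified_scale /=.
congr pair; rewrite !(scalerDr, scalerBr, scalerDl, scalerN, scaleNr, scalerA).
  by rewrite !opprD -!addrA; congr (_ + _); rewrite [RHS]addrC -addrA.
by rewrite -!addrA; congr (_ + _); rewrite addrA addrC.
Qed.

Fact complexified_scale1 : left_id 1 complexified_scale.
Proof.
by case=> x y; rewrite /complexified_scale /= !scale1r !scale0r subr0 addr0.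
Qed.

Fact complexified_scaleDr : right_distributive complexified_scale +%R.
Proof.
case=> a a' [x y] [x' y']; rewrite /complexified_scale /=; congr pair => /=.
  by rewrite !scalerDr opprD addrACA.
by rewrite !scalerDr addrACA.
Qed.

Fact complexified_scaleDl u :
  {morph complexified_scale^~ u : a b / a + b}.
Proof.
case: u => x y [a a'] [b b']; rewrite /complexified_scale /=; congr pair => /=.
  by rewrite !scalerDl opprD addrACA.
by rewrite !scalerDl addrACA.
Qed.

HB.instance Definition _ := GRing.Zmodule_isLmodule.Build R[i] VC
  complexified_scaleA complexified_scale1 complexified_scaleDr
  complexified_scaleDl.

Definition complexified_v2r (u : VC) : 'rV[R[i]]_(dim V) :=
  \row_j Complex (v2r u.1 0 j) (v2r u.2 0 j).

Definition complexified_r2v (w : 'rV[R[i]]_(dim V)) : VC :=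
  (r2v (\row_j complex.Re (w 0 j)), r2v (\row_j complex.Im (w 0 j))).

Fact complexified_vect_axiom : Vector.axiom (dim V) VC.
Proof.
exists complexified_v2r; last first.
  exists complexified_r2v.
    case=> x y; rewrite /complexified_r2v /complexified_v2r.
    by congr pair; rewrite -[RHS]v2rK; congr r2v; apply/rowP => j; rewrite !mxE.
  move=> w; apply/rowP => j; rewrite !mxE /= !r2vK !mxE.
  by case: (w 0 j).
move=> [a a'] [x y] [x' y']; apply/rowP => j.
rewrite !mxE /= !linearD !linearN !linearZ /= !mxE.
by apply/eqP; rewrite eq_complex /= mulrN eqxx addrC; apply/eqP.
Qed.

HB.instance Definition _ :=
  Lmodule_hasFinDim.Build R[i] VC complexified_vect_axiom.

Definition complexified_subspace (U : {vspace V}) : set VC :=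
  [set u | u.1 \in U /\ u.2 \in U].

End ComplexifiedVector.

Section ComplexifiedLie.
Variables (R : realType) (n : lieAlgType R).
Local Notation nC := (complexified R n).

Definition complexified_lie (u v : nC) : nC :=
  ([lie u.1, v.1] - [lie u.2, v.2], [lie u.1, v.2] + [lie u.2, v.1]).

Fact complexified_lie_linearl v : linear (complexified_lie ^~ v).
Proof.
move=> c u w; have cD : complexified_lie (c *: u + w) v =
    complexified_lie (c *: u) v + complexified_lie w v.
  rewrite /complexified_lie; congr pair => /=.
    by rewrite !lieDl opprD addrACA.
  by rewrite !lieDl addrACA.
rewrite cD; congr (_ + _); case: c u v {w cD} => [a a'] [x x'] [y y'].
rewrite /complexified_lie; congr pair => /=.
  rewrite !(lieDl, lieZl, lieNl, scalerDr, scalerN, opprD) -!addrA.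
  by rewrite !addrA [LHS](ACl (1*3*4*2)).
rewrite !(lieDl, lieZl, lieNl, scalerDr, scalerN, opprD) -!addrA.
by rewrite !addrA [LHS](ACl (1*3*4*2)).
Qed.

Fact complexified_liexx u : complexified_lie u u = 0.
Proof.
case: u => x y; rewrite /complexified_lie /= !liexx subr0.
by rewrite (lieC y x) subrr.
Qed.

Fact complexified_lieC u v : complexified_lie u v = - complexified_lie v u.
Proof.
apply/eqP; rewrite -addr_eq0; apply/eqP.
have D x y z : complexified_lie (x + y) z =
    complexified_lie x z + complexified_lie y z.
  by have := complexified_lie_linearl z 1 x y; rewrite !scale1r.
have D' x y z : complexified_lie z (x + y) =
    complexified_lie z x + complexified_lie z y.
  rewrite /complexified_lie; congr pair => /=; last by rewrite !lieDr addrACA.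
  by rewrite !lieDr opprD addrACA.
by have := complexified_liexx (u + v); rewrite D !D' !complexified_liexx
  add0r addr0.
Qed.

Fact complexified_lie_linearr u : linear (complexified_lie u).
Proof.
move=> c v w; rewrite complexified_lieC complexified_lie_linearl opprD -scalerN.
by rewrite -!complexified_lieC.
Qed.

Fact complexified_lie_jacobi u v w :
  complexified_lie u (complexified_lie v w) +
  complexified_lie v (complexified_lie w u) +
  complexified_lie w (complexified_lie u v) = 0.
Proof.
case: u v w => [x x'] [y y'] [z z'].
pose J (a b c : n) := [lie a, [lie b, c]] + [lie b, [lie c, a]] +
  [lie c, [lie a, b]].
have J0 a b c : J a b c = 0 by exact: lie_jacobi.
congr pair => /=; rewrite !(lieDl, lieDr, lieNl, lieNr, opprD, opprK).
- transitivity (J x y z - J x y' z' - J x' y z' - J x' y' z); last first.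
    by rewrite !J0 !subr0.
  rewrite /J !opprD !addrA.
  by rewrite [LHS](ACl (1*5*9*2*8*11*3*6*12*4*7*10)).
- transitivity (J x y z' + J x y' z + J x' y z - J x' y' z'); last first.
    by rewrite !J0 subr0 !addr0.
  rewrite /J !opprD !addrA.
  by rewrite [LHS](ACl (1*6*11*2*7*9*3*5*10*4*8*12)).
Qed.

HB.instance Definition _ := Vector_isLieAlgebra.Build R[i] nC
  complexified_lie_linearl complexified_lie_linearr complexified_liexx
  complexified_lie_jacobi.

End ComplexifiedLie.

(* n = n2 (+) n1 with n2 in degree -2 and n1 in degree -1. The class is exactly
   2: n is not abelian. *)
Definition graded_two_step (K : fieldType) (n : lieAlgType K)
    (n2 n1 : {vspace n}) : Prop :=
  [/\ (n2 + n1)%VS = fullv /\ (n2 :&: n1)%VS = 0%VS,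
      forall x y, x \in n1 -> y \in n1 -> [lie x, y] \in n2,
      forall z x, z \in n2 -> [lie z, x] = 0 &
      exists x y : n, [lie x, y] != 0].

Definition nondegenerate_on (K : fieldType) (V : vectType K) (B : V -> V -> K)
    (U : {vspace V}) : Prop :=
  forall x, x \in U -> (forall y, y \in U -> B x y = 0) -> x = 0.

(* J z is unique, B being non-degenerate on n1. *)
Definition pseudo_H_type (K : fieldType) (n : lieAlgType K)
    (n2 n1 : {vspace n}) : Prop :=
  graded_two_step n2 n1 /\
  exists (B : {biscalar n}) (J : subvs_of n2 -> 'End(subvs_of n1)),
    [/\ forall x y, B x y = B y x,
        forall z x, z \in n2 -> x \in n1 -> B z x = 0,
        nondegenerate_on B fullv /\ nondegenerate_on B n2,
        forall (z : subvs_of n2) (x y : subvs_of n1),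
          B (vsval (J z x)) (vsval y) = B [lie vsval x, vsval y] (vsval z) &
        forall z x, J z (J z x) = - B (vsval z) (vsval z) *: x].

Definition complexified_grading (R : realType) (n : lieAlgType R)
    (n2 n1 : {vspace n}) (k : int) : set (complexified R n) :=
  if k == -2 then complexified_subspace n2
  else if k == -1 then complexified_subspace n1
  else [set 0].

Definition negative_part_pseudo_H (R : realType) (L : lieAlgType R[i])
    (G : int -> set L) : Prop :=
  exists (n : lieAlgType R) (n2 n1 : {vspace n}),
    [/\ pseudo_H_type n2 n1, (1 < \dim n2)%N &
        graded_lie_iso (complexified_grading n2 n1) (negative_part G)].

(* Main.v *)
Require Import Defs.
From HB Require Import structures.
From mathcomp Require Import all_boot all_order all_algebra sesquilinear.
From mathcomp Require Import complex ring zify.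
From mathcomp Require Import mathcomp_extra boolp classical_sets reals.

(* Simple roots and coroots give sl2-triples (e_i, f_i, H_i); weight-string
   arguments show that the roots are those of an explicit list, that root
   spaces are lines, and that the negative root spaces have vectors f_a with
   [f_a, f_b] = N(a, b) f_(a + b) for computed integers N(a, b).

   Over C, the form [x, y] |-> B([x, y], z) of an H-type algebra is degenerate
   exactly for isotropic z, and if z_1, ..., z_k span an isotropic subspace of
   the centre, the J_(z_i) anticommute and have square 0, so they have a common
   kernel. When dim g_(-2) > 1 and the grading is not (E6, Sigma_{1,6}) or
   (F4, Sigma_4), some roots of degree -2 violate this.

   In the two remaining cases the real span of the f_a of negative degree is of
   pseudo H-type, for split forms with monomial J_z. *)

Set Implicit Arguments.
Unset Strict Implicit.
Unset Printing Implicit Defensive.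

Import Order.TTheory GRing.Theory Num.Theory.
Local Open Scope ring_scope.

(** * Weight vectors of sl2 *)

(** No real structure on g is given: the hypothesis only says that some real n complexifies to g_-.
    The obstruction therefore has to live over C, where isotropic vectors exist whatever the
    signature of the form. The form is not assumed invariant under g_0 either, so the isotropy of
    chosen central vectors must be read off from brackets alone, through radicals.

    The lists in [obstruction_roots] are chains in g_(-2): each root is the previous one plus a
    simple root outside Sigma. For (E8, alpha_1) and (E7, alpha_6), where g_(-2) is the vector
    representation of D7 and D5, they have 7 and 5 members, half the dimension, as maximal isotropic
    subspaces do.

    In the two good cases g_(-2) is the vector representation of D4 or B3 and g_(-1) a spin module
    of dimension 16 or 8, which is why Clifford relations are to be expected there. *)

Section Independence.
Variables (K : fieldType) (V : vectType K) (T : Type) (I : eqType).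
Variables (D : T -> {linear V -> V}) (l : I -> T -> K).

(** Applying [D t - l j t] to the relation removes [v j], and a [t] separating [i] from [j] keeps a
    nonzero multiple of [v i]. Different pairs may need different [t]: later the operators are the
    elements of the Cartan subalgebra and the labels are roots. *)
Lemma eigen_sum0 (s : seq I) (v : I -> V) :
  uniq s -> {in s &, forall i j, i != j -> exists t, l i t != l j t} ->
  (forall i t, i \in s -> D t (v i) = l i t *: v i) ->
  \sum_(i <- s) v i = 0 -> forall i, i \in s -> v i = 0.
Proof.
move=> us sep; elim: s us sep v => [//|j s IH] /= /andP[js us] sep v Dv S0.
have vs i : i \in s -> v i = 0.
  move=> si; have [t lt] : exists t, l i t != l j t.
    by apply: sep; rewrite ?inE ?eqxx ?si ?orbT //; apply: contraNneq js => <-.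
  have /(_ _ si) : forall k, k \in s -> (l k t - l j t) *: v k = 0.
    apply: IH => // [k k' sk sk'|k u sk|].
    - by apply: sep; rewrite inE ?sk ?sk' orbT.
    - by rewrite linearZ /= Dv ?inE ?sk ?orbT // !scalerA mulrC.
    transitivity (D t (\sum_(k <- j :: s) v k) - l j t *: \sum_(k <- j :: s) v k).
      rewrite linear_sum scaler_sumr -sumrB big_cons Dv ?inE ?eqxx // subrr add0r.
      apply: eq_big_seq => k sk.
      by rewrite Dv ?inE ?sk ?orbT // scalerBl.
    by rewrite S0 linear0 scaler0 subrr.
  by move/eqP; rewrite scaler_eq0 subr_eq0 (negPf lt) => /eqP.
move=> i; rewrite inE => /predU1P[->|/vs//].
by move: S0; rewrite big_cons big_seq big1 ?addr0.
Qed.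

Lemma eigen_free (s : seq I) (v : I -> V) :
  uniq s -> {in s &, forall i j, i != j -> exists t, l i t != l j t} ->
  (forall i t, i \in s -> D t (v i) = l i t *: v i) ->
  (forall i, i \in s -> v i != 0) -> free [seq v i | i <- s].
Proof.
move=> us sep Dv v0; case: s => [|i0 s'] in us sep Dv v0 *; first exact: nil_free.
set s := i0 :: s' in us sep Dv v0 *.
have szs : size [seq v i | i <- s] == size s by rewrite size_map.
suff : free (Tuple szs) by [].
apply/freeP => k S0 j.
pose c i := if insub (index i s) is Some j then k j else 0.
have cE (m : 'I_(size s)) : c (nth i0 s m) = k m.
  by rewrite /c index_uniq // valK.
have := eigen_sum0 (v := fun i => c i *: v i) us sep.
move=> /(_ _ _ _ (mem_nth i0 (ltn_ord j))); rewrite cE => H.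
have /eqP : k j *: v (nth i0 s j) = 0.
  apply: H => [i t si|]; first by rewrite linearZ /= Dv // !scalerA mulrC.
  rewrite (big_nth i0) big_mkord -[RHS]S0; apply: eq_bigr => m _ /=.
  by rewrite -/s cE; congr (_ *: _); rewrite -(nth_map i0 0 v (ltn_ord m)).
by rewrite scaler_eq0 (negPf (v0 _ (mem_nth i0 (ltn_ord j)))) orbF => /eqP.
Qed.

End Independence.

Section Sl2.
Variables (K : numFieldType) (L : lieAlgType K).
Implicit Types (x y z u v w : L).

HB.instance Definition _ x :=
  GRing.isLinear.Build K L L *:%R (lie x) (lie_linearr x).

Lemma lie_lie x y z : [lie x, [lie y, z]] = [lie [lie x, y], z] + [lie y, [lie x, z]].
Proof.
have := lie_jacobi x y z.
rewrite (lieC z [lie x, y]) (lieC z x) lieNr => /eqP.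
by rewrite subr_eq0 => /eqP <-; rewrite subrK.
Qed.

Lemma no_eigen_sequence u (v : nat -> L) (l : nat -> K) :
  injective l -> (forall n, [lie u, v n] = l n *: v n) -> exists n, v n = 0.
Proof.
move=> linj uv; apply: contrapT => vn0.
have v0 n : v n != 0 by apply/eqP => vn; apply: vn0; exists n.
pose d := \dim (@fullv K L).
have : free [seq v i | i <- iota 0 d.+1].
  apply: (@eigen_free K L unit nat (fun=> lie u) (fun i => fun=> l i)) => //.
    exact: iota_uniq.
    by move=> i j _ _ ij; exists tt; apply: contraNneq ij => /linj ->.
  by move=> i _ _; apply: uv.
set X := map _ _ => /eqP dX.
have : (\dim <<X>> <= d)%N by apply: dimvS; apply: subvf.
by rewrite dX /X size_map size_iota ltnn.
Qed.

Variables (e f H : L).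
Hypotheses (ef : [lie e, f] = H) (He : [lie H, e] = 2 *: e)
  (Hf : [lie H, f] = - 2 *: f).

Lemma lieHe v (c : K) : [lie H, v] = c *: v ->
  [lie H, [lie e, v]] = (c + 2) *: [lie e, v].
Proof. by move=> Hv; rewrite lie_lie He Hv lieZl lieZr -scalerDl addrC. Qed.

Lemma lieHf v (c : K) : [lie H, v] = c *: v ->
  [lie H, [lie f, v]] = (c - 2) *: [lie f, v].
Proof. by move=> Hv; rewrite lie_lie Hf Hv lieZl lieZr -scalerDl addrC. Qed.

Lemma iter_e_weight v (c : K) n : [lie H, v] = c *: v ->
  [lie H, iter n (lie e) v] = (c + 2 * n%:R) *: iter n (lie e) v.
Proof.
move=> Hv; elim: n => [|n IH]; first by rewrite mulr0 addr0.
by rewrite iterS (lieHe IH); congr (_ *: _); rewrite -natr1; ring.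
Qed.

Lemma iter_f_weight v (c : K) n : [lie H, v] = c *: v ->
  [lie H, iter n (lie f) v] = (c - 2 * n%:R) *: iter n (lie f) v.
Proof.
move=> Hv; elim: n => [|n IH]; first by rewrite mulr0 subr0.
by rewrite iterS (lieHf IH); congr (_ *: _); rewrite -natr1; ring.
Qed.

Lemma iter_e_eventually0 v (c : K) : [lie H, v] = c *: v -> v <> 0 ->
  exists2 n, iter n (lie e) v <> 0 & iter n.+1 (lie e) v = 0.
Proof.
move=> Hv v0; have [|n|n n0] := @no_eigen_sequence H (fun n => iter n (lie e) v)
    (fun n => c + 2 * n%:R).
- move=> m n /addrI /mulfI; rewrite pnatr_eq0 => /(_ isT) /eqP.
  by rewrite eqr_nat => /eqP.
- exact: iter_e_weight.
have ex : exists n, iter n (lie e) v == 0 by exists n; apply/eqP.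
case: (ex_minnP ex) => [[|m]] /eqP m0 mmin; first by case: v0.
by exists m => // mm0; have := mmin m; rewrite mm0 eqxx ltnn => /(_ isT).
Qed.

Lemma iter_f_eventually0 v (c : K) : [lie H, v] = c *: v -> v <> 0 ->
  exists2 n, iter n (lie f) v <> 0 & iter n.+1 (lie f) v = 0.
Proof.
move=> Hv v0; have [|n|n n0] := @no_eigen_sequence H (fun n => iter n (lie f) v)
    (fun n => c - 2 * n%:R).
- move=> m n /addrI /oppr_inj /mulfI; rewrite pnatr_eq0 => /(_ isT) /eqP.
  by rewrite eqr_nat => /eqP.
- exact: iter_f_weight.
have ex : exists n, iter n (lie f) v == 0 by exists n; apply/eqP.
case: (ex_minnP ex) => [[|m]] /eqP m0 mmin; first by case: v0.
by exists m => // mm0; have := mmin m; rewrite mm0 eqxx ltnn => /(_ isT).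
Qed.

Lemma e_iter_f v (c : K) n : [lie H, v] = c *: v -> [lie e, v] = 0 ->
  [lie e, iter n.+1 (lie f) v] = (n.+1%:R * (c - n%:R)) *: iter n (lie f) v.
Proof.
move=> Hv ev; elim: n => [|n IH].
  by rewrite /= lie_lie ef Hv ev lie0r addr0; congr (_ *: _); ring.
rewrite iterS lie_lie ef IH (iter_f_weight _ Hv) lieZr -iterS -scalerDl.
by congr (_ *: _); rewrite -!natr1; ring.
Qed.

(** If f^(n+1) v is the first power to vanish, applying e to it gives (n+1)(c - n) f^n v = 0, so c =
    n. *)
Lemma highest_weight_nat v (c : K) : [lie H, v] = c *: v -> [lie e, v] = 0 ->
  v <> 0 -> exists2 n, c = n%:R &
    forall k, (k <= n)%N -> iter k (lie f) v <> 0.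
Proof.
move=> Hv ev v0; have [n n0 n1] := iter_f_eventually0 Hv v0.
exists n.
  have := e_iter_f n Hv ev; rewrite n1 lie0r => /esym/eqP.
  rewrite scaler_eq0 mulf_eq0 pnatr_eq0 /= subr_eq0.
  by case/orP => [/eqP//|/eqP/n0].
move=> k kn k0; apply: n0; rewrite -(subnK kn) iterD k0.
by elim: (n - k)%N => //= m ->; rewrite lie0r.
Qed.

Lemma e_injective v (c : K) : [lie H, v] = c *: v -> c < 0 -> [lie e, v] = 0 -> v = 0.
Proof.
move=> Hv c0 ev; apply: contrapT => /(highest_weight_nat Hv ev) [n cn].
by move: c0; rewrite cn ltrn0.
Qed.

(** Climb to the top e^p v of the string, a highest weight vector of weight n + 2p, then descend n +
    p <= n + 2p steps. The result has weight -n, which gives the invariance of weights under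
    reflection without complete reducibility. *)
Lemma reflect_weight v n : [lie H, v] = n%:R *: v -> v <> 0 ->
  exists p, iter (n + p) (lie f) (iter p (lie e) v) <> 0.
Proof.
move=> Hv v0; have [p p0 p1] := iter_e_eventually0 Hv v0; exists p.
have [m mE] := highest_weight_nat (iter_e_weight p Hv) p1 p0.
apply; suff -> : m = (n + p.*2)%N by rewrite leq_add2l -addnn leq_addr.
by apply/eqP; rewrite -(eqr_nat K) -mE natrD -muln2 natrM mulrC.
Qed.

(* Applying e repeatedly would give vectors with [f, e^(k+1) v] a nonzero
   multiple of e^k v, hence infinitely many weights. *)
Lemma ef_injective v (c : K) : [lie H, v] = c *: v -> 0 < c ->
  [lie e, [lie f, v]] = 0 -> v = 0.
Proof.
move=> Hv c0 efv; apply: contrapT => v0.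
have fe n : exists2 d : K, d < 0 &
    [lie f, iter n.+1 (lie e) v] = d *: iter n (lie e) v.
  elim: n => [|n [d d0 IH]].
    exists (- c); first by rewrite oppr_lt0.
    by rewrite /= lie_lie (lieC f) ef efv addr0 lieNl Hv scaleNr.
  exists (d - (c + 2 * n.+1%:R)).
    by rewrite subr_lt0 (lt_le_trans d0) // addr_ge0 ?mulr_ge0 // ltW.
  rewrite iterS lie_lie (lieC f e) ef lieNl (iter_e_weight _ Hv) IH lieZr.
  by rewrite -iterS -scaleNr -scalerDl addrC.
have [n n0 n1] := iter_e_eventually0 Hv v0.
have [d d0] := fe n; rewrite n1 lie0r => /esym/eqP.
by rewrite scaler_eq0 lt_eqF //= => /eqP.
Qed.

End Sl2.

(** * Root spaces of one root and its multiples *)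

Section RootSpace.
Variables (K : numFieldType) (L : lieAlgType K) (h : {vspace L}).
Implicit Types (b c : functional h) (x y : L).

Lemma root_space_lin b (a : K) x y :
  root_space b x -> root_space b y -> root_space b (a *: x + y).
Proof.
move=> bx byy H; rewrite lieDr lieZr bx byy scalerDr !scalerA.
by congr (_ + _); congr (_ *: _); rewrite mulrC.
Qed.

Lemma root_space0 b : root_space b 0.
Proof. by move=> H; rewrite lie0r scaler0. Qed.

Lemma root_spaceZ b (a : K) x : root_space b x -> root_space b (a *: x).
Proof.
by move=> bx; rewrite -[X in root_space _ X]addr0; apply/root_space_lin/root_space0.
Qed.

Lemma root_spaceB b x y :
  root_space b x -> root_space b y -> root_space b (x - y).
Proof.
by move=> bx byy; rewrite addrC -scaleN1r; apply: root_space_lin.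
Qed.

Lemma root_space_lie b c x y :
  root_space b x -> root_space c y -> root_space (b + c) [lie x, y].
Proof.
move=> bx cy H; rewrite lie_lie bx cy lieZl lieZr -scalerDl.
by rewrite add_lfunE.
Qed.

End RootSpace.

Section OneRoot.
Variables (K : numFieldType) (L : lieAlgType K) (h : {vspace L}).
Hypothesis hC : cartan_subalgebra h.

(** Such an x commutes with h, so [h + <[x]>] is abelian and equals h by maximality. *)
Lemma root_space_cartan x : root_space (0 : functional h) x -> x \in h.
Proof.
case: hC => hab _ hmax x0; rewrite -(hmax (h + <[x]>)%VS).
- by rewrite (subvP (addvSr h <[x]>)) // memv_line.
- have hx y : y \in h -> [lie y, x] = 0.
    by move=> yh; have := x0 (Subvs yh); rewrite zero_lfunE scale0r.
  move=> y z /memv_addP[u uh [_ /vlineP[k ->] ->]].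
  move=> /memv_addP[v vh [_ /vlineP[m ->] ->]].
  rewrite lieDl !lieDr hab // !lieZr !lieZl liexx (lieC x v) !hx //.
  by rewrite !(scaler0, oppr0, addr0).
- exact: addvSl.
Qed.

Variables (b : functional h) (e f : L) (H : subvs_of h).
Hypotheses (be : root_space b e) (bf : root_space (- b) f).
Hypotheses (ef : vsval H = [lie e, f]) (bH : b H = 2).

Let He : [lie vsval H, e] = 2 *: e.
Proof. by rewrite be bH. Qed.
Let Hf : [lie vsval H, f] = - 2 *: f.
Proof. by rewrite bf opp_lfunE bH. Qed.
Let ef' : [lie e, f] = vsval H. Proof. by rewrite ef. Qed.
Let fe' : [lie f, e] = - vsval H. Proof. by rewrite lieC ef. Qed.

(** For y in the root space, [f, y] lies in h. As [f, e] = -H with b(-H) = -2, the given c makes b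
    vanish on [f, x - c e]; then e kills [f, x - c e], and [ef_injective] applies. *)
Lemma simple_root_space x : root_space b x -> exists c, x = c *: e.
Proof.
move=> bx; have hy y : root_space b y -> [lie f, y] \in h.
  move=> byy; apply: root_space_cartan.
  by rewrite -(addNr b); apply: root_space_lie.
pose g y (by_ : root_space b y) := Subvs (hy y by_).
pose c := b (g x bx) / -2; exists c; apply/eqP; rewrite -subr_eq0; apply/eqP.
have bz : root_space b (x - c *: e) by apply/root_spaceB/root_spaceZ.
apply: (ef_injective ef' He (c := 2)) => //.
  by rewrite bz bH.
rewrite lieC -[X in [lie X, _]]/(vsval (g _ bz)) be.
suff -> : b (g _ bz) = 0 by rewrite scale0r oppr0.
have -> : g _ bz = g _ bx + c *: H.
  by apply: val_inj; rewrite /= lieDr lieNr lieZr fe' scalerN opprK.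
rewrite linearD linearZ /= bH /c.
by rewrite /GRing.scale /= -mulrA invrN mulNr mulVf ?pnatr_eq0 // mulrN1 subrr.
Qed.

(** For k = 2, [f, x] is a multiple of e, so e kills it. For larger k, [f, x] = 0 by induction
    although x has positive weight; this contradicts sl2 theory for the triple (f, e, -H). *)
Lemma multiple_root_space k x : (1 < k)%N -> root_space (b *+ k) x -> x = 0.
Proof.
case: k => [|[|k]] // _; elim: k x => [|k IH] x bx.
  have Hx : [lie vsval H, x] = 4 *: x.
    by rewrite bx mulr2n add_lfunE bH; congr (_ *: _); ring.
  apply: (ef_injective ef' He Hx); first by rewrite ltr0n.
  have [c ->] : exists c, [lie f, x] = c *: e.
    apply: simple_root_space.
    have -> : b = - b + b *+ 2 by rewrite mulr2n addKr.
    exact: root_space_lie.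
  by rewrite lieZr liexx scaler0.
have Hx : [lie - vsval H, x] = (- (2 * k.+3%:R)) *: x.
  rewrite lieNl bx scaleNr; congr (- (_ *: _)).
  suff -> n : (b *+ n) H = b H * n%:R by rewrite bH.
  by elim: n => [|n IHn];
    rewrite ?mulr0n ?zero_lfunE ?mulr0 // mulrS add_lfunE IHn -natr1; ring.
apply: (e_injective fe' _ Hx) => //.
- by rewrite lieNl He scaleNr.
- by rewrite oppr_lt0 mulr_gt0.
apply: IH; have -> : b *+ k.+2 = - b + b *+ k.+3 by rewrite mulrS addKr.
exact: root_space_lie.
Qed.

End OneRoot.

(** * Roots *)

Definition chevalley_generators (K : fieldType) (L : lieAlgType K)
    (h : {vspace L}) (r : nat) (alpha : 'I_r -> functional h) (A : 'M[int]_r)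
    (e f : 'I_r -> L) (H : 'I_r -> subvs_of h) : Prop :=
  [/\ forall i, root_space (alpha i) (e i),
      forall i, root_space (- alpha i) (f i),
      forall i, vsval (H i) = [lie e i, f i] &
      forall i j, alpha i (H j) = (A i j)%:~R].

Lemma chevalley_generatorsP (K : numFieldType) (L : lieAlgType K)
    (h : {vspace L}) (r : nat) (alpha : 'I_r -> functional h) (A : 'M[int]_r) :
  has_cartan_matrix alpha A ->
  (forall i, A i i = 2) /\ exists e f H, chevalley_generators alpha A e f H.
Proof.
case=> H [Hco HA]; split=> [i|].
  have [_] := Hco i; rewrite HA => /eqP.
  by rewrite -[2]/(2%:~R) eqr_int => /eqP.
have : forall i, exists ef : L * L, [/\ root_space (alpha i) ef.1,
    root_space (- alpha i) ef.2 & vsval (H i) = [lie ef.1, ef.2]].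
  by move=> i; have [[x [y [? ? ?]]] _] := Hco i; exists (x, y).
case/fin_all_exists => ef efP.
exists (fun i => (ef i).1), (fun i => (ef i).2), H.
by split=> [i|i|i|//]; have [] := efP i.
Qed.

Section RootLattice.
Variables (K : numFieldType) (L : lieAlgType K) (h : {vspace L}).
Variables (r : nat) (alpha : 'I_r -> functional h) (A : 'M[int]_r).
Local Notation Q := 'rV[int]_r.
Implicit Types (a b : Q) (x y : L) (i j : 'I_r).

Definition root_at a : functional h := root_of alpha (a 0).

Definition simple_vec i : Q := delta_mx 0 i.

(** Since A i j = alpha_i(H_j), the entry [(a *m A) 0 j] is the value of the root a on the j-th
    coroot. *)
Definition reflection j a : Q := a - (a *m A) 0 j *: simple_vec j.

Definition nonneg_vec a := (a != 0) && [forall i, 0 <= a 0 i].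

Definition vec_height a : int := \sum_i a 0 i.

Lemma nonneg_vecP a : reflect (a <> 0 /\ forall i, 0 <= a 0 i) (nonneg_vec a).
Proof.
apply: (iffP andP) => -[a0 ap]; split.
- exact/eqP.
- exact/forallP/ap.
- exact/eqP.
- exact/forallP/ap.
Qed.

Lemma root_atD a b : root_at (a + b) = root_at a + root_at b.
Proof.
by rewrite /root_at /root_of -big_split; apply: eq_bigr => i _; rewrite mxE mulrzDr.
Qed.

Lemma root_at0 : root_at 0 = 0.
Proof. by rewrite /root_at /root_of big1 // => i _; rewrite mxE mulr0z. Qed.

Lemma root_atN a : root_at (- a) = - root_at a.
Proof. by apply/eqP; rewrite -addr_eq0 -root_atD addNr root_at0. Qed.

Lemma root_at_simple i : root_at (simple_vec i) = alpha i.
Proof.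
rewrite /root_at /root_of (bigD1 i) //= big1 => [|j ji].
  by rewrite !mxE !eqxx mulr1z addr0.
by rewrite !mxE (negPf ji) andbF mulr0z.
Qed.

Lemma vec_heightD a b : vec_height (a + b) = vec_height a + vec_height b.
Proof. by rewrite /vec_height -big_split; apply: eq_bigr => i _; rewrite mxE. Qed.

Lemma vec_heightZ m a : vec_height (m *: a) = m * vec_height a.
Proof. by rewrite /vec_height mulr_sumr; apply: eq_bigr => i _; rewrite mxE. Qed.

Lemma vec_height_simple i : vec_height (simple_vec i) = 1.
Proof.
rewrite /vec_height (bigD1 i) //= big1 => [|j ji]; first by rewrite !mxE !eqxx.
by rewrite !mxE (negPf ji) andbF.
Qed.

Lemma simple_vecE i j : simple_vec i 0 j = (j == i)%:R.
Proof. by rewrite mxE eqxx. Qed.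

Lemma nonneg_vec_height a : nonneg_vec a -> 0 < vec_height a.
Proof.
case/nonneg_vecP => a0 ap; rewrite lt_neqAle sumr_ge0 // andbT eq_sym.
apply/eqP => /eqP; rewrite psumr_eq0 // => /allP z; apply: a0; apply/rowP => i.
by have := z i (mem_index_enum i); rewrite mxE => /eqP.
Qed.

Hypothesis hS : simple_roots alpha.

Lemma root_at_inj : injective root_at.
Proof.
have inj0 a : root_at a = 0 -> a = 0.
  have [_ fr _] := hS; rewrite /root_at /root_of => S0.
  apply/rowP => i; rewrite mxE.
  have /freeP/(_ (fun j : 'I_#|'I_r| => (a 0 (enum_val j))%:~R)) :
    free (codom_tuple alpha) by [].
  rewrite (_ : \sum_j _ = 0) => [/(_ erefl (enum_rank i))|].
    by rewrite enum_rankK => /eqP; rewrite intr_eq0 => /eqP.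
  rewrite -[RHS]S0 [RHS](reindex (@enum_val _ 'I_r)) /=; last first.
    by exists enum_rank => k _; rewrite ?enum_valK ?enum_rankK.
  apply: eq_bigr => j _; rewrite scaler_int; congr (_ *~ _).
  by rewrite (nth_map (enum_val j)) -?enum_val_nth // -cardE.
move=> a b ab; apply/eqP; rewrite -subr_eq0; apply/eqP/inj0.
by rewrite root_atD root_atN ab subrr.
Qed.

Definition is_weight a := exists2 x, root_space (root_at a) x & x <> 0.

Lemma is_rootE a : is_root (root_at a) <-> a <> 0 /\ is_weight a.
Proof.
split=> [[a0 wa]|[a0 wa]]; split=> //; first by move=> a00; apply: a0;
  rewrite a00 root_at0.
by rewrite -root_at0 => /root_at_inj.
Qed.

Lemma weight_sign a : is_weight a ->
  (forall i, 0 <= a 0 i) \/ (forall i, a 0 i <= 0).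
Proof.
move=> wa; have [->|/eqP a0] := eqVneq a 0; first by left=> i; rewrite mxE.
have [_ _ /(_ (root_at a))] := hS; rewrite is_rootE => /(_ (conj a0 wa)).
case=> c [ac csgn]; suff -> : a = \row_i c i.
  by case: csgn => cs; [left|right] => i; rewrite mxE.
apply: root_at_inj; rewrite ac; apply: eq_bigr => i _; by rewrite mxE.
Qed.

Hypothesis hC : cartan_subalgebra h.
Hypothesis A2 : forall i, A i i = 2.
Variables (e f : 'I_r -> L) (H : 'I_r -> subvs_of h).
Hypothesis gen : chevalley_generators alpha A e f H.

Let ge i : root_space (root_at (simple_vec i)) (e i).
Proof. by rewrite root_at_simple; case: gen. Qed.

Let gf i : root_space (root_at (- simple_vec i)) (f i).
Proof. by rewrite root_atN root_at_simple; case: gen. Qed.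

Let gef i : [lie e i, f i] = vsval (H i).
Proof. by case: gen => _ _ ->. Qed.

Lemma coroot_act a j x : root_space (root_at a) x ->
  [lie vsval (H j), x] = ((a *m A) 0 j)%:~R *: x.
Proof.
move=> ax; rewrite ax; congr (_ *: _); rewrite /root_at /root_of.
rewrite sum_lfunE mxE rmorph_sum; apply: eq_bigr => i _ /=.
case: gen => _ _ _ gA; rewrite -scaler_int scale_lfunE gA rmorphM /=.
by [].
Qed.

Lemma simple_evE i j : (simple_vec i *m A) 0 j = A i j.
Proof. by rewrite -rowE mxE. Qed.

Let He j : [lie vsval (H j), e j] = 2 *: e j.
Proof. by rewrite (coroot_act _ (ge j)) simple_evE A2. Qed.

Let Hf j : [lie vsval (H j), f j] = - 2 *: f j.
Proof. by rewrite (coroot_act _ (gf j)) mulNmx mxE simple_evE A2. Qed.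

Lemma e_weight a j x : root_space (root_at a) x ->
  root_space (root_at (a + simple_vec j)) [lie e j, x].
Proof. by rewrite addrC root_atD => ax; apply: root_space_lie. Qed.

Lemma f_weight a j x : root_space (root_at a) x ->
  root_space (root_at (a - simple_vec j)) [lie f j, x].
Proof. by rewrite addrC root_atD => ax; apply: root_space_lie. Qed.

Let iter_e a j n x : root_space (root_at a) x ->
  root_space (root_at (a + n%:R *: simple_vec j)) (iter n (lie (e j)) x).
Proof.
move=> ax; elim: n => [|n IH]; first by rewrite scale0r addr0.
rewrite (_ : a + _ = a + n%:R *: simple_vec j + simple_vec j); first exact: e_weight.
by rewrite -addrA -natr1 scalerDl scale1r.
Qed.

Let iter_f a j n x : root_space (root_at a) x ->
  root_space (root_at (a - n%:R *: simple_vec j)) (iter n (lie (f j)) x).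
Proof.
move=> ax; elim: n => [|n IH]; first by rewrite scale0r subr0.
rewrite (_ : a - _ = a - n%:R *: simple_vec j - simple_vec j); first exact: f_weight.
by rewrite -addrA -opprD -natr1 scalerDl scale1r.
Qed.

Lemma e_weight_injective a j x : root_space (root_at a) x -> (a *m A) 0 j < 0 ->
  [lie e j, x] = 0 -> x = 0.
Proof.
move=> ax aj; apply: (e_injective (gef j) (Hf j) (coroot_act j ax)).
by rewrite ltrz0.
Qed.

Let fe j : [lie f j, e j] = - vsval (H j). Proof. by rewrite lieC gef. Qed.
Let He' j : [lie - vsval (H j), f j] = 2 *: f j.
Proof. by rewrite lieNl Hf scaleNr opprK. Qed.
Let Hf' j : [lie - vsval (H j), e j] = - 2 *: e j.
Proof. by rewrite lieNl He scaleNr. Qed.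

(** This is [reflect_weight] for (e_j, f_j, H_j), or for (f_j, e_j, -H_j) if the value of a on H_j
    is negative. *)
Lemma weight_reflection j a : is_weight a -> is_weight (reflection j a).
Proof.
case=> x ax x0; rewrite /reflection; have Hx := coroot_act j ax.
case: (ltrP ((a *m A) 0 j) 0) Hx => [|aj Hx].
  case: (_ 0 j) => // n _ Hx.
  have Hx' : [lie - vsval (H j), x] = n.+1%:R *: x.
    by rewrite lieNl Hx NegzE mulrNz scaleNr opprK.
  have [p xp] := reflect_weight (fe j) (He' j) (Hf' j) Hx' x0.
  exists (iter (n.+1 + p) (lie (e j)) (iter p (lie (f j)) x)) => //.
  have := iter_e j (n.+1 + p) (iter_f j p ax).
  by rewrite natrD scalerDl addrACA addNr addr0 NegzE scaleNr opprK natz.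
case: (_ 0 j) aj Hx => // n _ Hx.
have [p xp] := reflect_weight (gef j) (He j) (Hf j) Hx x0.
exists (iter (n + p) (lie (f j)) (iter p (lie (e j)) x)) => //.
have := iter_f j (n + p) (iter_e j p ax).
by rewrite natrD scalerDl opprD addrACA subrr addr0 natz.
Qed.

Lemma is_weight_simple j : is_weight (simple_vec j) /\ is_weight (- simple_vec j).
Proof.
have Hj0 : vsval (H j) <> 0.
  move=> H0; have := He j; rewrite H0 lie0l => /esym/eqP.
  rewrite scaler_eq0 pnatr_eq0 /= => /eqP e0; have := gef j.
  rewrite e0 lie0l => /esym; case: gen => _ _ _ /(_ j j); rewrite A2.
  move=> aH HH; have : alpha j (H j) = 0.
    by rewrite (_ : H j = 0) ?linear0 //; apply: val_inj.
  by rewrite aH => /eqP; rewrite intr_eq0.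
split; [exists (e j)|exists (f j)] => // z0; apply: Hj0.
  by rewrite -gef z0 lie0l.
by rewrite -gef z0 lie0r.
Qed.


Lemma simple_weight_space j x : root_space (root_at (- simple_vec j)) x ->
  exists c, x = c *: f j.
Proof.
case: gen => _ gf' gH gA.
rewrite root_atN root_at_simple => ax.
apply: (@simple_root_space _ _ _ hC (- alpha j) (f j) (e j) (- H j)) => //.
- by rewrite opprK; case: gen.
- by rewrite opp_lfunE linearN opprK /= gA A2.
Qed.

Lemma weight_multiple j (k : int) : is_weight (k *: simple_vec j) ->
  [\/ k = 0, k = 1 | k = -1].
Proof.
case: gen => ge' gf' gH gA.
have Ek b (n : nat) : root_at (n%:R *: b) = root_at b *+ n.
  elim: n => [|n IH]; first by rewrite scale0r root_at0.
  by rewrite -natr1 scalerDl scale1r root_atD IH mulrSr.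
case: k => [[|[|n]]|[|n]]; try by [move=> _; constructor 1|move=> _;
  constructor 2|move=> _; constructor 3].
  case=> x; rewrite -natz Ek root_at_simple => ax []; move: ax.
  by apply: (multiple_root_space hC (ge' j) (gf' j) (gH j)); rewrite ?gA ?A2.
case=> x; rewrite NegzE scaleNr -scalerN -natz Ek root_atN root_at_simple => ax [].
move: ax; apply: (@multiple_root_space _ _ _ hC (- alpha j) (f j) (e j) (- H j)) => //.
- by rewrite opprK.
- by rewrite opp_lfunE linearN opprK /= gA A2.
Qed.

(** The element sum_j v_j H_j is a strictly dominant coweight: all simple roots are positive on it.
    Hence a nonzero nonnegative a is positive on it, and so on some H_j, which drives every
    induction on the height below. *)
Variable v : 'I_r -> int.
Hypotheses (v_ge0 : forall i, 0 <= v i) (Av_gt0 : forall i, 0 < \sum_j A i j * v j).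

Lemma exists_positive_ev a : nonneg_vec a -> exists j, 0 < (a *m A) 0 j.
Proof.
move=> an; have [a0 ap] := nonneg_vecP _ an.
apply: contrapT => no; have le j : (a *m A) 0 j <= 0.
  by rewrite leNgt; apply/negP => lt; apply: no; exists j.
have : 0 < \sum_i a 0 i * \sum_j A i j * v j.
  rewrite lt_neqAle sumr_ge0 ?andbT => [|i _]; last by rewrite mulr_ge0 // ltW.
  rewrite eq_sym psumr_eq0 => [|i _]; last by rewrite mulr_ge0 // ltW.
  apply/negP => /allP z; apply: a0; apply/rowP => i.
  have := z i (mem_index_enum i); rewrite mulf_eq0 (gt_eqF (Av_gt0 i)) orbF mxE.
  by move/eqP.
have -> : \sum_i a 0 i * \sum_j A i j * v j = \sum_j (a *m A) 0 j * v j.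
  rewrite (eq_bigr _ (fun i _ => mulr_sumr _ _ _ _)) exchange_big /=.
  apply: eq_bigr => j _; rewrite mxE mulr_suml; apply: eq_bigr => i _.
  by rewrite mulrA.
by rewrite ltNge; apply/negP/negPn/sumr_le0 => j _; apply: mulr_le0_ge0.
Qed.

Lemma ev_reflection a j : (reflection j a *m A) 0 j = - (a *m A) 0 j.
Proof.
rewrite /reflection mulmxBl mxE [X in _ + X]mxE -scalemxAl [X in _ - X]mxE.
by rewrite simple_evE A2; ring.
Qed.

Lemma reflectionK j : involutive (reflection j).
Proof.
move=> a; rewrite {1}/reflection ev_reflection scaleNr opprK.
by rewrite /reflection subrK.
Qed.

Lemma reflectionN j a : reflection j (- a) = - reflection j a.
Proof. by rewrite /reflection mulNmx mxE scaleNr opprB opprK addrC. Qed.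

(* A nonnegative weight that is not a multiple of alpha_j keeps a positive
   coordinate under s_j, hence stays nonnegative. *)
Lemma reflection_nonneg a j : nonneg_vec a -> is_weight a \/ is_weight (- a) ->
  a <> simple_vec j -> nonneg_vec (reflection j a).
Proof.
move=> an wa aj; have [a0 ap] := nonneg_vecP _ an.
have [i ij ai] : exists2 i, i != j & 0 < a 0 i.
  apply: contrapT => no; have ai i : i != j -> a 0 i = 0.
    move=> ij; apply/eqP; rewrite eq_le ap andbT leNgt; apply/negP => lt.
    by apply: no; exists i.
  have aE : a = a 0 j *: simple_vec j.
    apply/rowP => i; rewrite mxE simple_vecE.
    by case: eqVneq => [->|/ai->]; rewrite ?mulr1 ?mulr0.
  have : [\/ a 0 j = 0, a 0 j = 1 | a 0 j = -1].
    case: wa => [|wN]; first by rewrite aE => /weight_multiple;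
      rewrite mxE simple_vecE eqxx mulr1.
    have : is_weight ((- a 0 j) *: simple_vec j) by rewrite scaleNr -aE.
    case/weight_multiple => /eqP; rewrite ?oppr_eq0 ?eqr_oppLR ?opprK => /eqP ->.
    - by constructor 1.
    - by constructor 3.
    - by constructor 2.
  case=> aj1; first by apply: a0; rewrite aE aj1 scale0r.
    by apply: aj; rewrite aE aj1 scale1r.
  by have := ap j; rewrite aj1.
have ri : reflection j a 0 i = a 0 i.
  by rewrite !mxE eqxx (negPf ij) mulr0 subr0.
apply/nonneg_vecP; split; first by move=> r0; move: ai; rewrite -ri r0 mxE.
have : (forall i, 0 <= reflection j a 0 i) \/ (forall i, reflection j a 0 i <= 0).
  case: wa => /(weight_reflection j); first exact: weight_sign.
  rewrite reflectionN => /weight_sign [] s; [right|left] => k; have := s k.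
    by rewrite mxE oppr_ge0.
  by rewrite mxE oppr_le0.
by case=> // /(_ i); rewrite ri leNgt ai.
Qed.

Lemma reflection_height a j : vec_height (reflection j a) = vec_height a - (a *m A) 0 j.
Proof. by rewrite /reflection -scaleNr vec_heightD vec_heightZ vec_height_simple
  mulr1. Qed.

(** P is a candidate for the set of positive roots. If a is positive on H_j and not alpha_j, then
    s_j lowers its height and keeps it nonnegative; descending in this way inside the weights or
    inside P shows that P consists exactly of the positive roots. *)
Variable P : {pred Q}.
Hypotheses (P_simple : forall i, simple_vec i \in P)
  (P_nonneg : forall a, a \in P -> nonneg_vec a)
  (P_reflection : forall a j, a \in P -> a = simple_vec j \/ reflection j a \in P).

Lemma positive_weight a : nonneg_vec a -> is_weight a \/ is_weight (- a) -> a \in P.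
Proof.
have [n] := ubnP `|vec_height a|; elim: n => // n IH in a *.
move=> ltn an wa; have [j aj] := exists_positive_ev an.
have [->//|/eqP anj] := eqVneq a (simple_vec j).
have rn := reflection_nonneg an wa anj.
have rP : reflection j a \in P.
  apply: IH => //; last first.
    by case: wa => /(weight_reflection j); rewrite ?reflectionN; [left|right].
  have := nonneg_vec_height an; have := nonneg_vec_height rn.
  by rewrite reflection_height; move: ltn aj; lia.
have [raj|] := P_reflection j rP; last by rewrite reflectionK.
have := nonneg_vecP _ an => -[_ /(_ j)].
have : a = - simple_vec j.
  rewrite -[a](reflectionK j) raj /reflection simple_evE A2.
  by rewrite (_ : 2 = 1 + 1) // scalerDl scale1r opprD addrA subrr sub0r.
by move=> ->; rewrite mxE simple_vecE eqxx.
Qed.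

Lemma weight_of_positive a : a \in P -> is_weight a /\ is_weight (- a).
Proof.
have [n] := ubnP `|vec_height a|; elim: n => // n IH in a *.
move=> ltn aP; have an := P_nonneg aP; have [j aj] := exists_positive_ev an.
have [->|rP] := P_reflection j aP; first exact: is_weight_simple.
have [||w1 w2] := IH (reflection j a) => //.
  have := nonneg_vec_height an; have := nonneg_vec_height (P_nonneg rP).
  by rewrite reflection_height; move: ltn aj; lia.
split; first by have := weight_reflection j w1; rewrite reflectionK.
by have := weight_reflection j w2; rewrite reflectionN reflectionK.
Qed.

Lemma lower_weight a j x : nonneg_vec a -> root_space (root_at (- a)) x ->
  x <> 0 -> 0 < (a *m A) 0 j -> a <> simple_vec j ->
  nonneg_vec (a - simple_vec j) /\ [lie e j, x] <> 0.
Proof.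
move=> an ax x0 aj anj; have ex0 : [lie e j, x] <> 0.
  move/(e_weight_injective ax) => xx; apply: x0; apply: xx.
  by rewrite mulNmx mxE oppr_lt0.
split=> //; apply/nonneg_vecP; split.
  by move/eqP; rewrite subr_eq0 => /eqP.
have wx : is_weight (- (a - simple_vec j)).
  by exists [lie e j, x] => //; rewrite opprB addrC; apply: e_weight.
have [_ ap] := nonneg_vecP _ an; case/weight_sign: wx => s i; have := s i; last first.
  by rewrite mxE oppr_le0.
(* [reflection j a] is nonnegative and arises from a by subtracting a positive multiple of alpha_j,
   so subtracting alpha_j once keeps all coordinates nonnegative. *)
move=> _; have rn := reflection_nonneg an _ anj.
have [_ /(_ i)] := nonneg_vecP _ (rn (or_intror (ex_intro2 _ _ x ax x0))).
rewrite !mxE eqxx /=; have := ap i; move: aj; rewrite mxE.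
by case: eqP => /= _; rewrite ?mulr1 ?mulr0; lia.
Qed.

(** If a is positive on H_j, then e_j is injective on the space of weight -a and maps it into the
    space of weight -(a - alpha_j), a line by induction. *)
Lemma weight_space_dim1 a x y : nonneg_vec a ->
  root_space (root_at (- a)) x -> root_space (root_at (- a)) y -> x <> 0 ->
  exists c, y = c *: x.
Proof.
have [n] := ubnP `|vec_height a|; elim: n => // n IH in a x y *.
move=> ltn an ax ay x0; have [j aj] := exists_positive_ev an.
have [aE|/eqP anj] := eqVneq a (simple_vec j).
  move: ax ay; rewrite aE => /simple_weight_space[c xE] /simple_weight_space[d yE].
  exists (d / c); rewrite xE yE scalerA mulfVK //.
  by apply/eqP => c0; apply: x0; rewrite xE c0 scale0r.
have [ln ex0] := lower_weight an ax x0 aj anj.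
have ea z : root_space (root_at (- a)) z ->
    root_space (root_at (- (a - simple_vec j))) [lie e j, z].
  by rewrite opprB addrC; apply: e_weight.
have [|c cE] := IH _ _ _ _ ln (ea _ ax) (ea _ ay) ex0.
  have := nonneg_vec_height an; have := nonneg_vec_height ln; move: ltn.
  rewrite -[- simple_vec j]scaleN1r vec_heightD vec_heightZ vec_height_simple; lia.
exists c; apply/eqP; rewrite -subr_eq0; apply/eqP.
apply: (@e_weight_injective (- a) j); first exact/root_spaceB/root_spaceZ.
  by rewrite mulNmx mxE oppr_lt0.
by rewrite lieDr lieNr lieZr cE subrr.
Qed.

Lemma lowest_weight0 a x : nonneg_vec a -> root_space (root_at (- a)) x ->
  (forall j, [lie e j, x] = 0) -> x = 0.
Proof.
move=> an ax ex; have [j aj] := exists_positive_ev an.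
by apply: (e_weight_injective ax _ (ex j)); rewrite mulNmx mxE oppr_lt0.
Qed.

End RootLattice.

(** * A Chevalley basis of the negative part *)

Section ChevalleyBasis.
Variables (K : numFieldType) (L : lieAlgType K) (h : {vspace L}).
Variables (r : nat) (alpha : 'I_r -> functional h) (A : 'M[int]_r).
Local Notation Q := 'rV[int]_r.
Local Notation "'δ" := (@simple_vec r).
Local Notation wt := (@root_at K L h r alpha).
Implicit Types (a q : Q) (x y : L) (i j : 'I_r).

Hypotheses (hS : simple_roots alpha) (hC : cartan_subalgebra h).
Hypothesis A2 : forall i, A i i = 2.
Variables (e f : 'I_r -> L) (H : 'I_r -> subvs_of h).
Hypothesis gen : chevalley_generators alpha A e f H.
Variable v : 'I_r -> int.
Hypotheses (v_ge0 : forall i, 0 <= v i) (Av_gt0 : forall i, 0 < \sum_j A i j * v j).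
Variable P : {pred Q}.
Hypotheses (P_simple : forall i, 'δ i \in P)
  (P_nonneg : forall a, a \in P -> nonneg_vec a)
  (P_reflection : forall a j, a \in P -> a = 'δ j \/ reflection A j a \in P).

Lemma e_f_distinct i j : i != j -> [lie e j, f i] = 0.
Proof.
move=> ij; have w : root_space (wt ('δ j - 'δ i)) [lie e j, f i].
  rewrite root_atD root_atN !root_at_simple; apply: root_space_lie.
    by case: gen.
  by case: gen.
apply: contrapT => n0.
have [s|s] := weight_sign hS (ex_intro2 _ _ _ w n0).
  by have := s i; rewrite !mxE !eqxx (negPf ij).
by have := s j; rewrite !mxE !eqxx [j == i]eq_sym (negPf ij).
Qed.

Variables (c d : 'I_r -> Q -> int).
Hypothesis c_out : forall i a, a \notin P -> c i a = 0.
(** A nonzero c allows f_a to be defined from f_(a - alpha_j); a nonzero d shows f_a to be nonzero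
    when f_(a - alpha_j) is. *)
Hypothesis parent : forall a, a \in P -> (exists i, a = 'δ i) \/
  exists j, [&& a - 'δ j \in P, c j (a - 'δ j) != 0 & d j a != 0].
(* The consistency of [f_i, f_a] = c i a f_(a + alpha_i) and
   [e_j, f_a] = d j a f_(a - alpha_j) when e_j is applied to [f_i, f_a]. *)
Hypothesis cd_compat : forall i j a, a \in P -> a + 'δ i \in P ->
  (if i == j then - (a *m A) 0 i else 0) +
  (if a == 'δ j then A i j else d j a * c i (a - 'δ j)) = d j (a + 'δ i) * c i a.

(** The fuel n is the height of a. The index j picked is arbitrary; that other choices give the same
    vector is part of [chevalley_vecP]. *)
Fixpoint lowering_vec n a : L :=
  if n is n'.+1 then
    if a \notin P then 0
    else if [pick i | a == 'δ i] is Some i then f i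
    else if [pick j | [&& a - 'δ j \in P, c j (a - 'δ j) != 0 & d j a != 0]]
      is Some j then (c j (a - 'δ j))%:~R^-1 *: [lie f j, lowering_vec n' (a - 'δ j)]
    else 0
  else 0.

Definition chevalley_vec a := lowering_vec `|vec_height a| a.
Local Notation F := chevalley_vec.

Let height_gt0 a : a \in P -> (0 < `|vec_height a|)%N.
Proof. by move/P_nonneg/nonneg_vec_height; lia. Qed.

Let heightB a i : vec_height (a - 'δ i) = vec_height a - 1.
Proof.
by rewrite -[- _]scaleN1r vec_heightD vec_heightZ vec_height_simple mulr1.
Qed.

Lemma chevalley_vec_out a : a \notin P -> F a = 0.
Proof. by rewrite /F; case: `|_|%N => //= n ->. Qed.

Lemma chevalley_vec_simple i : F ('δ i) = f i.
Proof.
rewrite /F vec_height_simple /= P_simple /=; case: pickP => [j|/(_ i)].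
  by move=> /eqP /rowP /(_ i); rewrite !simple_vecE eqxx; case: eqVneq => // ->.
by rewrite eqxx.
Qed.

Lemma chevalley_vec_step a : a \in P -> (forall i, a <> 'δ i) ->
  exists j, [/\ a - 'δ j \in P, c j (a - 'δ j) <> 0, d j a <> 0 &
   F a = (c j (a - 'δ j))%:~R^-1 *: [lie f j, F (a - 'δ j)]].
Proof.
move=> aP ns; have := height_gt0 aP; rewrite /F.
case hn: `|vec_height a|%N => [//|n] _ /=; rewrite aP /=.
case: pickP => [i /eqP /ns//|_].
case: pickP => [j /and3P[ajP /eqP cj /eqP dj]|no]; last first.
  by have [[i /ns//]|[j]] := parent aP; rewrite no.
exists j; split=> //; rewrite heightB.
have -> : `|vec_height a - 1|%N = n by move: hn;
  have := nonneg_vec_height (P_nonneg aP); lia.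
by [].
Qed.

Let Hf j a x : root_space (wt (- a)) x ->
  [lie vsval (H j), x] = - ((a *m A) 0 j)%:~R *: x.
Proof. by move=> ax; rewrite (coroot_act gen j ax) mulNmx mxE mulrNz. Qed.

Let out0 a x : nonneg_vec a -> a \notin P -> root_space (wt (- a)) x -> x = 0.
Proof.
move=> an aP ax; apply: contrapT => x0; move/negP: aP; apply.
apply: (positive_weight hS hC A2 gen v_ge0 Av_gt0 P_simple P_reflection) => //.
by right; exists x.
Qed.

Let nonnegD a i : nonneg_vec a -> nonneg_vec (a + 'δ i).
Proof.
move=> an; have [a0 ap] := nonneg_vecP _ an; apply/nonneg_vecP; split.
  move=> /rowP /(_ i); rewrite !mxE !eqxx /=; have := ap i; lia.
by move=> j; rewrite mxE simple_vecE addr_ge0.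
Qed.

(** A vector of negative weight killed by all e_j is zero, so [f_i, f_a] = c i a f_(a + alpha_i)
    need only be compared after applying each e_j, where [cd_compat] decides. Thus no Jacobi
    identity between the f_a is checked. The last clause lags one height behind because it uses the
    action of the e_j on f_(a + alpha_i). *)
Lemma chevalley_vecP n a : a \in P -> (`|vec_height a| <= n)%N ->
  [/\ root_space (wt (- a)) (F a),
      forall j, a <> 'δ j -> [lie e j, F a] = (d j a)%:~R *: F (a - 'δ j) &
      (`|vec_height a| < n)%N ->
        forall i, [lie f i, F a] = (c i a)%:~R *: F (a + 'δ i)].
Proof.
elim: n a => [|n IH] a aP; first by rewrite leqn0 => /eqP h0;
  have := height_gt0 aP; rewrite h0.
have heightD b i : vec_height (b + 'δ i) = vec_height b + 1.
  by rewrite vec_heightD vec_height_simple.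
(* The first term comes from [e_j, f_i], which is H_j or 0; the second from [f_i, [e_j, f_q]], where
   [e_j, f_q] is H_j if q = alpha_j. *)
have X q i j : q \in P -> (`|vec_height q| <= n)%N ->
  [lie e j, [lie f i, F q]] =
  ((if i == j then - (q *m A) 0 i else 0) +
   (if q == 'δ j then A i j else d j q * c i (q - 'δ j)))%:~R *: F (q + 'δ i - 'δ j).
  move=> qP qn; have [qw qe _] := IH q qP qn.
  rewrite lie_lie intrD scalerDl; congr (_ + _).
    case: eqVneq => [->|/e_f_distinct->]; last by rewrite lie0l scale0r.
    by rewrite (_ : [lie e j, f j] = vsval (H j)) ?(Hf _ qw) ?addrK ?mulrNz //;
      case: gen.
  case: eqVneq => [->|/eqP/qe->].
    rewrite chevalley_vec_simple (_ : [lie e j, f j] = vsval (H j)); last by case: gen.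
    rewrite lieC (Hf _ (a := 'δ i)); last by rewrite root_atN root_at_simple; case: gen.
    by rewrite simple_evE scaleNr opprK [_ + 'δ i]addrC addrK chevalley_vec_simple.
  rewrite lieZr intrM -scalerA; congr (_ *: _).
  have [qjP|qjP] := boolP (q - 'δ j \in P); last first.
    by rewrite chevalley_vec_out // c_out // lie0r scale0r.
  rewrite addrAC; have [|_ _ ->//] := IH _ qjP.
    by rewrite heightB; have := nonneg_vec_height (P_nonneg qP); move: qn; lia.
  by rewrite heightB; have := nonneg_vec_height (P_nonneg qP); move: qn; lia.
have AB b : b \in P -> (`|vec_height b| <= n.+1)%N ->
    root_space (wt (- b)) (F b) /\
    forall j, b <> 'δ j -> [lie e j, F b] = (d j b)%:~R *: F (b - 'δ j).
  move=> bP bn; have [bs|ns] := pselect (exists i, b = 'δ i).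
    case: bs => i ->; rewrite chevalley_vec_simple; split.
      by rewrite root_atN root_at_simple; case: gen.
    move=> j ij; rewrite e_f_distinct; last by apply/eqP => jE; apply: ij; rewrite jE.
    rewrite chevalley_vec_out ?scaler0 //; apply/negP => /P_nonneg /nonneg_vec_height.
    by rewrite heightB vec_height_simple subrr.
  have {ns} ns i : b <> 'δ i by move=> bE; apply: ns; exists i.
  have [j0 [qP cq dq FE]] := chevalley_vec_step bP ns.
  have qn : (`|vec_height (b - 'δ j0)| <= n)%N.
    by rewrite heightB; have := nonneg_vec_height (P_nonneg bP); move: bn; lia.
  have [qw _ _] := IH _ qP qn; rewrite FE; split.
    apply: root_spaceZ; rewrite (_ : - b = - (b - 'δ j0) - 'δ j0);
      last by rewrite opprB addrC addKr.
    exact: f_weight gen _ _ _ qw.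
  move=> j _; rewrite lieZr (X _ j0 j qP qn) cd_compat // subrK //.
  by rewrite scalerA intrM mulrCA mulVf ?mulr1 // intr_eq0; apply/eqP.
move=> an; have [aw ae] := AB a aP an; split=> // {}an i.
have fw : root_space (wt (- (a + 'δ i))) [lie f i, F a].
  by rewrite opprD; apply: f_weight gen _ _ _ aw.
have adn := nonnegD i (P_nonneg aP).
have [adP|adP] := boolP (a + 'δ i \in P); last first.
  by rewrite (chevalley_vec_out adP) scaler0; apply: out0 adP fw.
have [|aiw aie] := AB _ adP.
  by rewrite heightD; have := nonneg_vec_height (P_nonneg aP); move: an; lia.
apply/eqP; rewrite -subr_eq0; apply/eqP.
apply: (lowest_weight0 A2 gen v_ge0 Av_gt0 adn); first exact/root_spaceB/root_spaceZ.
move=> j; rewrite lieDr lieNr lieZr X // aie ?scalerA.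
  by rewrite cd_compat // intrM [_%:~R * _]mulrC subrr.
move=> /(congr1 (@vec_height r)); rewrite heightD vec_height_simple.
by have := nonneg_vec_height (P_nonneg aP); lia.
Qed.

Lemma chevalley_vec_weight a : root_space (wt (- a)) (F a).
Proof.
have [aP|aP] := boolP (a \in P); last by rewrite chevalley_vec_out //;
  apply: root_space0.
by have [] := chevalley_vecP aP (leqnn _).
Qed.

Lemma lie_f_chevalley_vec i a : [lie f i, F a] = (c i a)%:~R *: F (a + 'δ i).
Proof.
have [aP|aP] := boolP (a \in P).
  by have [_ _ ->] := chevalley_vecP aP (leqnSn _).
by rewrite c_out // chevalley_vec_out // lie0r scale0r.
Qed.

Lemma chevalley_vec_neq0 a : a \in P -> F a <> 0.
Proof.
have [n] := ubnP `|vec_height a|; elim: n => // n IH in a *.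
move=> ltn aP; have [[i ->]|ns] := pselect (exists i, a = 'δ i).
  rewrite chevalley_vec_simple => f0; have [_ [x xw x0]] := is_weight_simple A2 gen i.
  by have [c0 xE] := simple_weight_space hC A2 gen xw; apply: x0; rewrite xE f0 scaler0.
have {}ns i : a <> 'δ i by move=> aE; apply: ns; exists i.
have [j [ajP _ dj _]] := chevalley_vec_step aP ns.
have [_ /(_ j (ns j)) ea _] := chevalley_vecP aP (leqnn _).
move=> a0; move: ea; rewrite a0 lie0r => /esym/eqP; rewrite scaler_eq0 intr_eq0.
case/orP => /eqP // ; apply: IH => //; rewrite heightB.
by have := nonneg_vec_height (P_nonneg aP); move: ltn; lia.
Qed.

Lemma lie_chevalley_vec_out a b : a \in P -> b \in P -> a + b \notin P ->
  [lie F a, F b] = 0.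
Proof.
move=> aP bP abP; apply: (out0 _ abP); last first.
  rewrite opprD root_atD; apply: root_space_lie; exact: chevalley_vec_weight.
have [/eqP a0 ap] := nonneg_vecP _ (P_nonneg aP).
have [_ bp] := nonneg_vecP _ (P_nonneg bP).
have := nonneg_vec_height (P_nonneg aP); have := nonneg_vec_height (P_nonneg bP).
move=> hb ha; apply/nonneg_vecP; split=> [/(congr1 (@vec_height r))|i].
  have -> : vec_height (0 : Q) = 0 by rewrite /vec_height big1 // => i _; rewrite mxE.
  by rewrite vec_heightD; move: ha hb; lia.
by rewrite mxE addr_ge0.
Qed.

(** The Jacobi identity for [[f_j, f_a], f_b]. Since c j a is its own inverse, f_(a + alpha_j) is an
    integral multiple of [f_j, f_a] and the new coefficient is an integer. *)
Lemma lie_chevalley_vec_step a b j (m n : int) : c j a * c j a = 1 ->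
  [lie F a, F b] = m%:~R *: F (a + b) ->
  [lie F a, F (b + 'δ j)] = n%:~R *: F (a + (b + 'δ j)) ->
  [lie F (a + 'δ j), F b] =
    (c j a * (m * c j (a + b) - c j b * n))%:~R *: F (a + 'δ j + b).
Proof.
move=> ca ab abj.
have -> : F (a + 'δ j) = (c j a)%:~R *: [lie f j, F a].
  by rewrite lie_f_chevalley_vec scalerA -intrM ca scale1r.
rewrite lieZl intrM -scalerA; congr (_ *: _).
have -> : [lie [lie f j, F a], F b] = [lie f j, [lie F a, F b]] - [lie F a,
  [lie f j, F b]].
  by rewrite lie_lie addrK.
rewrite ab lieZr !lie_f_chevalley_vec lieZr abj !scalerA -!intrM.
by rewrite addrA addrAC -scalerBl -intrB.
Qed.

End ChevalleyBasis.

(** * Computing with root lists *)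

(* Membership in a list of vectors, written so that it evaluates fast. *)
Fixpoint eq_nats (s t : seq nat) : bool :=
  match s, t with
  | [::], [::] => true
  | m :: s', n :: t' => if eqn m n then eq_nats s' t' else false
  | _, _ => false
  end.

Fixpoint nats_mem (s : seq nat) (l : seq (seq nat)) : bool :=
  if l is t :: l' then if eq_nats s t then true else nats_mem s l' else false.

Lemma eq_natsE t u : eq_nats t u = (t == u).
Proof.
elim: t u => [|m t IH] [|n u] //=.
by rewrite eqseq_cons -IH [RHS]andbC; case: eqnP => [->|/eqP/negPf->];
  rewrite ?eqxx ?andbT ?andbF.
Qed.

Lemma nats_memE s l : nats_mem s l = (s \in l).
Proof.
by elim: l => //= t l IH; rewrite inE eq_natsE IH.
Qed.

Section Computation.
Variables (r : nat) (rows : seq (seq int)).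
Local Notation Q := 'rV[int]_r.
Local Notation A := (\matrix_(i < r, j < r) nth 0 (nth [::] rows i) j : 'M[int]_r).
Implicit Types (s t : seq nat).

Definition vec_of_seq s : Q := \row_i (nth 0%N s i)%:Z.

Definition seq_of_vec (a : Q) : seq nat := [seq absz (a 0 i) | i <- enum 'I_r].

(** A [foldr] over a list evaluates under [vm_compute], as [\sum] over ordinals does not. *)
Definition sum_iota (n : nat) (F : nat -> int) : int :=
  foldr (fun i acc => F i + acc) 0 (iota 0 n).

Lemma sum_iotaE n F : sum_iota n F = \sum_(i < n) F i.
Proof.
rewrite /sum_iota -(big_mkord xpredT) /index_iota subn0.
by elim: iota => [|i l IH] /=; rewrite ?big_nil // big_cons IH.
Qed.

Definition seq_ev s j : int :=
  sum_iota r (fun i => (nth 0%N s i)%:Z * nth 0 (nth [::] rows i) j).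

Definition simple_seq i : seq nat := incr_nth (nseq r 0%N) i.

(* [::] is not a root: it stands for the vectors with a negative coordinate. *)
Definition seq_lower s j : seq nat :=
  if nth 0%N s j is k.+1 then set_nth 0%N s j k else [::].

Definition seq_reflection j s : seq nat :=
  let m := (nth 0%N s j)%:Z - seq_ev s j in
  if 0 <= m then set_nth 0%N s j `|m|%N else [::].

Lemma vec_of_seqE s (i : 'I_r) : vec_of_seq s 0 i = (nth 0%N s i)%:Z.
Proof. by rewrite mxE. Qed.

Lemma vec_of_seqK s : size s = r -> seq_of_vec (vec_of_seq s) = s.
Proof.
move=> ss; apply: (@eq_from_nth _ 0%N); first by rewrite size_map size_enum_ord.
move=> i; rewrite size_map size_enum_ord => ir.
have i0 : 'I_r := Ordinal ir.
by rewrite (nth_map i0) ?size_enum_ord // mxE nth_enum_ord.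
Qed.

Lemma vec_of_seq_inj s t : size s = r -> size t = r ->
  vec_of_seq s = vec_of_seq t -> s = t.
Proof. by move=> ss st st'; rewrite -(vec_of_seqK ss) st' vec_of_seqK. Qed.

Lemma seq_evE s (j : 'I_r) : (vec_of_seq s *m A) 0 j = seq_ev s j.
Proof. by rewrite /seq_ev sum_iotaE mxE; apply: eq_bigr => i _; rewrite !mxE. Qed.

Lemma size_simple_seq i : (i < r)%N -> size (simple_seq i) = r.
Proof. by move=> ir; rewrite size_incr_nth size_nseq ir. Qed.

Lemma simple_seqE (i : 'I_r) : vec_of_seq (simple_seq i) = simple_vec i.
Proof.
apply/rowP => j; rewrite vec_of_seqE simple_vecE nth_incr_nth nth_nseq.
by rewrite if_same addn0 eq_sym natz.
Qed.

Lemma incr_seqE s (i : 'I_r) :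
  vec_of_seq (incr_nth s i) = vec_of_seq s + simple_vec i.
Proof.
apply/rowP => j; rewrite vec_of_seqE [RHS]mxE vec_of_seqE simple_vecE nth_incr_nth.
by rewrite PoszD addrC [j == i]eq_sym natz.
Qed.

Lemma size_seq_lower s (j : 'I_r) : size s = r -> (0 < nth 0%N s j)%N ->
  size (seq_lower s j) = r.
Proof.
rewrite /seq_lower => ss; case: nth => // k _.
by rewrite size_set_nth ss; apply/maxn_idPr.
Qed.

Lemma seq_lowerE s (j : 'I_r) : (0 < nth 0%N s j)%N ->
  vec_of_seq (seq_lower s j) = vec_of_seq s - simple_vec j.
Proof.
rewrite /seq_lower; case sj: nth => [//|k] _; apply/rowP => i.
rewrite [RHS]mxE !vec_of_seqE mxE simple_vecE nth_set_nth /= -val_eqE /=.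
by case: eqVneq => [->|_]; rewrite ?subr0 // sj; lia.
Qed.

Lemma seq_reflectionE s (j : 'I_r) : 0 <= (nth 0%N s j)%:Z - seq_ev s j ->
  vec_of_seq (seq_reflection j s) = reflection A j (vec_of_seq s).
Proof.
rewrite /seq_reflection => m0; rewrite m0; apply/rowP => i.
rewrite /reflection seq_evE vec_of_seqE [RHS]mxE vec_of_seqE 2!mxE simple_vecE
  nth_set_nth /= -val_eqE /=.
by case: eqVneq => [->|_]; rewrite ?mulr1 ?mulr0 ?subr0 // gez0_abs.
Qed.

Variables (roots : seq (seq nat)) (v : seq nat).

(** The boolean form of the hypotheses made above on P, on the diagonal of A and on the coweight
    v. *)
Definition root_list_check : bool :=
  [&& all (fun s => (size s == r) && has (leq 1) s) roots,
      all (fun i => nats_mem (simple_seq i) roots) (iota 0 r),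
      all (fun s => all (fun j => if eq_nats s (simple_seq j) then true
         else nats_mem (seq_reflection j s) roots) (iota 0 r)) roots,
      all (fun i => nth 0 (nth [::] rows i) i == 2) (iota 0 r) &
      all (fun i => 0 < sum_iota r
        (fun j => nth 0 (nth [::] rows i) j * (nth 0%N v j)%:Z)) (iota 0 r)].

Definition root_vecs : seq Q := [seq vec_of_seq s | s <- roots].

Hypothesis check : root_list_check.

Lemma root_list_size s : s \in roots -> size s = r.
Proof. by case/and5P: check => /allP c _ _ _ _ /c /andP[/eqP]. Qed.

Lemma nil_root (j : 'I_r) : [::] \notin roots.
Proof.
apply/negP => /root_list_size /= r0.
by have := leq_ltn_trans (leq0n j) (ltn_ord j); rewrite -r0.
Qed.

Lemma mem_root_vecs s : size s = r -> (vec_of_seq s \in root_vecs) = (s \in roots).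
Proof.
move=> ss; apply/mapP/idP => [[t tr st]|sr]; last by exists s.
by rewrite (vec_of_seq_inj ss (root_list_size tr) st).
Qed.

Lemma root_vecs_simple (i : 'I_r) : simple_vec i \in root_vecs.
Proof.
case/and5P: check => _ /allP c _ _ _; rewrite -simple_seqE.
by apply: map_f; rewrite -nats_memE; apply: c; rewrite mem_iota add0n ltn_ord.
Qed.

Lemma root_vecs_nonneg a : a \in root_vecs -> nonneg_vec a.
Proof.
case/mapP => s sr ->; case/and5P: check => /allP /(_ s sr) /andP[/eqP ss].
case/(has_nthP 0%N) => i; rewrite ss => ir si _ _ _ _.
apply/nonneg_vecP; split=> [/rowP /(_ (Ordinal ir))|j]; last by rewrite vec_of_seqE.
by rewrite vec_of_seqE mxE /=; move: si; case: nth.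
Qed.

Lemma root_vecs_reflection a (j : 'I_r) : a \in root_vecs ->
  a = simple_vec j \/ reflection A j a \in root_vecs.
Proof.
case/mapP => s sr ->; case/and5P: check => _ _ /allP /(_ s sr) /allP /(_ j) c _ _.
move: c; rewrite mem_iota add0n ltn_ord nats_memE eq_natsE => /(_ isT).
case: eqP => [->|_] sjr.
  by left; rewrite simple_seqE.
right; rewrite -seq_reflectionE; first exact: map_f.
move: sjr; rewrite /seq_reflection; case: ifP => // _.
by rewrite (negPf (nil_root j)).
Qed.

Lemma root_rows_diag (i : 'I_r) : A i i = 2.
Proof. by case/and5P: check => _ _ _ /allP c _; rewrite mxE; apply/eqP/c;
  rewrite mem_iota add0n ltn_ord. Qed.

Lemma root_rows_pos (i : 'I_r) : 0 < \sum_j A i j * (nth 0%N v j)%:Z.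
Proof.
case/and5P: check => _ _ _ _ /allP /(_ i); rewrite mem_iota /= sum_iotaE.
move=> /(_ (ltn_ord i)); congr (_ < _).
by apply: eq_bigr => j _; rewrite mxE.
Qed.

Variables (c d : nat -> seq nat -> int).

(** The boolean form of [parent] and [cd_compat]; coefficients at vectors off the list count as
    0. *)
Definition basis_check : bool :=
  all (fun s =>
    (if has (fun i => eq_nats s (simple_seq i)) (iota 0 r) then true
     else has (fun j => let t := seq_lower s j in
       if nats_mem t roots then (c j t != 0) && (d j s != 0) else false) (iota 0 r)) &&
    all (fun i => let t := incr_nth s i in
      if nats_mem t roots then
        let cis := c i s in
        all (fun j => (if i == j then - seq_ev s i else 0) +
          (if eq_nats s (simple_seq j) then nth 0 (nth [::] rows i) j
           else let u := seq_lower s j in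
             if nats_mem u roots then d j s * c i u else 0)
          == d j t * cis) (iota 0 r)
      else true) (iota 0 r)) roots.

Definition vec_fun (g : nat -> seq nat -> int) (i : 'I_r) (a : Q) : int :=
  if a \in root_vecs then g i (seq_of_vec a) else 0.

Lemma vec_fun_out g i a : a \notin root_vecs -> vec_fun g i a = 0.
Proof. by rewrite /vec_fun => /negPf ->. Qed.

Lemma vec_funE g (i : 'I_r) s : s \in roots -> vec_fun g i (vec_of_seq s) = g i s.
Proof.
by move=> sr; rewrite /vec_fun map_f // vec_of_seqK //; apply: root_list_size.
Qed.

Lemma lower_root s (j : 'I_r) : s \in roots ->
  (vec_of_seq s - simple_vec j \in root_vecs) = (seq_lower s j \in roots) /\
  (seq_lower s j \in roots -> vec_of_seq (seq_lower s j) = vec_of_seq s - simple_vec j).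
Proof.
move=> sr; have ss := root_list_size sr.
have [s0|sj] := posnP (nth 0%N s j).
  have -> : seq_lower s j = [::] by rewrite /seq_lower s0.
  rewrite (negPf (nil_root j)); split=> //;
    apply/negbTE/negP => /root_vecs_nonneg /nonneg_vecP [_ /(_ j)].
  by rewrite mxE vec_of_seqE mxE simple_vecE s0 eqxx.
by rewrite -seq_lowerE // mem_root_vecs // size_seq_lower.
Qed.

Hypothesis bcheck : basis_check.

Lemma basis_parent a : a \in root_vecs -> (exists i, a = simple_vec i) \/
  exists j, [&& a - simple_vec j \in root_vecs,
    vec_fun c j (a - simple_vec j) != 0 & vec_fun d j a != 0].
Proof.
case/mapP => s sr ->; have /allP/(_ s sr)/andP[par _] := bcheck.
move: par; case: ifP => [h _|_ h]; case/hasP: h => k; rewrite mem_iota add0n /= => kr.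
  by rewrite eq_natsE => /eqP ->; left; exists (Ordinal kr); rewrite -simple_seqE.
rewrite nats_memE; case: ifP => // lr /andP[cl dl]; right; exists (Ordinal kr).
have [-> lE] := lower_root (Ordinal kr) sr.
by rewrite -lE //= lr !vec_funE // cl dl.
Qed.

Lemma basis_compat (i j : 'I_r) a : a \in root_vecs -> a + simple_vec i \in root_vecs ->
  (if i == j then - (a *m A) 0 i else 0) +
  (if a == simple_vec j then A i j else vec_fun d j a * vec_fun c i (a - simple_vec j))
  = vec_fun d j (a + simple_vec i) * vec_fun c i a.
Proof.
case/mapP => s sr ->; rewrite -incr_seqE.
have ss : size (incr_nth s i) = r by rewrite size_incr_nth (root_list_size sr) ltn_ord.
rewrite mem_root_vecs // => ir.
have /allP /(_ s sr) /andP[_ /allP /(_ i)] := bcheck.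
rewrite mem_iota add0n ltn_ord /= nats_memE ir => /(_ isT) /allP /(_ j).
rewrite mem_iota add0n ltn_ord eq_natsE nats_memE => /(_ isT) /eqP.
rewrite seq_evE !vec_funE // => <-; congr (_ + _).
rewrite -simple_seqE (inj_in_eq (D := [pred s | size s == r])) //; first last.
- by rewrite inE size_simple_seq.
- by rewrite inE (root_list_size sr).
- by move=> x y /eqP sx /eqP sy; apply: vec_of_seq_inj.
case: eqP => _; first by rewrite mxE.
rewrite simple_seqE; have [E lE] := lower_root j sr.
case: ifP => lr; first by rewrite -lE // vec_funE.
by rewrite (vec_fun_out c) ?mulr0 // E lr.
Qed.

End Computation.

(** * Root lists and structure constants by type *)

Fixpoint root_layers (rows : seq (seq int)) (n : nat) (l : seq (seq nat)) : seq
  (seq nat) :=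
  if n is n'.+1 then
    l ++ root_layers rows n' (undup [seq seq_reflection (size rows) rows j s |
      s <- l, j <- [seq j <- iota 0 (size rows) | seq_ev (size rows) rows s j < 0]])
  else [::].

(** Each layer arises from the last by height-increasing simple reflections. In E8 a layer collects
    the roots of one height, at most 29, so 30 layers are enough; that the lists are complete is
    certified by [positive_roots_check]. *)
Definition positive_roots_of (rows : seq (seq int)) :=
  root_layers rows 30 [seq simple_seq (size rows) i | i <- iota 0 (size rows)].

Definition E6_roots := Eval vm_compute in positive_roots_of (cartan_rows E6).
Definition E7_roots := Eval vm_compute in positive_roots_of (cartan_rows E7).
Definition E8_roots := Eval vm_compute in positive_roots_of (cartan_rows E8).
Definition F4_roots := Eval vm_compute in positive_roots_of (cartan_rows F4).
Definition G2_roots := Eval vm_compute in positive_roots_of (cartan_rows G2).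

Definition positive_roots (t : exceptional) : seq (seq nat) :=
  match t with E6 => E6_roots | E7 => E7_roots | E8 => E8_roots
             | F4 => F4_roots | G2 => G2_roots end.

(* A multiple of the coefficients of the sum of the positive coroots. *)
Definition positive_coweight (t : exceptional) : seq nat :=
  match t with
  | E6 => [:: 8; 11; 15; 21; 15; 8]
  | E7 => [:: 34; 49; 66; 96; 75; 52; 27]
  | E8 => [:: 46; 68; 91; 135; 110; 84; 57; 29]
  | F4 => [:: 11; 21; 15; 8]
  | G2 => [:: 3; 5]
  end%N.

Lemma positive_roots_check t :
  root_list_check (rank t) (cartan_rows t) (positive_roots t) (positive_coweight t).
Proof. by case: t; vm_cast_no_check (erefl true). Qed.

(* The sign is eps(alpha_i, s) for a bilinear form eps with
   eps(a, b) eps(b, a) = (-1)^(a, b). *)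
Definition simply_laced_lower (t : exceptional) (i : nat) (s : seq nat) : int :=
  if ~~ nats_mem (incr_nth s i) (positive_roots t) then 0
  else if odd (nth 0%N s i + sumn [seq nth 0%N s j | j <- iota 0 (rank t) &
        (i < j)%N && (nth 0 (nth [::] (cartan_rows t) i) j != 0)]) then -1
  else 1.

(** If u and u + alpha_i are roots of a simply laced system, u has value -1 on H_i and [e_i,
    [f_i, f_u]] = f_u. The raising and lowering coefficients are then inverse signs, hence equal. *)
Definition simply_laced_raise t (i : nat) (s : seq nat) : int :=
  let u := seq_lower s i in
  if nats_mem u (positive_roots t) then simply_laced_lower t i u else 0.

(* Each row (s, (c, d)) records [f_i, f_s] = c_i f_(s + alpha_i) and
   [e_i, f_s] = d_i f_(s - alpha_i). *)
Definition F4_table : seq (seq nat * (seq int * seq int)) :=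
  [::
   ([:: 0; 0; 0; 1]%N, ([:: 0; 0; 1; 0], [:: 0; 0; 0; 0]));
   ([:: 0; 0; 1; 0]%N, ([:: 0; 1; 0; -1], [:: 0; 0; 0; 0]));
   ([:: 0; 1; 0; 0]%N, ([:: 1; 0; -1; 0], [:: 0; 0; 0; 0]));
   ([:: 1; 0; 0; 0]%N, ([:: 0; -1; 0; 0], [:: 0; 0; 0; 0]));
   ([:: 0; 0; 1; 1]%N, ([:: 0; 1; 0; 0], [:: 0; 0; 1; -1]));
   ([:: 0; 1; 1; 0]%N, ([:: 1; 0; 2; -1], [:: 0; 1; -2; 0]));
   ([:: 1; 1; 0; 0]%N, ([:: 0; 0; -1; 0], [:: 1; -1; 0; 0]));
   ([:: 0; 1; 1; 1]%N, ([:: 1; 0; 1; 0], [:: 0; 1; 0; -1]));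
   ([:: 0; 1; 2; 0]%N, ([:: 1; 0; 0; -1], [:: 0; 0; 1; 0]));
   ([:: 1; 1; 1; 0]%N, ([:: 0; 0; 2; -1], [:: 1; 0; -2; 0]));
   ([:: 0; 1; 2; 1]%N, ([:: 1; 0; 0; 1], [:: 0; 0; 1; -2]));
   ([:: 1; 1; 1; 1]%N, ([:: 0; 0; 1; 0], [:: 1; 0; 0; -1]));
   ([:: 1; 1; 2; 0]%N, ([:: 0; 1; 0; -1], [:: 1; 0; 1; 0]));
   ([:: 0; 1; 2; 2]%N, ([:: 1; 0; 0; 0], [:: 0; 0; 0; 2]));
   ([:: 1; 1; 2; 1]%N, ([:: 0; 1; 0; 1], [:: 1; 0; 1; -2]));
   ([:: 1; 2; 2; 0]%N, ([:: 0; 0; 0; -1], [:: 0; 1; 0; 0]));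
   ([:: 1; 1; 2; 2]%N, ([:: 0; 1; 0; 0], [:: 1; 0; 0; 2]));
   ([:: 1; 2; 2; 1]%N, ([:: 0; 0; 1; 1], [:: 0; 1; 0; -2]));
   ([:: 1; 2; 2; 2]%N, ([:: 0; 0; 2; 0], [:: 0; 1; 0; 2]));
   ([:: 1; 2; 3; 1]%N, ([:: 0; 0; 0; 1], [:: 0; 0; 1; 0]));
   ([:: 1; 2; 3; 2]%N, ([:: 0; 0; 1; 0], [:: 0; 0; 1; 1]));
   ([:: 1; 2; 4; 2]%N, ([:: 0; 1; 0; 0], [:: 0; 0; 2; 0]));
   ([:: 1; 3; 4; 2]%N, ([:: 1; 0; 0; 0], [:: 0; 1; 0; 0]));
   ([:: 2; 3; 4; 2]%N, ([:: 0; 0; 0; 0], [:: 1; 0; 0; 0]))].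

Definition F4_row (s : seq nat) : seq int * seq int :=
  nth ([::], [::]) [seq row.2 | row <- F4_table] (index s [seq row.1 | row <-
    F4_table]).

Definition F4_lower (i : nat) (s : seq nat) : int := nth 0 (F4_row s).1 i.

Definition F4_raise (i : nat) (s : seq nat) : int := nth 0 (F4_row s).2 i.

Definition lower_coef (t : exceptional) (i : nat) (s : seq nat) : int :=
  if nats_mem s (positive_roots t) then
    match t with F4 => F4_lower i s | _ => simply_laced_lower t i s end
  else 0.

Definition raise_coef (t : exceptional) (i : nat) (s : seq nat) : int :=
  match t with F4 => F4_raise i s | _ => simply_laced_raise t i s end.

(** G2 gets no table: its one |2|-grading, by alpha_2, has a line as g_(-2) and is excluded by
    dimension. *)
Lemma chevalley_basis_check t : t <> G2 ->
  basis_check (rank t) (cartan_rows t) (positive_roots t) (lower_coef t) (raise_coef t).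
Proof. case: t => [] tG; [| | | |by case: tG]; vm_cast_no_check (erefl true). Qed.

Lemma positive_roots_uniq t : uniq (positive_roots t).
Proof. by case: t; vm_cast_no_check (erefl true). Qed.

(** * A necessary condition for pseudo H-type *)

Section PseudoH.
Variables (R : realType) (n : lieAlgType R) (n2 n1 : {vspace n}).
Local Notation C := R[i].
Local Notation nC := (complexified R n).
Local Notation n1C := (complexified_subspace n1).
Local Notation n2C := (complexified_subspace n2).
Hypothesis hH : pseudo_H_type n2 n1.

(** Composing J with projections makes it total on n, so that its complexification can be written on
    pairs without subspace types. Non-degeneracy on n1 follows from that on n, as n1 and n2 are
    orthogonal. *)
Lemma pseudo_H_ambient : exists (B : {biscalar n}) (J : n -> n -> n),
  [/\ forall x y, B x y = B y x,
      nondegenerate_on B n1 /\ nondegenerate_on B n2,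
      forall z x, J z x \in n1,
      forall z x y, z \in n2 -> x \in n1 -> y \in n1 -> B (J z x) y = B [lie x, y] z &
      forall z x, z \in n2 -> x \in n1 -> J z (J z x) = - B z z *: x].
Proof.
have [[[sum _] _ _ _] [B [J [Bs B0 [Bf B2] BJ J2]]]] := hH.
exists B, (fun z x => vsval (J (vsproj n2 z) (vsproj n1 x))); split=> //.
- split=> // x xn1 x0; apply: Bf; first exact: memvf.
  move=> y _; have : y \in (n2 + n1)%VS by rewrite sum memvf.
  case/memv_addP=> y2 y2n [y1 y1n ->].
  by rewrite linearDr /= Bs B0 // x0 // addr0.
- by move=> z x; apply: subvsP.
- by move=> z x y zn xn yn; have := BJ (vsproj n2 z) (vsproj n1 x) (vsproj n1 y);
    rewrite !vsprojK.
- move=> z x zn xn; rewrite vsvalK J2 linearZ /=.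
  by rewrite !vsprojK.
Qed.

(** The map z |-> B(-, z) from n2 to its dual is injective, hence onto by dimension. *)
Lemma nondegenerate_repr (B : {biscalar n}) (a : n -> R) :
  nondegenerate_on B n2 -> (forall x y, B x y = B y x) -> scalar a ->
  exists2 z, z \in n2 & forall u, u \in n2 -> a u = B u z.
Proof.
move=> B2 Bs alin.
have Tlin1 (z : subvs_of n2) : linear (fun u : subvs_of n2 =>
  B (vsval u) (vsval z) : R^o).
  by move=> c u w; rewrite linearP /= linearPl.
pose T1 z : 'Hom(subvs_of n2, R^o) := linfun (HB.pack_for {linear subvs_of n2 -> R^o}
  (fun u : subvs_of n2 => B (vsval u) (vsval z) : R^o)
  (GRing.isLinear.Build _ _ _ _ _ (Tlin1 z))).
have T1E z u : T1 z u = B (vsval u) (vsval z) by rewrite lfunE.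
have Tlin : linear T1.
  move=> c z w; apply/lfunP => u.
  by rewrite add_lfunE scale_lfunE !T1E linearP /=.
pose T : 'Hom(subvs_of n2, 'Hom(subvs_of n2, R^o)) := linfun (HB.pack_for
  {linear subvs_of n2 -> 'Hom(subvs_of n2,
    R^o)} T1 (GRing.isLinear.Build _ _ _ _ _ Tlin)).
have TE z : T z = T1 z by rewrite lfunE.
have kerT : lker T = 0%VS.
  apply/eqP; rewrite -subv0; apply/subvP => z; rewrite memv_ker TE => /eqP z0.
  rewrite memv0; apply/eqP/val_inj; apply: B2; first exact: subvsP.
  move=> y yn; rewrite Bs; have := T1E z (Subvs yn).
  by rewrite z0 zero_lfunE.
have imT : limg T = fullv.
  apply/eqP; rewrite eqEdim subvf /=; have := limg_ker_dim T fullv.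
  by rewrite kerT capv0 dimv0 add0n => ->; rewrite !dimvf; apply: eq_leq; exact: muln1.
pose b : 'Hom(subvs_of n2, R^o) := linfun (HB.pack_for {linear subvs_of n2 -> R^o}
  (fun u : subvs_of n2 => a (vsval u) : R^o)
  (GRing.isLinear.Build _ _ _ _ _ (fun c u w =>
    etrans (congr1 a (linearP _ c u w)) (alin c (vsval u) (vsval w))))).
have : b \in limg T by rewrite imT memvf.
case/memv_imgP => z _ bz; exists (vsval z); first exact: subvsP.
move=> u un; have := congr1 (fun f : 'Hom(_, _) => f (Subvs un)) bz.
by rewrite /= TE T1E lfunE.
Qed.

Section Criterion.
Variables (B : {biscalar n}) (J : n -> n -> n).
Hypotheses (Bs : forall x y, B x y = B y x) (B1 : nondegenerate_on B n1)
  (B2 : nondegenerate_on B n2) (Jn1 : forall z x, J z x \in n1)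
  (BJ : forall z x y, z \in n2 -> x \in n1 -> y \in n1 ->
     B (J z x) y = B [lie x, y] z)
  (JJ : forall z x, z \in n2 -> x \in n1 -> J z (J z x) = - B z z *: x).

Let B_inj x y : x \in n1 -> y \in n1 ->
  (forall w, w \in n1 -> B x w = B y w) -> x = y.
Proof.
move=> xn yn xy; apply/eqP; rewrite -subr_eq0; apply/eqP/B1; first exact: rpredB.
by move=> w wn; rewrite linearBl xy // subrr.
Qed.

Let JDl z w x : z \in n2 -> w \in n2 -> x \in n1 -> J (z + w) x = J z x + J w x.
Proof.
move=> zn wn xn; apply: B_inj => [//||u un]; first exact: rpredD.
by rewrite linearDl !BJ ?rpredD // linearDr.
Qed.

Let JDr z x y : z \in n2 -> x \in n1 -> y \in n1 -> J z (x + y) = J z x + J z y.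
Proof.
move=> zn xn yn; apply: B_inj => [//||u un]; first exact: rpredD.
by rewrite linearDl !BJ ?rpredD // lieDl linearDl.
Qed.

Let JNr z x : z \in n2 -> x \in n1 -> J z (- x) = - J z x.
Proof.
move=> zn xn; apply: B_inj => [//||u un]; first by rewrite rpredN.
by rewrite linearNl !BJ ?rpredN // lieNl linearNl.
Qed.

Let anticommute z w x : z \in n2 -> w \in n2 -> x \in n1 ->
  J z (J w x) + J w (J z x) = - (2 * B z w) *: x.
Proof.
move=> zn wn xn.
have -> : J z (J w x) + J w (J z x) =
    J (z + w) (J (z + w) x) - (J z (J z x) + J w (J w x)).
  rewrite !(JDl, JDr) ?rpredD //; apply/eqP; rewrite eq_sym subr_eq.
  by apply/eqP; rewrite (AC (2*2) ((2*3)*(1*4))).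
rewrite !JJ ?rpredD // -scalerDl -scalerBl linearDl !linearDr (Bs w z).
by congr (_ *: _); ring.
Qed.

(** The bilinear, not the Hermitian, extension: it has isotropic vectors even when B is definite. *)
Definition complex_form (u w : nC) : C :=
  Complex (B u.1 w.1 - B u.2 w.2) (B u.1 w.2 + B u.2 w.1).

Definition complex_J (z x : nC) : nC :=
  (J z.1 x.1 - J z.2 x.2, J z.1 x.2 + J z.2 x.1).

Local Notation BC := complex_form.
Local Notation JC := complex_J.

Lemma complex_J_sub z x : n1C (JC z x).
Proof. by split; rewrite (rpredB, rpredD). Qed.

Lemma complex_formJ z x y : n2C z -> n1C x -> n1C y ->
  BC (JC z x) y = BC [lie x, y] z.
Proof.
case: z x y => [z1 z2] [x1 x2] [y1 y2] [/= ? ?] [/= ? ?] [/= ? ?].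
rewrite /BC /= !linearBl !linearDl !BJ //.
by congr Complex; ring.
Qed.

Lemma complex_J_anticommute z w x : n2C z -> n2C w -> n1C x ->
  JC z (JC w x) + JC w (JC z x) =
  Complex (- (2 * complex.Re (BC z w))) (- (2 * complex.Im (BC z w))) *: x.
Proof.
case: z w x => [z1 z2] [w1 w2] [x1 x2] [/= zn1 zn2] [/= wn1 wn2] [/= xn1 xn2].
have JB z x y (zn : z \in n2) (xn : x \in n1) (yn : y \in n1) :
  J z (x - y) = J z x - J z y by rewrite JDr ?rpredN // JNr.
have A (z w x y : n) (zn : z \in n2) (wn : w \in n2) (xn : x \in n1) :
  J z (J w x) + J w (J z x) = - (2 * B z w) *: x by apply: anticommute.
congr pair; rewrite /= !JB // !JDr // ?opprD !addrA.
  rewrite [LHS](ACl ((1*5)*(2*7)*(3*6)*(4*8))) /= -!opprD !A //.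
  rewrite -!scaleNr [LHS](ACl ((1*4)*(2*3))) /= -!scalerDl.
  by congr (_ *: _ + _ *: _); ring.
rewrite [LHS](ACl ((1*5)*(2*7)*(3*6)*(4*8))) /= -!opprD !A //.
rewrite -!scaleNr [LHS](ACl ((1*4)*(2*3))) /= -!scalerDl.
by congr (_ *: _ + _ *: _); ring.
Qed.

Lemma complex_formDr u v w : BC w (u + v) = BC w u + BC w v.
Proof.
case: u v w => [u1 u2] [v1 v2] [w1 w2]; rewrite /BC /= !linearDr.
by apply/eqP; rewrite eq_complex /=; apply/andP; split; apply/eqP; ring.
Qed.

Lemma complex_formC u v : BC u v = BC v u.
Proof.
case: u v => [u1 u2] [v1 v2]; rewrite /BC /= !(Bs v1) !(Bs v2).
by congr Complex; rewrite addrC.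
Qed.

Lemma complex_form0l w : BC 0 w = 0.
Proof. by rewrite /BC /= !linear0l subr0 addr0. Qed.

(** With w = z the anticommutation relation at x reads 0 = -2 BC(z, z) x. *)
Lemma complex_J_form z x : n2C z -> n1C x -> x <> 0 -> JC z x = 0 -> BC z z = 0.
Proof.
move=> zn xn x0 zx; have := complex_J_anticommute zn zn xn.
have JC0 : JC z 0 = 0.
  have J0 w : w \in n2 -> J w 0 = 0.
    by move=> wn; apply: (addrI (J w 0)); rewrite -JDr ?mem0v // !addr0.
  by case: zn => ? ?; rewrite /JC /= !J0 // subr0 addr0.
rewrite zx JC0 addr0 => /esym/eqP; rewrite scaler_eq0 => /orP[|/eqP //].
rewrite eq_complex /= !oppr_eq0 !mulf_eq0 pnatr_eq0 /= => /andP[/eqP re /eqP im].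
by apply/eqP; rewrite eq_complex /= re im !eqxx.
Qed.

Lemma complex_J_eq0 z x : n2C z -> n1C x ->
  (forall y, n1C y -> BC [lie x, y] z = 0) -> JC z x = 0.
Proof.
move=> zn xn xz; have [j1 j2] := complex_J_sub z x.
have E y : y \in n1 -> B (JC z x).1 y = 0 /\ B (JC z x).2 y = 0.
  (* Testing against real vectors is enough: the real and imaginary parts give one condition on each
     component of [JC z x]. *)
  move=> yn; have yC : n1C ((y, 0) : nC) by split=> //=; apply: mem0v.
  have := xz _ yC; rewrite -complex_formJ // => /eqP.
  rewrite eq_complex /= !linear0r subr0 add0r => /andP[/eqP ? /eqP ?].
  by split.
by rewrite [JC z x]surjective_pairing; congr pair; apply: B1 => // y /E[].
Qed.

(** The real and imaginary parts of zeta on real vectors are represented by z1 and z2; complex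
    linearity then makes z1 + i z2 represent zeta. *)
Lemma complex_functional_repr (zeta : 'Hom(nC, C^o)) :
  exists2 z, n2C z & forall u, n2C u -> zeta u = BC u z.
Proof.
have zC (c : C) (u : nC) : zeta (c *: u) = c * zeta u by rewrite linearZ.
pose a (u : n) := complex.Re (zeta (u, 0)); pose b (u : n) := complex.Im (zeta (u, 0)).
have E c (u w : n) : ((c *: u + w, 0) : nC) = (c%:C%C : C) *: ((u, 0) : nC) + ((w,
  0) : nC).
  by congr pair; rewrite /= ?scaler0 ?scale0r ?subr0 ?addr0.
have al : scalar a.
  move=> c u w; rewrite /a E linearD /= zC.
  by case: (zeta (u, 0)) (zeta (w, 0)) => p q [p' q'] /=; rewrite mul0r subr0.
have bl : scalar b.
  move=> c u w; rewrite /b E linearD /= zC.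
  by case: (zeta (u, 0)) (zeta (w, 0)) => p q [p' q'] /=; rewrite mul0r addr0.
have [z1 z1n aE] := nondegenerate_repr B2 Bs al.
have [z2 z2n bE] := nondegenerate_repr B2 Bs bl.
exists (z1, z2) => // -[u1 u2] [/= u1n u2n].
have uE : ((u1, u2) : nC) = ((u1, 0) : nC) + ('i%C : C) *: ((u2, 0) : nC).
  by congr pair; rewrite /= ?scaler0 ?scale0r ?scale1r ?subr0 ?addr0 ?add0r.
have zab w : zeta (w, 0) = Complex (a w) (b w) by rewrite /a /b; case: (zeta _).
rewrite [in LHS]uE linearD /= zC !zab !aE // !bE //.
by apply/eqP; rewrite eq_complex /=; apply/andP; split; apply/eqP; ring.
Qed.

End Criterion.

(* The functionals zeta_i correspond to vectors z_i of the complexified centre.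
   A nonzero radical of zeta_i + zeta_j makes z_i + z_j isotropic, so the z_i
   span an isotropic subspace, and the J_(z_i) anticommute and square to 0. *)
Lemma pseudo_H_radical (k : nat) (zeta : 'I_k -> 'Hom(nC, C^o)) :
  (exists2 x, n1C x & x <> 0) ->
  (forall i j, exists x, [/\ n1C x, x <> 0 &
     forall y, n1C y -> zeta i [lie x, y] + zeta j [lie x, y] = 0]) ->
  exists x, [/\ n1C x, x <> 0 & forall i y, n1C y -> zeta i [lie x, y] = 0].
Proof.
move=> ne rad; have [B [J [Bs [B1 B2] Jn1 BJ JJ]]] := pseudo_H_ambient.
have lie2 x y : n1C x -> n1C y -> n2C [lie x, y].
  have [[_ l2 _ _] _] := hH; case: x y => [x1 x2] [y1 y2] [/= ? ?] [/= ? ?].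
  by split; rewrite /= (rpredB, rpredD) // l2.
have /fin_all_exists2[z zn zE] : forall i, exists2 z, n2C z &
  forall u, n2C u -> zeta i u = complex_form B u z.
  by move=> i; apply: complex_functional_repr.
have n2D u w : n2C u -> n2C w -> n2C (u + w).
  by move=> [? ?] [? ?]; split; apply: rpredD.
have iso2 i j : complex_form B (z i + z j) (z i + z j) = 0.
  have [x [xn x0 xr]] := rad i j.
  have zn' : n2C (z i + z j) by apply: n2D.
  apply: (complex_J_form Bs B1 Jn1 BJ JJ zn' xn x0).
  apply: (complex_J_eq0 B1 Jn1 BJ zn' xn) => y yn.
  by rewrite complex_formDr -!zE ?xr //; apply: lie2.
(* [iso2] with equal indices says that four times the square of z_l is 0; the mixed case then leaves
   twice the product. *)
have iso i j : complex_form B (z i) (z j) = 0.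
  have iso1 l : complex_form B (z l) (z l) = 0.
    have := iso2 l l; rewrite !complex_formDr !(complex_formC Bs (_ + _))
      !complex_formDr.
    by move/eqP; rewrite -!mulr2n -mulrnA mulrn_eq0 => /eqP.
  have := iso2 i j; rewrite !complex_formDr !(complex_formC Bs (_ + _)) !complex_formDr.
  rewrite !iso1 add0r addr0 (complex_formC Bs (z j)) -mulr2n => /eqP.
  by rewrite mulrn_eq0 => /eqP.
have [x [xn x0 xz]] : exists x, [/\ n1C x, x <> 0 & forall i, complex_J J (z i) x = 0].
  (* The operators are treated one at a time, m counting those already annihilating x. *)
  suff: forall m, exists x, [/\ n1C x, x <> 0 & forall i : 'I_k,
    (i < m)%N -> complex_J J (z i) x = 0].
    by move=> /(_ k)[x [xn x0 xz]]; exists x; split=> // i; apply: xz.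
  elim=> [|m [x [xn x0 xz]]]; first by have [x ? ?] := ne; exists x.
  have [km|mk] := leqP k m.
    by exists x; split=> // i im; apply: xz; rewrite (leq_trans _ km).
  pose im := Ordinal mk.
  have [y0|yn0] := pselect (complex_J J (z im) x = 0).
    exists x; split=> // i; rewrite ltnS leq_eqVlt => /orP[/eqP ie|/xz //].
    by rewrite (_ : i = im) //; apply: val_inj.
  have JC0 w : n2C w -> complex_J J w 0 = 0.
    move=> wn; apply: (complex_J_eq0 B1 Jn1 BJ wn); first by split; apply: mem0v.
    by move=> y _; rewrite lie0l complex_form0l.
  (* If the next operator does not kill x, its value at x is the new vector: the operator itself
     kills it, having square 0, and the earlier ones do by anticommutation. *)
  exists (complex_J J (z im) x); split=> //; first exact: complex_J_sub.
  move=> i; rewrite ltnS leq_eqVlt => ile.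
  have := complex_J_anticommute Bs B1 Jn1 BJ JJ (zn i) (zn im) xn.
  rewrite iso /= mulr0 oppr0 scale0r.
  move: ile => /orP[/eqP ie|/xz ->]; last by rewrite JC0 // addr0.
  have -> : i = im by apply: val_inj.
  move/eqP; rewrite -mulr2n -scaler_nat scaler_eq0 pnatr_eq0 => /eqP //.
exists x; split=> // i y yn; rewrite zE; last exact: lie2.
by rewrite -(complex_formJ BJ) // xz complex_form0l.
Qed.

End PseudoH.

(** * The exceptional types *)

Definition seq_add (r : nat) (s u : seq nat) : seq nat :=
  [seq (nth 0%N s i + nth 0%N u i)%N | i <- iota 0 r].

Definition mask_height (r : nat) (m : bitseq) (s : seq nat) : nat :=
  sumn [seq nth 0%N s i | i <- iota 0 r & nth false m i].

Definition mask_of (r : nat) (Sigma : {set 'I_r}) : bitseq :=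
  [seq i \in Sigma | i <- enum 'I_r].

Lemma seq_addE r s u : vec_of_seq r (seq_add r s u) = vec_of_seq r s + vec_of_seq r u.
Proof.
apply/rowP => i; rewrite [RHS]mxE !vec_of_seqE (nth_map 0%N) ?size_iota //.
by rewrite nth_iota.
Qed.

Lemma size_seq_add r s u : size (seq_add r s u) = r.
Proof. by rewrite size_map size_iota. Qed.

Lemma size_mask_of r (Sigma : {set 'I_r}) : size (mask_of Sigma) = r.
Proof. by rewrite size_map size_enum_ord. Qed.

Lemma nth_mask_of r (Sigma : {set 'I_r}) (i : 'I_r) :
  nth false (mask_of Sigma) i = (i \in Sigma).
Proof. by rewrite (nth_map i) ?size_enum_ord // nth_ord_enum. Qed.

Lemma mask_heightE r (Sigma : {set 'I_r}) s :
  height Sigma (fun i => (nth 0%N s i)%:Z) = mask_height r (mask_of Sigma) s.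
Proof.
rewrite /height /mask_height sumnE big_map big_filter.
rewrite (_ : iota 0 r = index_iota 0 r) ?big_mkord; last by rewrite /index_iota subn0.
rewrite (big_morph Posz PoszD (erefl _)).
by apply: eq_bigl => i; rewrite nth_mask_of.
Qed.

(* The coefficient N with [f_s, f_u] = N f_(s + u), expanding f_s as a multiple
   of [f_j, f_(s - alpha_j)]; None when n is less than the height of s, or when
   no j with coefficient 1 or -1 is met. *)
Fixpoint bracket_coef (n : nat) (t : exceptional) (s u : seq nat) : option int :=
  if n is n'.+1 then
    let r := rank t in
    let roots := positive_roots t in
    if ~~ nats_mem s roots then Some 0 else
    if ~~ nats_mem u roots then Some 0 else
    if ~~ nats_mem (seq_add r s u) roots then Some 0 else
    let i := find (fun i => eq_nats s (simple_seq r i)) (iota 0 r) in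
    if (i < r)%N then Some (lower_coef t i u) else
    let j := find (fun j =>
      let c := lower_coef t j (seq_lower s j) in c * c == 1) (iota 0 r) in
    if (j < r)%N then
      let s' := seq_lower s j in
      match bracket_coef n' t s' u, bracket_coef n' t s' (incr_nth u j) with
      | Some a, Some b => Some (lower_coef t j s' *
          (a * lower_coef t j (seq_add r s' u) - lower_coef t j u * b))
      | _, _ => None
      end
    else None
  else None.

Definition highest_seq (t : exceptional) : seq nat :=
  match t with
  | E6 => [:: 1; 2; 2; 3; 2; 1]
  | E7 => [:: 2; 2; 3; 4; 3; 2; 1]
  | E8 => [:: 2; 3; 4; 6; 5; 4; 3; 2]
  | F4 => [:: 2; 3; 4; 2]
  | G2 => [:: 3; 2]
  end%N.

Lemma highest_seq_check t : (highest_seq t \in positive_roots t) &&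
  all (fun s => all (fun i => nth 0 s i <= nth 0 (highest_seq t) i)%N
    (iota 0 (rank t))) (positive_roots t).
Proof. by case: t; vm_cast_no_check (erefl true). Qed.

(** * Negative root vectors of an exceptional algebra *)

Section NegativeRoots.
Variables (K : numFieldType) (t : exceptional) (L : lieAlgType K) (h : {vspace L}).
Variable alpha : 'I_(rank t) -> functional h.
Local Notation r := (rank t).
Local Notation V := (vec_of_seq r).
Local Notation roots := (positive_roots t).

Definition root_vector_family (F : seq nat -> L) : Prop :=
  forall s, s \in roots -> root_space (root_at alpha (- V s)) (F s) /\ F s <> 0.

Hypothesis ex : exceptional_lie t alpha.

Let hC : cartan_subalgebra h. Proof. by case: ex. Qed.
Let hS : simple_roots alpha. Proof. by case: ex. Qed.
Let check := positive_roots_check t.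
Let P := root_vecs r roots.
Local Notation A := (\matrix_(i < r,
  j < r) nth 0 (nth [::] (cartan_rows t) i) j : 'M[int]_r).
Let A2 (i : 'I_r) : A i i = 2 := root_rows_diag check i.
Let v (i : 'I_r) : int := nth 0%N (positive_coweight t) i.
Let v_ge0 (i : 'I_r) : 0 <= v i. Proof. by []. Qed.
Let Av_gt0 (i : 'I_r) : 0 < \sum_j A i j * v j := root_rows_pos check i.
Let P_simple := root_vecs_simple check.
Let P_nonneg := root_vecs_nonneg check.
Let P_reflection := root_vecs_reflection check.
Let generators : exists e f H, chevalley_generators alpha A e f H.
Proof. by case: ex => _ _ _ /chevalley_generatorsP[]. Qed.

Let size_root s : s \in roots -> size s = r := @root_list_size _ _ _ _ check s.

Lemma root_of_at (a : 'I_r -> int) : root_of alpha a = root_at alpha (\row_i a i).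
Proof. by rewrite /root_at /root_of; apply: eq_bigr => i _; rewrite mxE. Qed.

Lemma exceptional_root (a : 'I_r -> int) : is_root (root_of alpha a) <->
  exists2 s, s \in roots & \row_i a i = V s \/ \row_i a i = - V s.
Proof.
have [e [f [H gen]]] := generators.
rewrite root_of_at is_rootE //; split=> [[a0 wa]|[s sr aE]]; last first.
  have Vs : V s \in P by apply: map_f.
  have [w1 w2] := weight_of_positive A2 gen v_ge0 Av_gt0 P_nonneg P_reflection Vs.
  have [V0 _] := nonneg_vecP _ (P_nonneg Vs).
  by case: aE => ->; split=> //; move/eqP; rewrite oppr_eq0 => /eqP.
have pos b : nonneg_vec b -> is_weight alpha b \/ is_weight alpha (- b) ->
    exists2 s, s \in roots & b = V s.
  move=> bn bw; have := positive_weight hS hC A2 gen v_ge0 Av_gt0 P_simple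
    P_reflection bn bw.
  by case/mapP => s; exists s.
case: (weight_sign hS wa) => sgn.
  by have [||s sr ->] := pos (\row_i a i); [exact/nonneg_vecP|left|exists s => //;
    left].
have [||s sr sE] := pos (- \row_i a i).
- apply/nonneg_vecP; split=> [/eqP|i]; first by rewrite oppr_eq0 => /eqP.
  by rewrite mxE oppr_ge0.
- by right; rewrite opprK.
- by exists s => //; right; rewrite -sE opprK.
Qed.

Lemma root_vector_line F s x : root_vector_family F -> s \in roots ->
  root_space (root_at alpha (- V s)) x -> exists c, x = c *: F s.
Proof.
move=> FP sr xw; have [e [f [H gen]]] := generators; have [Fw F0] := FP s sr.
apply: (weight_space_dim1 hS hC A2 gen v_ge0 Av_gt0 _ Fw xw F0).
exact/P_nonneg/map_f.
Qed.

Lemma root_vector_free F c : root_vector_family F ->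
  \sum_(s <- roots) c s *: F s = 0 -> forall s, s \in roots -> c s = 0.
Proof.
move=> FP S0 s sr; have [_ F0] := FP s sr.
have /eqP : c s *: F s = 0.
  apply: (eigen_sum0 (D := fun H : subvs_of h => lie (vsval H))
    (l := fun s H => root_at alpha (- V s) H) (v := fun s => c s *: F s)
    (positive_roots_uniq t)) => //.
    move=> s1 s2 sr1 sr2 s12; apply: contrapT => no; move/negP: s12; apply.
    apply/eqP/(vec_of_seq_inj (size_root sr1) (size_root sr2)).
    apply/oppr_inj/(root_at_inj hS)/lfunP => H; apply: contrapT => ne.
    by apply: no; exists H; apply/eqP.
  move=> s1 H sr1; have [Fw _] := FP s1 sr1.
  by rewrite /= lieZr Fw !scalerA mulrC.
by rewrite scaler_eq0 => /orP[/eqP //|/eqP].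
Qed.

(** These dual coordinates, restricted to degree -2, supply the functionals on the centre to which
    [pseudo_H_radical] is applied. *)
Lemma root_vector_coord F : root_vector_family F ->
  exists p : seq nat -> 'Hom(L, K^o), forall s u, s \in roots -> u \in roots ->
    p u (F s) = (s == u)%:R.
Proof.
move=> FP; pose X := in_tuple [seq F s | s <- roots].
have szX : size [seq F s | s <- roots] = size roots by rewrite size_map.
have frX : free X.
  apply/freeP => k k0 i.
  pose c s := if insub (index s roots) is Some j then k j else 0.
  have ci (j : 'I_(size [seq F s | s <- roots])) : c (nth [::] roots j) = k j.
    by rewrite /c index_uniq -?szX ?positive_roots_uniq // valK.
  rewrite -ci; apply: (@root_vector_free F c FP); last by rewrite mem_nth -?szX.
  rewrite (big_nth [::]) -{1}szX big_mkord -[RHS]k0; apply: eq_bigr => j _.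
  by rewrite ci (nth_map [::]) -?szX.
exists (fun u => if insub (index u roots) is Some j then linfun (coord X j : L ->
  K^o) else 0).
move=> s u sr ur; have iu w : w \in roots -> (index w roots < size [seq F s | s <-
  roots])%N.
  by rewrite szX index_mem.
rewrite /= insubT ?iu //= => iu'; rewrite lfunE /=.
have -> : F s = X`_(Ordinal (iu _ sr)).
  by rewrite /= (nth_map [::]) ?index_mem // nth_index.
rewrite coord_free // -val_eqE /=; congr (nat_of_bool _)%:R.
by apply/eqP/eqP => [/(congr1 (nth [::] roots))|->//]; rewrite !nth_index.
Qed.

Lemma root_vector_lie F s u : root_vector_family F -> s \in roots -> u \in roots ->
  exists k, [lie F s, F u] = k *: F (seq_add r s u) /\
    (seq_add r s u \notin roots -> k = 0).
Proof.
move=> FP sr ur; have [Fs _] := FP s sr; have [Fu _] := FP u ur.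
have w : root_space (root_at alpha (- V (seq_add r s u))) [lie F s, F u].
  by rewrite seq_addE opprD root_atD; apply: root_space_lie.
have [sur|sur] := boolP (seq_add r s u \in roots).
  by have [k kE] := root_vector_line FP sur w; exists k.
exists 0; split=> //; rewrite scale0r; apply: contrapT => n0.
have [e [f [H gen]]] := generators; move/negP: sur; apply.
rewrite -(mem_root_vecs check) ?size_seq_add //.
apply: (positive_weight hS hC A2 gen v_ge0 Av_gt0 P_simple P_reflection).
  have [s0 sp] := nonneg_vecP _ (P_nonneg (map_f V sr)).
  have [_ up] := nonneg_vecP _ (P_nonneg (map_f V ur)).
  rewrite seq_addE; apply/nonneg_vecP; split=> [su0|i]; last by rewrite mxE addr_ge0.
  apply: s0; apply/rowP => i; apply/eqP; rewrite [X in _ == X]mxE eq_le sp andbT.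
  have /rowP/(_ i) := su0; rewrite mxE [RHS]mxE => /eqP; rewrite addr_eq0 => /eqP ->.
  by rewrite oppr_le0.
by right; exists [lie F s, F u].
Qed.

Lemma sigma_grading_neg F (Sigma : {set 'I_r}) (m : nat) x : root_vector_family F ->
  (0 < m)%N -> sigma_grading alpha Sigma (- m%:Z) x <->
  exists c : seq nat -> K,
    x = \sum_(s <- roots | mask_height r (mask_of Sigma) s == m) c s *: F s.
Proof.
move=> FP m0; set ht := mask_height r (mask_of Sigma).
have hE (a : 'I_r -> int) s : \row_i a i = - V s -> height Sigma a = - (ht s)%:Z.
  move=> aE; rewrite -mask_heightE /height -sumrN; apply: eq_bigr => i _.
  by have /rowP/(_ i) := aE; rewrite !mxE.
have hE' (a : 'I_r -> int) s : \row_i a i = V s -> height Sigma a = ht s.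
  move=> aE; rewrite -mask_heightE; apply: eq_bigr => i _.
  by have /rowP/(_ i) := aE; rewrite !mxE.
split; last first.
  case=> c ->; pose l := [seq s <- roots | ht s == m].
  exists (size l), (fun i => c (nth [::] l i)), (fun i => F (nth [::] l i)); split.
    move=> i; have := mem_nth [::] (ltn_ord i); rewrite mem_filter => /andP[/eqP hm sr].
    right; exists (fun j => - V (nth [::] l i) 0 j).
    have E : \row_j - V (nth [::] l i) 0 j = - V (nth [::] l i).
      by apply/rowP => j; rewrite [LHS]mxE [RHS]mxE.
    have [Fw _] := FP _ sr; rewrite root_of_at E; split=> //.
      by rewrite -E -root_of_at; apply/exceptional_root;
        exists (nth [::] l i) => //; right.
    by rewrite (hE _ (nth [::] l i)) // hm.
  by rewrite -big_filter -/l (big_nth [::]) big_mkord.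
case=> M [c [w [wS ->]]].
have TD : forall d1 d2 : seq nat -> K, \sum_(s <- roots | ht s == m) d1 s *: F s +
    \sum_(s <- roots | ht s == m) d2 s *: F s =
    \sum_(s <- roots | ht s == m) (d1 s + d2 s) *: F s.
  by move=> d1 d2; rewrite -big_split; apply: eq_bigr => s _; rewrite scalerDl.
have [d dE] : exists d : 'I_M -> seq nat -> K,
    forall i, w i = \sum_(s <- roots | ht s == m) d i s *: F s.
  apply: (fin_all_exists (P := fun i (d : seq nat -> K) =>
    w i = \sum_(s <- roots | ht s == m) d s *: F s)) => i.
  case: (wS i) => [[/eqP]|[a [ra ha aw]]].
    by rewrite oppr_eq0 => /eqP [m00]; move: m0; rewrite m00.
  have [s sr [/hE'|aE]] := (exceptional_root a).1 ra.
    by rewrite ha => /esym/eqP; case: (m) m0.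
  have /eqP := hE _ _ aE; rewrite ha eqr_opp eqz_nat => /eqP hm.
  have [|k ->] := root_vector_line FP sr (x := w i); first by rewrite -aE -root_of_at.
  exists (fun u => if u == s then k else 0).
  rewrite big_mkcond (bigD1_seq s) ?positive_roots_uniq //= -hm !eqxx big1 ?addr0
    // => u us.
  by rewrite (negPf us) scale0r if_same.
exists (fun s => \sum_i c i * d i s).
rewrite (eq_bigr _ (fun i _ => congr1 _ (dE i))).
under eq_bigr do rewrite scaler_sumr.
rewrite exchange_big /=; apply: eq_bigr => s _.
by rewrite scaler_suml; apply: eq_bigr => i _; rewrite scalerA.
Qed.

Lemma two_gradingE (Sigma : {set 'I_r}) :
  two_grading alpha Sigma <-> mask_height r (mask_of Sigma) (highest_seq t) = 2.
Proof.
have /andP[hr /allP hmax] := (highest_seq_check t).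
have le s (i : 'I_r) : s \in roots -> (nth 0 s i <= nth 0 (highest_seq t) i)%N.
  by move=> /hmax /allP /(_ i); rewrite mem_iota add0n ltn_ord; apply.
have hroot : is_root (root_of alpha (fun i : 'I_r => (nth 0%N (highest_seq t) i)%:Z)).
  by apply/exceptional_root; exists (highest_seq t) => //; left.
split=> [[a [ra amax] h2]|h2]; last first.
  exists (fun i : 'I_r => (nth 0%N (highest_seq t) i)%:Z);
    last by rewrite mask_heightE h2.
  split=> // b /exceptional_root [s sr [] /rowP bE] i; have := bE i; rewrite !mxE => ->.
    exact: le.
  by rewrite (@le_trans _ _ 0) // oppr_le0.
apply/eqP; rewrite -eqz_nat; apply/eqP; rewrite -mask_heightE; apply: etrans h2;
  apply: eq_bigr => i _.
have [s sr [] /rowP aE] := (exceptional_root a).1 ra.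
  have ai := aE i; rewrite !mxE in ai; apply/eqP.
  by rewrite eq_le (amax _ hroot) ai lez_nat le.
have [V0 _] := nonneg_vecP _ (P_nonneg (map_f V hr)).
exfalso; apply: V0; apply/rowP => j; apply/eqP; rewrite eq_le !mxE andbT.
by have := amax _ hroot j; have := aE j; rewrite !mxE => -> /le_trans; apply;
  rewrite oppr_le0.
Qed.

Definition bracket_family (F : seq nat -> L) : Prop :=
  forall n s u k, size s = r -> size u = r -> bracket_coef n t s u = Some k ->
    [lie F s, F u] = k%:~R *: F (seq_add r s u).

Lemma root_vector_family_exists : exists2 F, root_vector_family F &
  t <> G2 -> bracket_family F.
Proof.
have [e [f [H gen]]] := generators.
have [tG|tG] := pselect (t = G2).
  (* For G2 any nonzero vectors of the root spaces will do, since no brackets are prescribed. *)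
  have /choice[F FP] : forall s, exists x, s \in roots ->
      root_space (root_at alpha (- V s)) x /\ x <> 0.
    move=> s; have [sr|sr] := boolP (s \in roots); last by exists 0.
    have [_ [x xw x0]] := weight_of_positive A2 gen v_ge0 Av_gt0 P_nonneg P_reflection
      (map_f V sr : V s \in P).
    by exists x.
  by exists F.
have bcheck := chevalley_basis_check tG.
pose c (i : 'I_r) := vec_fun roots (lower_coef t) i.
pose d (i : 'I_r) := vec_fun roots (raise_coef t) i.
have c_out i a : a \notin P -> c i a = 0 by apply: vec_fun_out.
have par := basis_parent check bcheck.
have cd := basis_compat check bcheck.
pose F0 := chevalley_vec f [pred a | a \in P] c d.
have F0w := chevalley_vec_weight hS hC A2 gen v_ge0 Av_gt0 P_simple P_nonneg
  P_reflection c_out par cd.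
have F00 := chevalley_vec_neq0 hS hC A2 gen v_ge0 Av_gt0 P_simple P_nonneg
  P_reflection c_out par cd.
have F0out : forall a, a \notin P -> F0 a = 0 by apply: chevalley_vec_out.
exists (F0 \o V) => [s sr|_].
  by split; [apply: F0w | apply/F00/map_f].
have cE (i : 'I_r) u : size u = r -> c i (V u) = lower_coef t i u.
  move=> su; rewrite /c /vec_fun vec_of_seqK // (mem_root_vecs check su).
  by rewrite /lower_coef nats_memE; case: (u \in roots).
have memP s : size s = r -> (V s \in P) = (s \in roots) by apply: (mem_root_vecs check).
elim=> [//|n IH] s u k ss su /=; rewrite !nats_memE seq_addE.
have [sr|/=] := boolP (s \in roots); last first.
  by rewrite -memP // => /F0out -> [<-]; rewrite lie0l scale0r.
have [ur|/=] := boolP (u \in roots); last first.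
  by rewrite -memP // => /F0out -> [<-]; rewrite lie0r scale0r.
have [sur|/=] := boolP (_ \in roots); last first.
  rewrite -memP ?size_seq_add // seq_addE => out [<-]; rewrite scale0r.
  apply: (lie_chevalley_vec_out hS hC A2 gen v_ge0 Av_gt0 P_simple P_nonneg
    P_reflection c_out par cd) => //; exact: map_f.
have findP (p : pred nat) : (find p (iota 0 r) < r)%N -> p (find p (iota 0 r)).
  move=> lt; have hp : has p (iota 0 r) by rewrite has_find size_iota.
  by have := nth_find 0%N hp; rewrite nth_iota.
case: ifP => [ir|_].
  have := findP _ ir; set i := find _ _ in ir *.
  rewrite eq_natsE => /eqP -> [<-].
  have -> : V (simple_seq r i) = simple_vec (Ordinal ir) by rewrite -simple_seqE.
  rewrite /= /F0 chevalley_vec_simple // -(cE (Ordinal ir)) //.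
  rewrite (lie_f_chevalley_vec hS hC A2 gen v_ge0 Av_gt0 P_simple P_nonneg
    P_reflection c_out par cd).
  by rewrite addrC.
case: ifP => // jr; have /= /eqP := findP _ jr; set j := find _ _ in jr *.
set s' := seq_lower s j => cc.
(* [lower_coef] is 0 off the root list, so a coefficient of square 1 forces s' to be a root. *)
have sr' : s' \in roots.
  apply: contraT => out; move: cc; rewrite /lower_coef nats_memE (negPf out) mulr0.
  by move/eqP; rewrite eq_sym oner_eq0.
have ss' := size_root sr'; pose jo := Ordinal jr.
have sE : V s = V s' + simple_vec jo.
  by have [_ ->] := lower_root check jo sr; rewrite ?subrK.
have su' : size (incr_nth u j) = r by rewrite size_incr_nth su jr.
case e1: bracket_coef => [k1|//]; case e2: bracket_coef => [k2|//] [<-].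
have ab := IH _ _ _ ss' su e1; have abj := IH _ _ _ ss' su' e2.
rewrite /= !seq_addE (incr_seqE u jo) in ab abj.
rewrite /= sE -!(cE jo) ?size_seq_add // seq_addE.
apply: (lie_chevalley_vec_step hS hC A2 gen v_ge0 Av_gt0 P_simple P_nonneg
  P_reflection c_out par cd) => //.
by rewrite cE.
Qed.

End NegativeRoots.

(** * Gradings that are not of pseudo H-type *)

Definition graded_piece (t : exceptional) (m : bitseq) (k : nat) : seq (seq nat) :=
  [seq s <- positive_roots t | mask_height (rank t) m s == k].

(* Root vectors f_a, a in [:: a1; a2], pair nontrivially under the functionals
   dual to gammas only with f_delta, so that a combination of two of them lies
   in the radical; but no f_b of degree -1 lies in all radicals. The bound 40
   exceeds the height of every root. *)
Definition obstruction (t : exceptional) (m : bitseq) (a1 a2 delta : seq nat)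
    (gammas : seq (seq nat)) : bool :=
  let r := rank t in
  let deg1 := graded_piece t m 1 in
  [&& a1 != a2, nats_mem a1 deg1, nats_mem a2 deg1,
      all (fun g => nats_mem g (positive_roots t)) gammas,
      all (fun a => all (fun u =>
        if nats_mem (seq_add r a u) gammas then eq_nats u delta else true) deg1)
        [:: a1; a2] &
      all (fun b => has (fun u =>
        if nats_mem (seq_add r b u) gammas then
          (if bracket_coef 40 t b u is Some k then k != 0 else false) else false)
        deg1) deg1].

Section Obstruction.
Variables (R : realType) (t : exceptional) (L : lieAlgType R[i]) (h : {vspace L}).
Variable alpha : 'I_(rank t) -> functional h.
Hypothesis ex : exceptional_lie t alpha.
Variable Sigma : {set 'I_(rank t)}.
Hypothesis pH : negative_part_pseudo_H (sigma_grading alpha Sigma).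
Local Notation r := (rank t).
Local Notation m := (mask_of Sigma).
Local Notation C := R[i].

Lemma graded_piece_sum F (k : nat) x : root_vector_family alpha F -> (0 < k)%N ->
  sigma_grading alpha Sigma (- k%:Z) x <->
  exists c : seq nat -> C, x = \sum_(s <- graded_piece t m k) c s *: F s.
Proof.
move=> FP k0; split=> [/(sigma_grading_neg ex _ _ FP k0)|] [c xE].
  by exists c; rewrite big_filter.
by apply/(sigma_grading_neg ex _ _ FP k0); exists c; rewrite xE big_filter.
Qed.

(** Were g_(-2) a line, two real vectors u, v of n2 independent over R would become proportional
    over C. *)
Lemma negative_part_pseudo_H_dim : size (graded_piece t m 2) != 1%N.
Proof.
have [F FP _] := root_vector_family_exists ex.
have [n [n2 [n1 [hn dim2 [phi [inj _ im]]]]]] := pH.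
apply/negP => /eqP sz; have [g gE] : exists g, graded_piece t m 2 = [:: g].
  by case: graded_piece sz => [|g [|]] //; exists g.
have line u : u \in n2 -> exists a, phi ((u, 0) : complexified R n) = a *: F g.
  move=> un; have : negative_part (sigma_grading alpha Sigma) (-2) (phi ((u,
    0) : complexified R n)).
    by rewrite -im; exists (u, 0) => //; split=> //=; apply: mem0v.
  move/(graded_piece_sum _ FP (isT : 0 < 2)%N) => [c ->].
  by rewrite gE big_seq1; exists (c g).
have [u un u0] : exists2 u, u \in n2 & u != 0.
  apply: contrapT => no; have n20 : n2 = 0%VS.
    apply/eqP; rewrite -subv0; apply/subvP => u un; rewrite memv0.
    by apply: contrapT => /negP u0; apply: no; exists u.
  by rewrite n20 dimv0 in dim2.
have [v vn vu] : exists2 v, v \in n2 & v \notin <[u]>%VS.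
  apply: contrapT => no; have /dimvS : (n2 <= <[u]>)%VS.
    apply/subvP => v vn; apply: contrapT => /negP vu; apply: no; exists v => //.
  by rewrite dim_vline u0 leqNgt dim2.
have [a aE] := line u un; have [b bE] := line v vn.
have a0 : a != 0.
  apply: contra_neq u0 => a0; have := inj (u, 0) 0; rewrite aE a0 scale0r linear0.
  by move=> /(_ erefl) [].
have : phi ((v, 0) : complexified R n) = phi ((b / a) *: ((u, 0) : complexified R n)).
  by rewrite linearZ /= aE bE scalerA mulfVK.
(* The first component of a complex multiple of (u, 0) is a real multiple of u, so v would lie on
   the real line of u. *)
move=> /inj [vE _]; move/negP: vu; apply; rewrite vE scaler0 subr0.
by rewrite memvZ // memv_line.
Qed.

Lemma obstructionP a1 a2 delta gammas : t <> G2 ->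
  obstruction t m a1 a2 delta gammas -> False.
Proof.
move=> tG /and5P[a12 a1d a2d /allP groot /andP[/allP sparse /allP full]].
rewrite !nats_memE in a1d a2d.
have [F FP /(_ tG) Fb] := root_vector_family_exists ex.
have [n [n2 [n1 [hn _ [phi [inj phiL im]]]]]] := pH.
have [p pE] := root_vector_coord ex FP.
have im1 x : complexified_subspace n1 x ->
    exists c : seq nat -> C, phi x = \sum_(s <- graded_piece t m 1) c s *: F s.
  move=> xn; apply/(graded_piece_sum _ FP (isT : 0 < 1)%N).
  have := im (-1); rewrite /complexified_grading /= => /seteqP[+ _]; apply.
  by exists x.
have im1' (c : seq nat -> C) : exists2 x, complexified_subspace n1 x &
    phi x = \sum_(s <- graded_piece t m 1) c s *: F s.
  have : sigma_grading alpha Sigma (-1) (\sum_(s <- graded_piece t m 1) c s *: F s).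
    by apply/(graded_piece_sum _ FP (isT : 0 < 1)%N); exists c.
  have := im (-1); rewrite /complexified_grading /= => /seteqP[_ +] H;
    move=> /(_ _ H) [x xn xE].
  by exists x.
have deg1_root s : s \in graded_piece t m 1 -> s \in positive_roots t.
  by rewrite mem_filter => /andP[].
have uniq1 : uniq (graded_piece t m 1) by rewrite filter_uniq // positive_roots_uniq.
have sumF (k : C) s : s \in graded_piece t m 1 ->
    \sum_(u <- graded_piece t m 1) (if u == s then k else 0) *: F u = k *: F s.
  move=> sd; rewrite (bigD1_seq s) //= eqxx big1 ?addr0 // => u /negPf ->.
  by rewrite scale0r.
have free1 (c : seq nat -> C) : \sum_(s <- graded_piece t m 1) c s *: F s = 0 ->
    forall s, s \in graded_piece t m 1 -> c s = 0.
  rewrite big_filter big_mkcond /= => c0 s sd.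
  have := root_vector_free (c := fun s =>
    if mask_height r m s == 1%N then c s else 0) ex FP.
  move=> /(_ _ _ (deg1_root _ sd)); move: sd; rewrite mem_filter => /andP[-> _]; apply.
  rewrite -[RHS]c0; apply: eq_bigr => u _; by case: ifP => _ //; rewrite scale0r.
have sz s : s \in positive_roots t -> size s = r := root_list_size
  (positive_roots_check t) (s := s).
have p0 s u g : s \in positive_roots t -> u \in positive_roots t ->
    g \in positive_roots t -> seq_add r s u != g -> p g [lie F s, F u] = 0.
  move=> sr ur gr sug; have [k [-> k0]] := root_vector_lie ex FP sr ur.
  have [sur|/k0->] := boolP (seq_add r s u \in positive_roots t);
    last by rewrite scale0r linear0.
  by rewrite linearZ /= pE // (negPf sug) scaler0.
have groot' g : g \in gammas -> g \in positive_roots t by move/groot; rewrite nats_memE.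
have x0P x c : phi x = \sum_(s <- graded_piece t m 1) c s *: F s -> x <> 0 ->
    exists2 s, s \in graded_piece t m 1 & c s <> 0.
  move=> xE x0; apply: contrapT => no; apply/x0/inj; rewrite xE linear0.
  rewrite big_seq big1 // => s sd; have [->|/eqP cs] := eqVneq (c s) 0;
    first by rewrite scale0r.
  by case: no; exists s.
(* The functionals are the coordinates along the gammas, pulled back to the complexified algebra. *)
pose zeta (i : 'I_(size gammas)) := (p (nth [::] gammas i) \o phi)%VF.
have [||x [xn x0 xrad]] := @pseudo_H_radical R n n2 n1 hn _ zeta.
- have [x xn xE] := im1' (fun u => if u == a1 then 1 else 0); exists x => //.
  move=> x00; move: xE; rewrite x00 linear0 sumF // => /esym/eqP.
  rewrite scale1r => /eqP; have [] := FP a1 (deg1_root _ a1d) => _; exact.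
- move=> i j; set gi := nth [::] gammas i; set gj := nth [::] gammas j.
  have gir : gi \in gammas by apply: mem_nth.
  have gjr : gj \in gammas by apply: mem_nth.
  pose q z := p gi z + p gj z.
  have qZ k z : q (k *: z) = k * q z by rewrite /q !linearZ /= -mulrDr.
  have qD z1 z2 : q (z1 + z2) = q z1 + q z2 by rewrite /q !linearD addrACA.
  (* In the plane spanned by f_a1 and f_a2, pairing with f_delta is a single linear condition, and
     no other f_u gives one. *)
  have [c1 [c2 [cw cn]]] : exists c1 c2 : C,
      c1 * q [lie F a1, F delta] + c2 * q [lie F a2,
        F delta] = 0 /\ (c1 != 0) || (c2 != 0).
    have [w0|w0] := eqVneq (q [lie F a1, F delta]) 0.
      by exists 1, 0; rewrite w0 mulr0 mul0r addr0 oner_eq0.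
    exists (q [lie F a2, F delta]), (- q [lie F a1, F delta]).
    by rewrite mulNr mulrC subrr oppr_eq0 w0 orbT.
  pose c s := (if s == a1 then c1 else 0) + (if s == a2 then c2 else 0).
  have cE : \sum_(s <- graded_piece t m 1) c s *: F s = c1 *: F a1 + c2 *: F a2.
    by under eq_bigr do rewrite scalerDl; rewrite big_split /= !sumF.
  have [x xn xE] := im1' c; exists x; split=> //.
    move=> x00; move: xE; rewrite x00 linear0 => /esym /free1 c0.
    have := c0 _ a1d; have := c0 _ a2d; rewrite /c !eqxx (negPf a12) eq_sym (negPf a12).
    by rewrite add0r addr0 => c20 c10; move: cn; rewrite c10 c20 eqxx.
  move=> y /im1 [d yE];
    rewrite -[LHS]/((p gi \o phi)%VF [lie x, y] + (p gj \o phi)%VF [lie x, y]).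
  rewrite !comp_lfunE phiL xE cE yE -[LHS]/(q _) raddf_sum /=.
  have -> : q (\sum_(u <- graded_piece t m 1) [lie c1 *: F a1 + c2 *: F a2,
    d u *: F u]) =
      \sum_(u <- graded_piece t m 1) q [lie c1 *: F a1 + c2 *: F a2, d u *: F u].
    by rewrite /q !linear_sum -big_split.
  rewrite big_seq big1 // => u ud.
  rewrite lieZr qZ lieDl !lieZl qD !qZ; have [->|udelta] := eqVneq u delta;
    first by rewrite cw mulr0.
  have q0 a : a \in [:: a1; a2] -> q [lie F a, F u] = 0.
    move=> ad; have ar : a \in positive_roots t.
      by move: ad; rewrite !inE => /orP[] /eqP ->; apply: deg1_root.
    have := sparse a ad => /allP /(_ u ud); rewrite nats_memE eq_natsE (negPf udelta).
    case: ifP => // aug _; have ug := deg1_root _ ud; have z0 g : g \in gammas ->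
        p g [lie F a, F u] = 0.
      move=> gg; apply: p0 => //; first exact: groot'.
      by apply/eqP => auE; move: aug; rewrite auE gg.
    by rewrite /q !z0 // addr0.
  by rewrite !q0 ?inE ?eqxx ?orbT // !mulr0 addr0 mulr0.
(* The common radical is zero: if x has a nonzero coefficient at b, pair it with f_u for the u that
   [full] gives. Only the term at b reaches the root b + u, and its bracket coefficient is
   nonzero. *)
have [c xE] := im1 x xn; have [b bd cb] := x0P x c xE x0.
have /hasP[u ud] := full b bd; rewrite nats_memE; case: ifP => // bug.
case bk: bracket_coef => [k|//] k0.
have [br ur] := (deg1_root _ bd, deg1_root _ ud).
have [y yn yE] := im1' (fun s => if s == u then 1 else 0).
have ig : (index (seq_add r b u) gammas < size gammas)%N by rewrite index_mem.
have := xrad (Ordinal ig) y yn; rewrite /zeta comp_lfunE /= nth_index //.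
rewrite phiL xE yE sumF // scale1r lieC linearN raddf_sum linear_sum /= => /eqP.
rewrite oppr_eq0 (bigD1_seq b) //= big_seq_cond big1 => [|s /andP[sd sb]].
  rewrite addr0 lieZr (lieC (F u)) (Fb _ _ _ _ (sz _ br) (sz _ ur) bk) scalerN scalerA.
  rewrite linearN linearZ /= pE ?groot' // eqxx oppr_eq0 scaler_eq0 oner_eq0 orbF
    mulf_eq0 intr_eq0.
  by rewrite (negPf k0) orbF => /eqP.
rewrite lieZr linearZ /= (lieC (F u)) linearN /=.
suff -> : p (seq_add r b u) [lie F s, F u] = 0 by rewrite oppr0 scaler0.
have sr := deg1_root _ sd; apply: p0 => //; first exact: groot'.
apply: contra_neq sb => /(congr1 (vec_of_seq r)); rewrite !seq_addE => /addIr.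
by apply: vec_of_seq_inj; apply: sz.
Qed.

End Obstruction.

(** * Enumeration of the subsets Sigma *)

Fixpoint bitseqs (n : nat) : seq bitseq :=
  if n is n'.+1 then [seq b :: m | b <- [:: true;
    false], m <- bitseqs n'] else [:: [::]].

Lemma mem_bitseqs m : m \in bitseqs (size m).
Proof.
elim: m => [//|b m IH] /=; rewrite cats0 mem_cat.
by case: b; rewrite map_f ?orbT.
Qed.

Definition E6_mask := [:: true; false; false; false; false; true].
Definition F4_mask := [:: false; false; false; true].

Definition special_mask (t : exceptional) : option bitseq :=
  match t with
  | E6 => Some E6_mask
  | F4 => Some F4_mask
  | _ => None
  end.

(* For Sigma = {alpha_(i+1)}; delta is this simple root. *)
Definition obstruction_roots (t : exceptional) (i : nat) : seq (seq nat) :=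
  match t, i with
  | E6, 2 => [:: [:: 1; 1; 2; 2; 1; 0]; [:: 1; 1; 2; 2; 1; 1]; [:: 1; 1; 2; 2; 2; 1]]
  | E6, 4 => [:: [:: 0; 1; 1; 2; 2; 1]; [:: 1; 1; 1; 2; 2; 1]; [:: 1; 1; 2; 2; 2; 1]]
  | E7, 1 => [:: [:: 1; 2; 2; 3; 2; 1; 0]; [:: 1; 2; 2; 3; 2; 1; 1];
                 [:: 1; 2; 2; 3; 2; 2; 1]; [:: 1; 2; 2; 3; 3; 2; 1]]
  | E7, 5 => [:: [:: 0; 1; 1; 2; 2; 2; 1]; [:: 1; 1; 1; 2; 2; 2; 1];
                 [:: 1; 1; 2; 2; 2; 2; 1]; [:: 1; 1; 2; 3; 2; 2; 1];
                 [:: 1; 2; 2; 3; 2; 2; 1]]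
  | E8, 0 => [:: [:: 2; 2; 3; 4; 3; 2; 1; 0]; [:: 2; 2; 3; 4; 3; 2; 1; 1];
                 [:: 2; 2; 3; 4; 3; 2; 2; 1]; [:: 2; 2; 3; 4; 3; 3; 2; 1];
                 [:: 2; 2; 3; 4; 4; 3; 2; 1]; [:: 2; 2; 3; 5; 4; 3; 2; 1];
                 [:: 2; 3; 3; 5; 4; 3; 2; 1]]
  | _, _ => [::]
  end%N.

(** The two vectors are gamma_0 - delta and gamma_1 - delta, so that f_delta carries them to two
    different gammas. Every Sigma for which [mask_check] calls this test is a singleton, found as
    the first marked node. *)
Definition mask_obstructed (t : exceptional) (m : bitseq) : bool :=
  let i := find id m in
  let gammas := obstruction_roots t i in
  obstruction t m (seq_lower (nth [::] gammas 0) i) (seq_lower (nth [::] gammas 1) i)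
    (simple_seq (rank t) i) gammas.

Definition mask_check (t : exceptional) (m : bitseq) : bool :=
  if mask_height (rank t) m (highest_seq t) == 2 then
    if size (graded_piece t m 2) == 1 then true
    else if Some m == special_mask t then true
    else mask_obstructed t m
  else true.

Lemma bitseqs_check t : all (mask_check t) (bitseqs (rank t)).
Proof. by case: t; vm_cast_no_check (erefl true). Qed.

Lemma pseudo_H_mask (R : realType) (t : exceptional) (L : lieAlgType R[i])
    (h : {vspace L}) (alpha : 'I_(rank t) -> functional h)
    (Sigma : {set 'I_(rank t)}) :
  exceptional_lie t alpha -> two_grading alpha Sigma ->
  negative_part_pseudo_H (sigma_grading alpha Sigma) ->
  Some (mask_of Sigma) = special_mask t.
Proof.
move=> ex /(two_gradingE ex) h2 pH.
have := mem_bitseqs (mask_of Sigma); rewrite size_mask_of.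
move=> /(allP (bitseqs_check t)); rewrite /mask_check h2 eqxx.
rewrite (negPf (negative_part_pseudo_H_dim ex pH)); case: eqP => // _ ob.
exfalso; have [tG|tG] := pselect (t = G2); last exact: (obstructionP ex pH tG ob).
(* For G2 the list of gammas is empty, so the two roots required to be distinct coincide. *)
by move: (mask_of _) ob => m; rewrite /mask_obstructed tG => /and5P[/eqP].
Qed.

Lemma graded_lie_iso_refl (K : fieldType) (L : lieAlgType K) (G : int -> set L) :
  graded_lie_iso G G.
Proof.
exists \1%VF; split=> [x y||k]; first by rewrite !id_lfunE.
  by move=> x y; rewrite !id_lfunE.
apply/seteqP; split=> [_ [x Gx <-]|x Gx]; first by rewrite id_lfunE.
by exists x => //; rewrite id_lfunE.
Qed.

Lemma pseudo_H_classification (R : realType) (t : exceptional) (L : lieAlgType R[i])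
    (h : {vspace L}) (alpha : 'I_(rank t) -> functional h)
    (Sigma : {set 'I_(rank t)}) :
  exceptional_lie t alpha -> two_grading alpha Sigma ->
  negative_part_pseudo_H (sigma_grading alpha Sigma) ->
  graded_iso_to (sigma_grading alpha Sigma) E6 Sigma16 \/
  graded_iso_to (sigma_grading alpha Sigma) F4 Sigma4.
Proof.
move=> ex tg pH; have := pseudo_H_mask ex tg pH; clear tg pH.
case: t alpha Sigma ex => //= alpha Sigma ex [mE]; [left|right].
  have -> : Sigma = Sigma16.
    apply/setP => i; rewrite -nth_mask_of mE !inE.
    by case: i => [[|[|[|[|[|[|?]]]]]] ?].
  by exists L, h, alpha; split=> //; apply: graded_lie_iso_refl.
have -> : Sigma = Sigma4.
  apply/setP => i; rewrite -nth_mask_of mE !inE.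
  by case: i => [[|[|[|[|?]]]] ?].
by exists L, h, alpha; split=> //; apply: graded_lie_iso_refl.
Qed.

(** * The pseudo H-type algebra of a split Clifford module *)

Section TwoStep.
Variables (K : fieldType) (p q : nat).

(* The pair (z, x) has x in degree -1 and z in degree -2. *)
Definition two_step (U : 'I_p -> 'M[K]_q) : Type := ('rV[K]_p * 'rV[K]_q)%type.

Variable U : 'I_p -> 'M[K]_q.
Local Notation n := (two_step U).

HB.instance Definition _ := Vector.copy n ('rV[K]_p * 'rV[K]_q)%type.

(** Antisymmetrizing an arbitrary matrix makes the bracket alternating with no condition on U, so
    the Lie structure can be declared for every U. *)
Definition two_step_form (l : 'I_p) : 'M[K]_q := U l - (U l)^T.

Definition two_step_bracket (x y : 'rV[K]_q) : 'rV[K]_p :=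
  \row_l (x *m two_step_form l *m y^T) 0 0.

Definition two_step_lie (u v : n) : n := (two_step_bracket u.2 v.2, 0).

Fact two_step_bracket_linearl y : linear (two_step_bracket ^~ y).
Proof.
move=> c x x'; apply/rowP => l; rewrite [LHS]mxE.
by rewrite 2!mulmxDl -2!scalemxAl !mxE.
Qed.

Fact two_step_bracketC x y : two_step_bracket x y = - two_step_bracket y x.
Proof.
apply/rowP => l; rewrite [LHS]mxE [RHS]mxE [X in _ = - X]mxE.
have -> : (x *m two_step_form l *m y^T) 0 0 = ((x *m two_step_form l *m y^T)^T) 0 0.
  by rewrite [RHS]mxE.
rewrite !trmx_mul trmxK /two_step_form linearB /= trmxK -opprB.
by rewrite mulmxA mulmxN mulNmx mxE.
Qed.

Fact two_step_lie_linearl v : linear (two_step_lie ^~ v).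
Proof.
move=> c u w; congr pair; last by rewrite /= scaler0 addr0.
exact: two_step_bracket_linearl.
Qed.

Fact two_step_lie_linearr u : linear (two_step_lie u).
Proof.
move=> c v w; congr pair; last by rewrite /= scaler0 addr0.
rewrite /= two_step_bracketC two_step_bracket_linearl opprD -scalerN.
by rewrite -!two_step_bracketC.
Qed.

Fact two_step_bracketxx x : two_step_bracket x x = 0.
Proof.
apply/rowP => l; rewrite [LHS]mxE [RHS]mxE /two_step_form mulmxBr mulmxBl [LHS]mxE
  [X in _ + X]mxE.
have -> : (x *m (U l)^T *m x^T) 0 0 = ((x *m (U l)^T *m x^T)^T) 0 0 by rewrite [RHS]mxE.
by rewrite !trmx_mul !trmxK mulmxA subrr.
Qed.

Fact two_step_lie_jacobi u v w :
  two_step_lie u (two_step_lie v w) + two_step_lie v (two_step_lie w u) +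
  two_step_lie w (two_step_lie u v) = 0.
Proof.
have b0 x : two_step_bracket x 0 = 0.
  by apply/rowP => l; rewrite mxE trmx0 mulmx0 !mxE.
by rewrite /two_step_lie /= !b0; congr pair; rewrite /= !addr0.
Qed.

End TwoStep.

HB.instance Definition _ (K : fieldType) p q (U : 'I_p -> 'M[K]_q) :=
  Vector_isLieAlgebra.Build K (two_step U)
    (@two_step_lie_linearl K p q U) (@two_step_lie_linearr K p q U)
    (fun u => congr1 (fun z =>
      (z, 0)) (two_step_bracketxx U u.2)) (@two_step_lie_jacobi K p q U).

Section CliffordModel.
Variables (K : numFieldType) (p q : nat) (U : 'I_p -> 'M[K]_q).
Variables (b2 : 'M[K]_p) (b1 : 'M[K]_q).
Local Notation n := (two_step U).

(** The matrix of the form (x, y) |-> <[x, y], z_k>. As b1 is its own inverse, J_(z_k) acts on row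
    vectors by [omega k *m b1]. *)
Definition omega (k : 'I_p) : 'M[K]_q := \sum_l b2 l k *: two_step_form U l.

Hypotheses (b2T : b2^T = b2) (b2u : b2 \in unitmx) (b1T : b1^T = b1)
  (b1K : b1 *m b1 = 1%:M).
Hypothesis clifford : forall k l : 'I_p,
  omega k *m b1 *m (omega l *m b1) + omega l *m b1 *m (omega k *m b1)
    = (- 2 * b2 k l)%:M.
Hypothesis nonabelian : exists l, two_step_form U l != 0.

Let iota2 (z : 'rV[K]_p) : n := (z, 0).
Let iota1 (x : 'rV[K]_q) : n := (0, x).
Fact iota2_linear : linear iota2.
Proof. by move=> c z w; congr pair; rewrite /= scaler0 addr0. Qed.
Fact iota1_linear : linear iota1.
Proof. by move=> c z w; congr pair; rewrite /= scaler0 addr0. Qed.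
HB.instance Definition _ := GRing.isLinear.Build K _ n _ iota2 iota2_linear.
HB.instance Definition _ := GRing.isLinear.Build K _ n _ iota1 iota1_linear.

Definition two_step_center : {vspace n} := limg (linfun iota2).
Definition two_step_complement : {vspace n} := limg (linfun iota1).

Lemma mem_two_step_center (u : n) : (u \in two_step_center) = (u.2 == 0).
Proof.
apply/memv_imgP/eqP => [[z _ ->]|u0]; first by rewrite lfunE.
by exists u.1; rewrite ?memvf // lfunE /= /iota2 -u0 -surjective_pairing.
Qed.

Lemma mem_two_step_complement (u : n) : (u \in two_step_complement) = (u.1 == 0).
Proof.
apply/memv_imgP/eqP => [[z _ ->]|u0]; first by rewrite lfunE.
by exists u.2; rewrite ?memvf // lfunE /= /iota1 -u0 -surjective_pairing.
Qed.

Lemma dim_two_step_center : \dim two_step_center = p.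
Proof.
rewrite limg_dim_eq; first by rewrite dimvf; apply: mul1n.
apply/eqP; rewrite -subv0; apply/subvP => z;
  rewrite memv_cap memv_ker lfunE => /andP[_].
by case/eqP => ->; rewrite mem0v.
Qed.

Definition model_form (u v : n) : K :=
  (u.1 *m b2 *m v.1^T + u.2 *m b1 *m v.2^T) 0 0.

Fact model_form_bilinear : bilinear_for *%R *%R model_form.
Proof.
split=> w c u v; rewrite /model_form /=.
  rewrite !mulmxDl -!scalemxAl addrACA -scalerDr mxE; congr (_ + _).
  by rewrite mxE.
rewrite !linearP /= addrACA -scalerDr mxE; congr (_ + _).
by rewrite mxE.
Qed.

HB.instance Definition _ := bilinear_isBilinear.Build K n n K *%R *%R model_form
  model_form_bilinear.

Lemma model_formE u v : model_form u v =
  (u.1 *m b2 *m v.1^T) 0 0 + (u.2 *m b1 *m v.2^T) 0 0.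
Proof. by rewrite /model_form mxE. Qed.

Lemma mx11_tr (M : 'M[K]_1) : M 0 0 = M^T 0 0.
Proof. by rewrite mxE. Qed.

Lemma model_formC u v : model_form u v = model_form v u.
Proof.
by rewrite !model_formE mx11_tr [X in _ + X]mx11_tr !trmx_mul !trmxK b2T b1T !mulmxA.
Qed.

Lemma unitmx_nondegenerate m (b : 'M[K]_m) (x : 'rV_m) : b \in unitmx ->
  (forall y : 'rV_m, (x *m b *m y^T) 0 0 = 0) -> x = 0.
Proof.
move=> bu xb; have : x *m b = 0.
  apply/rowP => i; have := xb (delta_mx 0 i).
  by rewrite trmx_delta -colE !mxE.
by move/(congr1 (mulmx^~ (invmx b))); rewrite mulmxK // mul0mx.
Qed.

Definition model_J (z : 'rV[K]_p) : 'M[K]_q := \sum_k z 0 k *: (omega k *m b1).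

Lemma model_J_form z x y :
  (x *m model_J z *m b1 *m y^T) 0 0 = (two_step_bracket U x y *m b2 *m z^T) 0 0.
Proof.
rewrite -[RHS]/(((two_step_bracket U x y *m b2) *m z^T) 0 0) [RHS]mxE.
rewrite /model_J mulmx_sumr !mulmx_suml summxE; apply: eq_bigr => k _.
rewrite -scalemxAr -!scalemxAl mxE [z^T _ _]mxE mulrC; congr (_ * _).
rewrite -!mulmxA (mulmxA b1) b1K mul1mx !mulmxA /omega mulmx_sumr mulmx_suml summxE
  [RHS]mxE.
apply: eq_bigr => l _;
  rewrite -scalemxAr -scalemxAl mxE mulrC [two_step_bracket _ _ _ _ _]mxE.
by [].
Qed.

Lemma model_J_sq z : model_J z *m model_J z = (- (z *m b2 *m z^T) 0 0)%:M.
Proof.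
(* After doubling, the indices k and l are exchanged in one copy of the double sum, and the Clifford
   relations apply termwise. *)
apply: (can_inj (g := fun M => 2^-1 *: M) (f := fun M : 'M[K]_q => 2 *: M)).
  by move=> M; rewrite scalerA mulVf ?scale1r ?pnatr_eq0.
have E : model_J z *m model_J z =
    \sum_k \sum_l (z 0 k * z 0 l) *: (omega k *m b1 *m (omega l *m b1)).
  rewrite {1}/model_J mulmx_suml; apply: eq_bigr => k _.
  rewrite /model_J mulmx_sumr; apply: eq_bigr => l _.
  by rewrite -scalemxAl -scalemxAr scalerA.
rewrite (_ : 2 = 1 + 1) // scalerDl scale1r {2}E exchange_big E -big_split /=.
transitivity (\sum_k \sum_l (z 0 k * z 0 l) *: (- 2 * b2 k l)%:M : 'M[K]_q).
  apply: eq_bigr => k _; rewrite -big_split; apply: eq_bigr => l _.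
  by rewrite /= [z 0 l * _]mulrC -scalerDr clifford.
transitivity ((\sum_k \sum_l (z 0 k * z 0 l) * (- 2 * b2 k l))%:M : 'M[K]_q).
  rewrite raddf_sum; apply: eq_bigr => k _; rewrite raddf_sum; apply: eq_bigr => l _.
  by rewrite scale_scalar_mx.
rewrite scale_scalar_mx; congr _%:M.
rewrite mxE exchange_big /= mulrN mulr_sumr -sumrN; apply: eq_bigr => l _.
rewrite mxE [z^T _ _]mxE mulr_suml mulr_sumr -sumrN; apply: eq_bigr => k _.
by ring.
Qed.

Definition model_J_end (z : subvs_of two_step_center) (x : subvs_of
  two_step_complement) :
    subvs_of two_step_complement :=
  vsproj two_step_complement (iota1 ((vsval x).2 *m model_J (vsval z).1)).

Fact model_J_end_linear z : linear (model_J_end z).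
Proof.
move=> c x y; rewrite /model_J_end linearP /= mulmxDl -scalemxAl.
by rewrite linearP /= linearP.
Qed.

Lemma model_J_endE z x : vsval (model_J_end z x) =
  iota1 ((vsval x).2 *m model_J (vsval z).1).
Proof. by rewrite vsprojK // mem_two_step_complement. Qed.

Lemma pseudo_H_two_step : pseudo_H_type two_step_center two_step_complement.
Proof.
have iotaE (u : n) : u = iota2 u.1 + iota1 u.2.
  by case: u => z x; congr pair; rewrite /= ?addr0 ?add0r.
have pair0 (u : n) : u.1 = 0 -> u.2 = 0 -> u = 0.
  by case: u => z x /= -> ->.
have [b1u _] := mulmx1_unit b1K.
split.
  split.
  - split.
      apply/eqP; rewrite eqEsubv subvf; apply/subvP => u _; rewrite [u]iotaE.
      by apply: memv_add; rewrite ?mem_two_step_center ?mem_two_step_complement.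
    apply/eqP; rewrite -subv0; apply/subvP => u.
    rewrite memv_cap mem_two_step_center mem_two_step_complement memv0 =>
      /andP[/eqP u2 /eqP u1].
    by apply/eqP/pair0.
  - by move=> x y _ _; rewrite mem_two_step_center.
  - move=> z x; rewrite mem_two_step_center => /eqP z2;
      rewrite /lie /= /two_step_lie z2.
    by congr pair; apply/rowP => l; rewrite mxE !mul0mx !mxE.
  have [l /eqP Ul] := nonabelian.
  apply: contrapT => no; apply: Ul; apply/matrixP => i j; rewrite [RHS]mxE.
  have /eqP : [lie iota1 (delta_mx 0 i), iota1 (delta_mx 0 j)] = 0.
    by apply: contrapT => /eqP ne; apply: no;
      exists (iota1 (delta_mx 0 i)), (iota1 (delta_mx 0 j)).
  case/eqP => /rowP /(_ l); rewrite mxE [RHS]mxE /= -rowE trmx_delta -colE => ij0.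
  by apply: etrans _ ij0; rewrite !mxE.
exists model_form, (fun z => linfun (HB.pack_for
  {linear subvs_of two_step_complement -> subvs_of two_step_complement}
  (model_J_end z) (GRing.isLinear.Build _ _ _ _ _ (model_J_end_linear z)))).
split.
- exact: model_formC.
- move=> z x; rewrite mem_two_step_center mem_two_step_complement => /eqP z2 /eqP x1.
  by rewrite /= model_formE z2 x1 trmx0 mulmx0 !mul0mx !mxE addr0.
- split=> [u _|u] u0.
    apply: pair0.
      apply: (unitmx_nondegenerate b2u) => y; have := u0 (iota2 y) (memvf _).
      by rewrite /= model_formE /= trmx0 mulmx0 [X in _ + X]mxE addr0.
    apply: (unitmx_nondegenerate b1u) => y; have := u0 (iota1 y) (memvf _).
    by rewrite /= model_formE /= trmx0 mulmx0 [X in X + _]mxE add0r.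
  move: u0; rewrite mem_two_step_center => /eqP u2 u0.
  apply: pair0 => //.
  apply: (unitmx_nondegenerate b2u) => y; have := u0 (iota2 y).
  rewrite mem_two_step_center eqxx /= model_formE u2 /= !mul0mx [X in _ + X]mxE addr0.
  exact.
- move=> z x y; rewrite lfunE /= model_J_endE !model_formE /= !mul0mx.
  by rewrite [X in X + _ = _]mxE [X in _ = _ + X]mxE add0r addr0 model_J_form.
- move=> z x; apply: val_inj; rewrite !lfunE /= model_J_endE.
  rewrite model_J_endE /= -mulmxA model_J_sq mul_mx_scalar.
  have := subvsP x; have := subvsP z.
  rewrite mem_two_step_center mem_two_step_complement => /eqP z2 /eqP x1.
  by rewrite /= model_formE z2 !mul0mx [X in _ + X]mxE addr0 linearZ /=;
    congr (_ *: _); apply: injective_projections.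
Qed.

End CliffordModel.

(* A square matrix with at most one nonzero entry per row: row i holds the
   column and the value of that entry. *)
Definition monomial := seq (nat * int).

Definition monomial_entry (M : monomial) (i j : nat) : int :=
  let e := nth (0%N, 0) M i in if eqn e.1 j then e.2 else 0.

Definition monomial_mul (M N : monomial) : monomial :=
  [seq (let e' := nth (0%N, 0) N e.1 in (e'.1, e.2 * e'.2)) | e <- M].

(** For fixed s at most one u satisfies s + u = g, so each form is monomial; the entry (0, 0)
    encodes a zero row. *)
Definition structure_forms (t : exceptional) (m : bitseq) : seq monomial :=
  let deg1 := graded_piece t m 1 in
  [seq [seq (let j := find (fun u => eq_nats (seq_add (rank t) s u) g) deg1 in
             if (j < size deg1)%N then
               (j, odflt 0 (bracket_coef 40 t s (nth [::] deg1 j)))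
             else (0%N, 0)) | s <- deg1] | g <- graded_piece t m 2].

Definition E6_forms := Eval vm_compute in structure_forms E6 E6_mask.
Definition F4_forms := Eval vm_compute in structure_forms F4 F4_mask.

Definition identity_entry (c : int) (i j : nat) : int := if eqn i j then c else 0.

(* J_k is determined by B1 (J_k x) y = B2 [x, y] z_k, where B1 squares to 1. *)
Definition clifford_monomial (forms : seq monomial) (b1 b2 : monomial) (k : nat) :
  monomial :=
  let e := nth (0%N, 0) b2 k in
  monomial_mul [seq (e'.1, e.2 * e'.2) | e' <- nth [::] forms e.1] b1.

Definition all_iota (n : nat) (P : pred nat) : bool := all P (iota 0 n).

Lemma all_iotaP n (P : pred nat) : all_iota n P -> forall i : 'I_n, P i.
Proof. by move=> /allP nP i; apply: nP; rewrite mem_iota add0n ltn_ord. Qed.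

(* b2' is 4 times the inverse of b2. *)
Definition clifford_check (p q : nat) (forms : seq monomial) (b1 b2 b2' : monomial)
  : bool :=
  let en := monomial_entry in
  let wf n (M : monomial) := (size M == n) && all (fun e => e.1 < n)%N M in
  let J := [seq clifford_monomial forms b1 b2 k | k <- iota 0 p] in
  [&& [&& size forms == p, all (wf q) forms, wf q b1, wf p b2 & wf p b2'],
      all_iota p (fun l => all_iota q (fun i => all_iota q (fun j =>
        en (nth [::] forms l) j i == - en (nth [::] forms l) i j))),
      all_iota q (fun i => all_iota q (fun j => (en b1 i j == en b1 j i) &&
        (en (monomial_mul b1 b1) i j == identity_entry 1 i j))),
      all_iota p (fun k => all_iota p (fun l => (en b2 k l == en b2 l k) &&
        (en (monomial_mul b2 b2') k l == identity_entry 4 k l))),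
      all_iota p (fun k => all_iota p (fun l =>
        let JJ := monomial_mul (nth [::] J k) (nth [::] J l) in
        let JJ' := monomial_mul (nth [::] J l) (nth [::] J k) in
        let c := - 2 * en b2 k l in
        all_iota q (fun i => all_iota q (fun j =>
          en JJ i j + en JJ' i j == identity_entry c i j)))) &
      let C := nth [::] forms 0%N in
      [&& (0 < p)%N, (0 < q)%N & en C 0%N (nth (0%N, 0) C 0%N).1 != 0]].

(* The g_0-invariant forms on g_(-1) and g_(-2), scaled so that the Clifford
   relations hold. *)
Definition E6_b1 : monomial :=
  [:: (14%N, 1); (15%N, 1); (12%N, 1); (13%N, 1); (10%N, -1); (11%N, 1); (7%N, 1);
    (6%N, 1);
      (9%N, -1); (8%N, -1); (4%N, -1); (5%N, 1); (2%N, 1); (3%N, 1); (0%N, 1);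
        (1%N, 1)].
Definition E6_b2 : monomial :=
  [:: (7%N, 2); (6%N, 2); (5%N, -2); (4%N, 2); (3%N, 2); (2%N, -2); (1%N, 2); (0%N, 2)].
Definition F4_b1 : monomial :=
  [:: (7%N, 1); (6%N, -1); (5%N, 1); (4%N, -1); (3%N, -1); (2%N, 1); (1%N, -1);
    (0%N, 1)].
Definition F4_b2 : monomial :=
  [:: (5%N, 2); (4%N, -2); (3%N, 2); (2%N, 2); (1%N, -2); (0%N, 2); (6%N, -1)].
Definition F4_b2' : monomial :=
  [:: (5%N, 2); (4%N, -2); (3%N, 2); (2%N, 2); (1%N, -2); (0%N, 2); (6%N, -4)].

Lemma E6_clifford_check : clifford_check 8 16 E6_forms E6_b1 E6_b2 E6_b2.
Proof. by vm_cast_no_check (erefl true). Qed.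

Lemma F4_clifford_check : clifford_check 7 8 F4_forms F4_b1 F4_b2 F4_b2'.
Proof. by vm_cast_no_check (erefl true). Qed.

(** [structure_forms] puts 0 where [bracket_coef] fails. This check confirms that it never fails,
    that all entries agree, and that every nonzero bracket lands on a listed root of degree -2. *)
Definition brackets_check (t : exceptional) (m : bitseq) (forms : seq monomial) :
  bool :=
  let deg1 := graded_piece t m 1 in
  let deg2 := graded_piece t m 2 in
  all_iota (size deg1) (fun i => all_iota (size deg1) (fun j =>
    let s := nth [::] deg1 i in let u := nth [::] deg1 j in
    if bracket_coef 40 t s u is Some N then
      (if N == 0 then true else nats_mem (seq_add (rank t) s u) deg2) &&
      all_iota (size deg2) (fun l => monomial_entry (nth [::] forms l) i j ==
        (if eq_nats (seq_add (rank t) s u) (nth [::] deg2 l) then N else 0))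
    else false)).

Lemma E6_brackets_check : brackets_check E6 E6_mask E6_forms.
Proof. by vm_cast_no_check (erefl true). Qed.

Lemma F4_brackets_check : brackets_check F4 F4_mask F4_forms.
Proof. by vm_cast_no_check (erefl true). Qed.

(** * From monomial matrices to the pseudo H-type model *)

Section Monomial.
Variables (K : numFieldType).

Definition monomial_mx (q : nat) (M : monomial) : 'M[K]_q :=
  \matrix_(i, j) (monomial_entry M i j)%:~R.

Lemma monomial_mx_mul q M N : size M = q -> all (fun e => e.1 < q)%N M ->
  monomial_mx q M *m monomial_mx q N = monomial_mx q (monomial_mul M N).
Proof.
move=> sM /allP Mq; apply/matrixP => i j; rewrite !mxE.
have iM : (i < size M)%N by rewrite sM.
pose e := nth (0%N, 0) M i; have eq : (e.1 < q)%N by apply: Mq; apply: mem_nth.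
rewrite (bigD1 (Ordinal eq)) //= big1 => [|k ke].
  rewrite !mxE addr0 -intrM; congr _%:~R.
  rewrite /monomial_entry /monomial_mul (nth_map (0%N, 0)) //= -/e.
  by rewrite !eqnE eqxx; case: eqP => _; rewrite ?mulr0.
rewrite !mxE /monomial_entry -/e ifF ?mul0r // eqnE; apply: contraNF ke => /eqP ke.
by apply/eqP/val_inj.
Qed.

Variables (p q : nat) (forms : seq monomial) (b1 b2 b2' : monomial).
Hypothesis check : clifford_check p q forms b1 b2 b2'.

(** The strict upper triangle, whose antisymmetrization in [two_step_form] restores the whole
    alternating form. *)
Definition upper_forms (l : 'I_p) : 'M[K]_q :=
  \matrix_(i, j) if (i < j)%N then (monomial_entry (nth [::] forms l) i j)%:~R else 0.

Lemma upper_formsE l : two_step_form upper_forms l = monomial_mx q (nth [::] forms l).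
Proof.
case/and5P: check => _ /all_iotaP/(_ l)/all_iotaP anti _ _ _.
have a i j := all_iotaP (anti i) j; apply/matrixP => i j; rewrite !mxE.
have aij := eqP (a i j); have [ij|ji|ij] := ltngtP i j; rewrite ?subr0 //.
  by rewrite aij mulrNz opprK add0r.
have := aij; rewrite (val_inj ij) => /eqP;
  rewrite -addr_eq0 -mulr2n mulrn_eq0 /= => /eqP ->.
by rewrite mulr0z.
Qed.

Lemma monomial_mx_scalar m (M : monomial) (c : int) :
  (forall i j : 'I_m, monomial_entry M i j = identity_entry c i j) ->
  monomial_mx m M = (c%:~R)%:M.
Proof.
move=> E; apply/matrixP => i j; rewrite !mxE E /identity_entry eqnE.
by rewrite -val_eqE; case: eqP.
Qed.

Let wf_forms (k : 'I_p) : (size (nth [::] forms k) == q) && all (fun e =>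
  e.1 < q)%N (nth [::] forms k).
Proof.
case/and5P: check => /and5P[/eqP sf /allP wf _ _ _] _ _ _ _.
by apply: wf; apply: mem_nth; rewrite sf.
Qed.

Let wf_b : [/\ size b1 = q, all (fun e =>
  e.1 < q)%N b1, size b2 = p & all (fun e => e.1 < p)%N b2].
Proof.
by case/and5P: check => /and5P[_ _ /andP[/eqP ? ?] /andP[/eqP ? ?] _] _ _ _ _.
Qed.

Let b1_sym : (monomial_mx q b1)^T = monomial_mx q b1.
Proof.
case/and5P: check => _ _ /all_iotaP b1c _ _; apply/matrixP => i j; rewrite !mxE.
by have /all_iotaP /(_ i) /andP[/eqP -> _] := b1c j.
Qed.

Let b1_sq : monomial_mx q b1 *m monomial_mx q b1 = 1%:M.
Proof.
have [s1 w1 _ _] := wf_b;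
  rewrite monomial_mx_mul // (@monomial_mx_scalar _ _ 1) // => i j.
by case/and5P: check => _ _ /all_iotaP /(_ i) /all_iotaP /(_ j) /andP[_ /eqP ->].
Qed.

Let b2_symE (k l : 'I_p) : monomial_entry b2 k l = monomial_entry b2 l k.
Proof.
by case/and5P: check => _ _ _ /all_iotaP /(_ k) /all_iotaP /(_ l) /andP[/eqP ->].
Qed.

Let b2_sym : (monomial_mx p b2)^T = monomial_mx p b2.
Proof. by apply/matrixP => i j; rewrite !mxE b2_symE. Qed.

Let b2_unit : monomial_mx p b2 \in unitmx.
Proof.
have [_ _ s2 w2] := wf_b; suff E : monomial_mx p b2 *m monomial_mx p b2' = 4%:M.
  have := unitmxE (4%:M : 'M[K]_p); rewrite det_scalar unitrX ?unitfE ?pnatr_eq0 //.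
  by rewrite -E unitmx_mul => /andP[].
rewrite monomial_mx_mul // (@monomial_mx_scalar _ _ 4) // => i j.
by case/and5P: check => _ _ _ /all_iotaP /(_ i) /all_iotaP /(_ j) /andP[_ /eqP ->].
Qed.

Lemma omega_monomial (k : 'I_p) :
  omega upper_forms (monomial_mx p b2) k *m monomial_mx q b1 =
  monomial_mx q (clifford_monomial forms b1 b2 k).
Proof.
have [s1 w1 s2 /allP w2] := wf_b; rewrite /clifford_monomial.
set e := nth (0%N, 0) b2 k; have ep : (e.1 < p)%N by apply: w2; apply: mem_nth;
  rewrite s2.
have /andP[/eqP sf wf] := wf_forms (Ordinal ep).
set M := [seq _ | e' <- _]; rewrite -monomial_mx_mul; first last.
- by rewrite all_map.
- by rewrite size_map.
congr (_ *m _); rewrite /omega (bigD1 (Ordinal ep)) //= big1 => [|l le].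
  rewrite addr0 mxE b2_symE upper_formsE /=; apply/matrixP => i j; rewrite !mxE.
  rewrite -intrM; congr _%:~R;
    rewrite /monomial_entry /M (nth_map (0%N, 0)) ?sf //= -/e.
  by rewrite eqnE eqxx; case: ifP; rewrite ?mulr0.
rewrite mxE b2_symE /monomial_entry -/e ifF ?scale0r // eqnE.
by apply: contraNF le => /eqP le; apply/eqP/val_inj.
Qed.

Lemma model_pseudo_H :
  pseudo_H_type (two_step_center upper_forms) (two_step_complement upper_forms).
Proof.
have [s1 w1 s2 w2] := wf_b.
have wfJ (k : 'I_p) : size (clifford_monomial forms b1 b2 k) = q /\
    all (fun e => e.1 < q)%N (clifford_monomial forms b1 b2 k).
  have /allP w2' := w2; have ep : ((nth (0%N, 0%R) b2 k).1 < p)%N.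
    by apply: w2'; apply: mem_nth; rewrite s2.
  have /andP[/eqP sf wf] := wf_forms (Ordinal ep).
  rewrite /clifford_monomial /monomial_mul !size_map; split=> //.
  rewrite !all_map; apply/allP => e ef /=; have /allP wf' := wf; have /allP w1' := w1.
  by apply: w1'; apply: mem_nth; rewrite s1; apply: wf'.
apply: (@pseudo_H_two_step _ _ _ _ (monomial_mx p b2) (monomial_mx q b1)) => //.
- move=> k l; rewrite !omega_monomial; have [sk wk] := wfJ k; have [sl wl] := wfJ l.
  rewrite !monomial_mx_mul //; apply/matrixP => i j; rewrite !mxE -intrD.
  case/and5P: check => _ _ _ _ /andP[/all_iotaP /(_ k) /all_iotaP /(_ l) + _].
  rewrite !(nth_map 0%N) ?size_iota // !nth_iota // !add0n.
  move=> /all_iotaP /(_ i) /all_iotaP /(_ j) /eqP ->.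
  rewrite /identity_entry eqnE val_eqE; case: eqP => _ //=.
  by rewrite mulr1n !intrM.
- case/and5P: check => _ _ _ _ /andP[_ /and3P[p0 q0 ne]].
  exists (Ordinal p0); rewrite upper_formsE; apply: contra_neq ne => z.
  set e := nth (0%N, 0) _ 0%N.
  have /andP[/eqP sf /allP wf] := wf_forms (Ordinal p0).
  have eq : (e.1 < q)%N by apply: wf; apply: mem_nth; rewrite sf.
  have /matrixP /(_ (Ordinal q0) (Ordinal eq)) := z; rewrite !mxE /= => /eqP.
  by rewrite intr_eq0 => /eqP.
Qed.

End Monomial.

(** * The gradings of E6 and F4 *)

Section Realification.
Variables (R : realType).
Local Notation C := R[i].
Local Notation rc := (real_complex R).

Definition complex_row (m : nat) (a b : 'rV[R]_m) : 'rV[C]_m :=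
  map_mx rc a + 'i%C *: map_mx rc b.

Lemma complex_rowE m (a b : 'rV[R]_m) j : complex_row a b 0 j = Complex (a 0 j) (b 0 j).
Proof.
by rewrite !mxE; apply/eqP; rewrite eq_complex /=; apply/andP; split; apply/eqP; ring.
Qed.

Lemma complex_rowK m (c : 'rV[C]_m) :
  complex_row (\row_j complex.Re (c 0 j)) (\row_j complex.Im (c 0 j)) = c.
Proof. by apply/rowP => j; rewrite complex_rowE !mxE; case: (c 0 j). Qed.

Lemma complex_row_eq0 m (a b : 'rV[R]_m) : complex_row a b = 0 -> a = 0 /\ b = 0.
Proof.
move=> /rowP ab; split; apply/rowP => j; have := ab j;
  rewrite complex_rowE !mxE => /eqP.
  by rewrite eq_complex => /andP[/eqP].
by rewrite eq_complex => /andP[_ /eqP].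
Qed.

Variables (p q : nat) (U : 'I_p -> 'M[R]_q).
Local Notation nC := (complexified R (two_step U)).

(** A complexified vector is a pair of pairs ((z, x), (z', x')); it is regrouped as z + i z' and x +
    i x'. *)
Definition degree2_coord (u : nC) : 'rV[C]_p := complex_row u.1.1 u.2.1.
Definition degree1_coord (u : nC) : 'rV[C]_q := complex_row u.1.2 u.2.2.

Lemma degree2_coord_linear : linear degree2_coord.
Proof.
move=> c u v; rewrite /degree2_coord; apply/rowP => j.
rewrite [RHS]mxE [X in _ = X + _]mxE !complex_rowE.
case: c => c1 c2; rewrite /= !mxE.
by apply/eqP; rewrite eq_complex /=; apply/andP; split; apply/eqP; ring.
Qed.

Lemma degree1_coord_linear : linear degree1_coord.
Proof.
move=> c u v; rewrite /degree1_coord; apply/rowP => j.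
rewrite [RHS]mxE [X in _ = X + _]mxE !complex_rowE.
case: c => c1 c2; rewrite /= !mxE.
by apply/eqP; rewrite eq_complex /=; apply/andP; split; apply/eqP; ring.
Qed.

Lemma degree1_coord_lie u v : degree1_coord [lie u, v] = 0.
Proof.
by apply/rowP => j; rewrite /degree1_coord complex_rowE mxE /= !mxE subr0 addr0.
Qed.

Lemma degree2_coord_lie u v l : degree2_coord [lie u, v] 0 l =
  \sum_i \sum_j rc (two_step_form U l i j) * degree1_coord u 0 i * degree1_coord v 0 j.
Proof.
have E (x y : 'rV[R]_q) : (x *m two_step_form U l *m y^T) 0 0 =
    \sum_i \sum_j two_step_form U l i j * x 0 i * y 0 j.
  rewrite mxE exchange_big; apply: eq_bigr => j _; rewrite mxE [y^T _ _]mxE mulr_suml.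
  by apply: eq_bigr => i _; rewrite [x 0 i * _]mulrC.
have BE x y : two_step_bracket U x y 0 l =
    \sum_i \sum_j two_step_form U l i j * x 0 i * y 0 j by rewrite mxE E.
rewrite /degree2_coord /degree1_coord complex_rowE /=.
rewrite [X in Complex X _]mxE [X in Complex _ X]mxE [X in Complex (_ + X) _]mxE !BE.
have Re_sum I (s : seq I) (f : I -> C) : complex.Re (\sum_(i <- s) f i) = \sum_(i
  <- s) complex.Re (f i).
  by apply: (big_morph _ _ (erefl _)) => -[? ?] [? ?].
have Im_sum I (s : seq I) (f : I -> C) : complex.Im (\sum_(i <- s) f i) = \sum_(i
  <- s) complex.Im (f i).
  by apply: (big_morph _ _ (erefl _)) => -[? ?] [? ?].
apply/eqP; rewrite eq_complex /= Re_sum Im_sum.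
apply/andP; split; apply/eqP; rewrite -?sumrB -?big_split; apply: eq_bigr => i _;
  rewrite ?Re_sum ?Im_sum -?sumrB -?big_split; apply: eq_bigr => j _;
  rewrite /= !complex_rowE /=; ring.
Qed.

End Realification.

Section NegativePartIso.
Variables (R : realType) (t : exceptional) (L : lieAlgType R[i]) (h : {vspace L}).
Variables (alpha : 'I_(rank t) -> functional h) (Sigma : {set 'I_(rank t)}).
Hypothesis ex : exceptional_lie t alpha.
Local Notation C := R[i].
Local Notation m := (mask_of Sigma).
Local Notation deg1 := (graded_piece t m 1).
Local Notation deg2 := (graded_piece t m 2).
Local Notation p := (size deg2).
Local Notation q := (size deg1).
Variables (forms : seq monomial) (b1 b2 b2' : monomial).
Hypotheses (check : clifford_check p q forms b1 b2 b2')
  (bcheck : brackets_check t m forms)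
  (height2 : all (fun s => mask_height (rank t) m s <= 2)%N (positive_roots t))
  (p_gt1 : (1 < p)%N).
Variable F : seq nat -> L.
Hypotheses (FP : root_vector_family alpha F) (FB : bracket_family t F).
Local Notation n := (two_step (@upper_forms R p q forms)).
Local Notation nC := (complexified R n).

Let iso_fun (u : nC) : L :=
  \sum_l degree2_coord u 0 l *: F (nth [::] deg2 l) +
  \sum_i degree1_coord u 0 i *: F (nth [::] deg1 i).

Fact iso_fun_linear : linear iso_fun.
Proof.
move=> c u v; rewrite /iso_fun degree2_coord_linear degree1_coord_linear.
rewrite [X in _ = X + _]scalerDr [RHS]addrACA; congr (_ + _);
  rewrite scaler_sumr -big_split; apply: eq_bigr => i _;
  by rewrite mxE [X in X + _]mxE /= scalerDl scalerA.
Qed.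

HB.instance Definition _ := GRing.isLinear.Build C nC L _ iso_fun iso_fun_linear.

Let piece_root k s : s \in graded_piece t m k ->
  s \in positive_roots t /\ mask_height (rank t) m s = k.
Proof. by rewrite mem_filter => /andP[/eqP]. Qed.

Let piece_uniq k : uniq (graded_piece t m k).
Proof. by rewrite filter_uniq // positive_roots_uniq. Qed.

Let piece_size k s : s \in graded_piece t m k -> size s = rank t.
Proof. by case/piece_root => sr _;
  apply: root_list_size (positive_roots_check t) _ sr. Qed.

Let mask_height_add s u :
  mask_height (rank t) m (seq_add (rank t) s u) =
  (mask_height (rank t) m s + mask_height (rank t) m u)%N.
Proof.
apply/eqP; rewrite -eqz_nat PoszD -!mask_heightE /height -big_split; apply/eqP.
apply: eq_bigr => i _ /=; rewrite (nth_map 0%N) ?size_iota //.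
by rewrite nth_iota // PoszD.
Qed.

Let lie_high j k s u : s \in graded_piece t m j -> u \in graded_piece t m k ->
  (2 < j + k)%N -> [lie F s, F u] = 0.
Proof.
move=> /piece_root[sr sh] /piece_root[ur uh] jk.
have [c [-> c0]] := root_vector_lie ex FP sr ur; rewrite c0 ?scale0r //.
apply/negP => sur; have /allP /(_ _ sur) := height2.
by rewrite mask_height_add sh uh leqNgt jk.
Qed.

Let lie_deg1 (i j : 'I_q) : [lie F (nth [::] deg1 i), F (nth [::] deg1 j)] =
  \sum_l (real_complex R (two_step_form (@upper_forms R p q forms) l i j)) *: F
    (nth [::] deg2 l).
Proof.
have sd := mem_nth [::] (ltn_ord i); have ud := mem_nth [::] (ltn_ord j).
set s := nth [::] deg1 i in sd *; set u := nth [::] deg1 j in ud *.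
have := bcheck => /all_iotaP /(_ i) /all_iotaP /(_ j); cbv beta zeta; rewrite -/s -/u.
case e: bracket_coef => [k|] // /andP [mk] /all_iotaP kl.
rewrite (FB (piece_size sd) (piece_size ud) e).
transitivity (\sum_(l < p) (if seq_add (rank t) s u == nth [::] deg2 l then k else
  0)%:~R *: F (nth [::] deg2 l)); last first.
  apply: eq_bigr => l _; congr (_ *: _).
  rewrite (upper_formsE _ check) mxE (eqP (kl l)) eq_natsE.
  by rewrite rmorph_int.
have [->|/negPf k0] := eqVneq k 0.
  by rewrite scale0r big1 // => l _; rewrite if_same scale0r.
move: mk; rewrite k0 nats_memE => gd.
have ig : (index (seq_add (rank t) s u) deg2 < p)%N by rewrite index_mem.
rewrite (bigD1 (Ordinal ig)) //= nth_index // eqxx big1 ?addr0 // => l li.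
rewrite ifF ?scale0r //; apply: contraNF li => /eqP li.
by apply/eqP/val_inj; rewrite /= li index_uniq.
Qed.

Lemma iso_fun_lie u v : iso_fun [lie u, v] = [lie iso_fun u, iso_fun v].
Proof.
have sumlie I J (s : seq I) (w : seq J) (f : I -> L) (g : J -> L) :
    [lie \sum_(i <- s) f i,
      \sum_(j <- w) g j] = \sum_(i <- s) \sum_(j <- w) [lie f i, g j].
  rewrite linear_sum exchange_big /=; apply: eq_bigr => j _.
  by rewrite lieC linear_sum -sumrN; apply: eq_bigr => i _; rewrite [RHS]lieC.
rewrite {1}/iso_fun degree1_coord_lie [X in _ + X]big1 ?addr0 => [|i _];
  last by rewrite mxE scale0r.
rewrite /iso_fun lieDl !lieDr !sumlie.
have z j k (c : 'I_(size (graded_piece t m j)) -> C) (d : 'I_(size (graded_piece t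
  m k)) -> C) :
    (2 < j + k)%N -> \sum_i \sum_l [lie c i *: F (nth [::] (graded_piece t m j) i),
      d l *: F (nth [::] (graded_piece t m k) l)] = 0.
  move=> jk; rewrite big1 // => i _; rewrite big1 // => l _.
  by rewrite lieZl lieZr (@lie_high j k) ?scaler0 // mem_nth.
(* No root has height above 2, so only the bracket of the two degree -1 parts survives. *)
rewrite (z 2 2)%N // (z 2 1)%N // (z 1 2)%N // !add0r.
under eq_bigr do rewrite degree2_coord_lie scaler_suml.
rewrite exchange_big /=; apply: eq_bigr => i _.
under eq_bigr do rewrite scaler_suml.
rewrite exchange_big /=; apply: eq_bigr => j _.
rewrite lieZl lieZr lie_deg1 !scaler_sumr; apply: eq_bigr => l _.
by rewrite !scalerA; congr (_ *: _); ring.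
Qed.

Let graded_coef (g : seq (seq nat)) (c : 'rV[C]_(size g)) (s : seq nat) : C :=
  if insub (index s g) is Some i then c 0 i else 0.

Let graded_coefE (g : seq (seq nat)) (c : 'rV[C]_(size g)) (i : 'I_(size g)) :
  uniq g -> graded_coef c (nth [::] g i) = c 0 i.
Proof. by move=> gu; rewrite /graded_coef index_uniq // valK. Qed.

Let graded_sumE (g : seq (seq nat)) (c : 'rV[C]_(size g)) : uniq g ->
  \sum_i c 0 i *: F (nth [::] g i) = \sum_(s <- g) graded_coef c s *: F s.
Proof.
move=> gu; rewrite (big_nth [::]) big_mkord; apply: eq_bigr => i _.
by rewrite graded_coefE.
Qed.

Lemma iso_fun_injective : injective iso_fun.
Proof.
move=> u v uv; apply/eqP; rewrite -subr_eq0; apply/eqP.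
have : iso_fun (u - v) = 0 by rewrite linearB /= uv subrr.
set w := u - v; rewrite /iso_fun !graded_sumE // !big_filter !(big_mkcond (fun s =>
  mask_height _ _ s == _)).
rewrite -big_split /= => w0.
(* The two degrees are merged into one sum over all positive roots, to which the freeness of the
   root vectors applies. *)
pose c s := (if mask_height (rank t) m s == 2 then graded_coef (degree2_coord w) s
  else 0) +
  (if mask_height (rank t) m s == 1%N then graded_coef (degree1_coord w) s else 0).
have c0 : forall s, s \in positive_roots t -> c s = 0.
  apply: (root_vector_free ex FP); rewrite -[RHS]w0; apply: eq_bigr => s _.
  by rewrite /c scalerDl; congr (_ + _); case: ifP => // _; rewrite scale0r.
have cz k (d : 'rV[C]_(size (graded_piece t m k))) :
    (forall s, s \in graded_piece t m k -> graded_coef d s = c s) -> d = 0.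
  move=> dc; apply/rowP => i; rewrite mxE -(graded_coefE d) //.
  have sd := mem_nth [::] (ltn_ord i); rewrite dc // c0 //.
  by have [] := piece_root sd.
have /complex_row_eq0[z1 z2] : degree2_coord w = 0.
  by apply: cz => s /piece_root[_ sh]; rewrite /c sh /= addr0.
have /complex_row_eq0[x1 x2] : degree1_coord w = 0.
  by apply: cz => s /piece_root[_ sh]; rewrite /c sh /= add0r.
by case: w z1 z2 x1 x2 {w0 c c0 cz} => [[? ?] [? ?]] /= -> -> -> ->.
Qed.

Lemma iso_fun_image k :
  (iso_fun @` complexified_grading (two_step_center (@upper_forms R p q forms))
    (two_step_complement (@upper_forms R p q forms)) k)%classic =
  negative_part (sigma_grading alpha Sigma) k.
Proof.
have sum0 j (c : 'I_j -> C) (G : 'I_j -> L) : (forall i,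
  c i = 0) -> \sum_i c i *: G i = 0.
  by move=> c0; rewrite big1 // => i _; rewrite c0 scale0r.
have c00 j (a b : 'rV[R]_j) i : a = 0 -> b = 0 -> complex_row a b 0 i = 0.
  by move=> -> ->; rewrite complex_rowE !mxE.
rewrite /complexified_grading; have [->|k2] := eqVneq k (-2).
  apply/seteqP; split=> [_ [u [/= u1 u2] <-]|x xG].
    apply/(graded_piece_sum ex Sigma _ FP (isT : 0 < 2)%N).
    move: u1 u2; rewrite !mem_two_step_center => /eqP u1 /eqP u2.
    exists (graded_coef (degree2_coord u)).
    rewrite /iso_fun graded_sumE // [X in _ + X]sum0 ?addr0 // => i.
    exact: c00.
  have [c xE] := (graded_piece_sum ex Sigma x FP (isT : 0 < 2)%N).1 xG.
  pose d : 'rV[C]_p := \row_l c (nth [::] deg2 l).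
  exists ((\row_l complex.Re (d 0 l), 0), (\row_l complex.Im (d 0 l), 0)).
    by split; rewrite mem_two_step_center.
  rewrite /iso_fun [X in _ + X]sum0 ?addr0 => [|i]; last exact: c00.
  rewrite xE (big_nth [::]) big_mkord; apply: eq_bigr => l _.
  by rewrite /degree2_coord /= complex_rowK mxE.
have [->|k1] := eqVneq k (-1).
  apply/seteqP; split=> [_ [u [/= u1 u2] <-]|x xG].
    apply/(graded_piece_sum ex Sigma _ FP (isT : 0 < 1)%N).
    move: u1 u2; rewrite !mem_two_step_complement => /eqP u1 /eqP u2.
    exists (graded_coef (degree1_coord u)).
    rewrite /iso_fun [X in X + _]sum0 ?add0r => [|i]; last exact: c00.
    exact: graded_sumE.
  have [c xE] := (graded_piece_sum ex Sigma x FP (isT : 0 < 1)%N).1 xG.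
  pose d : 'rV[C]_q := \row_l c (nth [::] deg1 l).
  exists ((0, \row_l complex.Re (d 0 l)), (0, \row_l complex.Im (d 0 l))).
    by split; rewrite mem_two_step_complement.
  rewrite /iso_fun [X in X + _]sum0 ?add0r => [|i]; last exact: c00.
  rewrite xE (big_nth [::]) big_mkord; apply: eq_bigr => l _.
  by rewrite /degree1_coord /= complex_rowK mxE.
have imE : (iso_fun @` [set 0] = [set 0])%classic.
  apply/seteqP; split=> [_ [_ -> <-]|_ ->]; first exact: linear0.
  by exists 0 => //; apply: linear0.
rewrite imE /negative_part; case: ifP => // k0.
(* What remains are the degrees below -2, where the grading vanishes because no root has height
   above 2. *)
have [j kE] : exists j : nat, k = - (j.+3)%:Z.
  case: k k0 k1 k2 => // -[|[|j]] // _ _ _; exists j; by rewrite NegzE.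
have G0 x : sigma_grading alpha Sigma k x <-> x = 0.
  have g0 : graded_piece t m j.+3 = [::].
    apply/eqP; rewrite -(negbK (_ == _)) -has_filter -all_predC;
      apply: sub_all height2 => s /=.
    by move=> s2; rewrite neq_ltn ltnS (leq_trans s2).
  rewrite kE; have G := graded_piece_sum ex Sigma x FP (ltn0Sn j.+2).
  split=> [/G [c ->]|->]; first by rewrite g0 big_nil.
  by apply/(graded_piece_sum ex Sigma 0 FP (ltn0Sn j.+2)); exists (fun=> 0);
    rewrite g0 big_nil.
by apply/seteqP; split=> x /G0.
Qed.

Lemma negative_part_model : negative_part_pseudo_H (sigma_grading alpha Sigma).
Proof.
exists n, (two_step_center (@upper_forms R p q forms)),
  (two_step_complement (@upper_forms R p q forms)).
split; first exact: model_pseudo_H check.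
  by rewrite dim_two_step_center.
exists (linfun iso_fun); split=> [u v|u v|k].
- by rewrite !lfunE; apply: iso_fun_injective.
- by rewrite !lfunE; apply: iso_fun_lie.
rewrite -iso_fun_image; apply/seteqP.
by split=> _ [u uG <-]; exists u; rewrite ?lfunE.
Qed.

End NegativePartIso.

(** The mask and the sizes are variables tied by equations, so that the certificates, computed on
    literal lists, can be used for a finite set Sigma, which does not evaluate. *)
Lemma model_of_mask (R : realType) (t : exceptional) (L : lieAlgType R[i])
    (h : {vspace L}) (alpha : 'I_(rank t) -> functional h)
    (Sigma : {set 'I_(rank t)}) (m : bitseq) p q forms b1 b2 b2' :
  exceptional_lie t alpha -> t <> G2 -> mask_of Sigma = m ->
  mask_height (rank t) m (highest_seq t) = 2 ->
  size (graded_piece t m 2) = p -> size (graded_piece t m 1) = q ->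
  clifford_check p q forms b1 b2 b2' -> brackets_check t m forms ->
  all (fun s => mask_height (rank t) m s <= 2)%N (positive_roots t) -> (1 < p)%N ->
  two_grading alpha Sigma /\ negative_part_pseudo_H (sigma_grading alpha Sigma).
Proof.
move=> ex tG <- h2 <- <- check bcheck height2 p1.
split; first exact/(two_gradingE ex).
have [F FP /(_ tG) FB] := root_vector_family_exists ex.
exact: (negative_part_model ex check bcheck height2 p1 FP FB).
Qed.

Lemma mask_of_Sigma16 : mask_of Sigma16 = E6_mask.
Proof.
apply: (@eq_from_nth _ false); first by rewrite size_mask_of.
move=> k; rewrite size_mask_of => k6; rewrite (nth_mask_of _ (Ordinal k6)) inE /=.
by do 6!case: k k6 => [|k] k6 //.
Qed.

Lemma mask_of_Sigma4 : mask_of Sigma4 = F4_mask.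
Proof.
apply: (@eq_from_nth _ false); first by rewrite size_mask_of.
move=> k; rewrite size_mask_of => k4; rewrite (nth_mask_of _ (Ordinal k4)) inE /=.
by do 4!case: k k4 => [|k] k4 //.
Qed.

Theorem theorem7 (R : realType) :
  [/\ forall (L : lieAlgType R[i]) (h : {vspace L})
        (alpha : 'I_(rank E6) -> functional h),
        exceptional_lie E6 alpha ->
        two_grading alpha Sigma16 /\
        negative_part_pseudo_H (sigma_grading alpha Sigma16),
      forall (L : lieAlgType R[i]) (h : {vspace L})
        (alpha : 'I_(rank F4) -> functional h),
        exceptional_lie F4 alpha ->
        two_grading alpha Sigma4 /\
        negative_part_pseudo_H (sigma_grading alpha Sigma4) &
      forall (t : exceptional) (L : lieAlgType R[i]) (h : {vspace L})
        (alpha : 'I_(rank t) -> functional h) (Sigma : {set 'I_(rank t)}),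
        exceptional_lie t alpha ->
        two_grading alpha Sigma ->
        negative_part_pseudo_H (sigma_grading alpha Sigma) ->
        graded_iso_to (sigma_grading alpha Sigma) E6 Sigma16 \/
        graded_iso_to (sigma_grading alpha Sigma) F4 Sigma4].
Proof.
split=> [L h alpha ex|L h alpha ex|t L h alpha Sigma];
  last exact: pseudo_H_classification.
  by apply: (model_of_mask ex _ mask_of_Sigma16 _ _ _ E6_clifford_check
    E6_brackets_check) => //;
    vm_compute.
by apply: (model_of_mask ex _ mask_of_Sigma4 _ _ _ F4_clifford_check
  F4_brackets_check) => //;
  vm_compute.
Qed.
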